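(* Let $T>0$, let $f\in C^1([0,T])$ with $f(0)=0$. Then the problem \[ \theta_t(x,t)=\int_0^t N(t-s)\,\theta_{xx}(x,s)\,ds,\quad x\in(0,\pi),\ t\in(0,T],\qquad \theta(x,0)=0,\quad \theta(0,t)=f(t),\quad \theta(\pi,t)=0, \] admits a unique solution $\theta\in C([0,T];L^2(0,\pi))$, where ''solution'' means the following: the function $\eta(x,t):=\theta(x,t)-\frac{\pi-x}{\pi}f(t)$ belongs to $C([0,T];L^2(0,\pi))$, satisfies $A\int_0^t a(t-s)\eta(s)\,ds\in C([0,T];L^2(0,\pi))$ and \[ \eta(t)=A\int_0^t a(t-s)\eta(s)\,ds-\frac{\pi-x}{\pi}f(t),\qquad t\in[0,T]. \]
   Context: Standing assumptions on the relaxation kernel $N:(0,+\infty)\to\mathbb R$: (a) $N\in L^1(0,T)$ for every $T>0$; its Laplace transform $\hat N(\lambda)$ is defined and holomorphic on $\Pi_0=\{\lambda\in\mathbb C:\operatorname{Re}\lambda>0\}$ and maps $\Pi_0$ into itself (i.e. $\hat N$ is a positive real function); (b) on $\Pi_0$, $\hat N(\lambda)=\alpha\lambda^{-\gamma}+\lambda^{-\gamma-\sigma}N_1(\lambda)$ with $\alpha>0$, $\gamma\in(0,1)$, $\sigma>0$, $N_1$ holomorphic and bounded on $\Pi_0$, and $\operatorname{Re}\big(N_1(\lambda)\lambda^{-\sigma}\big)\ge 0$ on $\Pi_0$ (principal branches of powers); (c) there is a polynomial $p$ with $\int_0^t|N(s)|\,ds<p(t)$ for all $t>0$. $A$ denotes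 the operator $A\phi=\phi''$ in $L^2(0,\pi)$ with domain $\{\phi\in H^2(0,\pi):\phi(0)=\phi(\pi)=0\}$, and $a(t)=\int_0^tN(s)\,ds$. *)

(* Defs.v *)
From mathcomp Require Import all_boot all_order all_algebra.
From mathcomp Require Import all_classical all_reals all_analysis.
From mathcomp Require Import complex.
Import Order.TTheory GRing.Theory Num.Theory.
Import numFieldNormedType.Exports.

Set Implicit Arguments.
Unset Strict Implicit.
Unset Printing Implicit Defensive.

Local Open Scope ring_scope.
Local Open Scope classical_set_scope.

Notation leb R := (@lebesgue_measure R).

Definition cabs (R : realType) (z : R[i]) : R :=
  Num.sqrt (complex.Re z ^+ 2 + complex.Im z ^+ 2).

(* principal argument, valid on the right half plane Re z > 0 *)
Definition carg_rhp (R : realType) (z : R[i]) : R :=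
  atan (complex.Im z / complex.Re z).

Definition cpow_rhp (R : realType) (z : R[i]) (s : R) : R[i] :=
  ((cabs z `^ s * cos (s * carg_rhp z)) +i*
   (cabs z `^ s * sin (s * carg_rhp z)))%C.

Definition holomorphic_rhp (R : realType) (F : R[i] -> R[i]) : Prop :=
  forall z : R[i], 0 < complex.Re z ->
    derivable (F : (R[i] : numFieldType)^o -> (R[i] : numFieldType)^o) z 1.

(* Laplace transform of N : (0,+oo) -> R at complex lambda = x + i y:
   \int_0^oo e^{-lambda t} N(t) dt
   = \int e^{-xt} cos(yt) N(t) dt - i \int e^{-xt} sin(yt) N(t) dt *)
Definition laplace (R : realType) (N : R -> R) (z : R[i]) : R[i] :=
  ((\int[leb R]_(t in `]0, +oo[)
       (expR (- complex.Re z * t) * cos (complex.Im z * t) * N t)) +i*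
   (- \int[leb R]_(t in `]0, +oo[)
       (expR (- complex.Re z * t) * sin (complex.Im z * t) * N t)))%C.

Definition relax_a (R : realType) (N : R -> R) (t : R) : R :=
  \int[leb R]_(s in `]0, t[) N s.

Definition kernel_assumptions (R : realType) (N : R -> R) : Prop :=
  (forall T : R, 0 < T -> (leb R).-integrable `]0, T[ (EFin \o N)) /\
  (forall z : R[i], 0 < complex.Re z ->
     (leb R).-integrable `]0, +oo[
        (fun t => (expR (- complex.Re z * t) * N t)%:E)) /\
  holomorphic_rhp (laplace N) /\
  (forall z : R[i], 0 < complex.Re z -> 0 < complex.Re (laplace N z)) /\
  (exists (alpha gamma sigma : R) (N1 : R[i] -> R[i]),
     [/\ 0 < alpha, 0 < gamma < 1 & 0 < sigma] /\
     [/\ holomorphic_rhp N1,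
         (exists M : R, forall z : R[i], 0 < complex.Re z -> cabs (N1 z) <= M),
         (forall z : R[i], 0 < complex.Re z ->
            0 <= complex.Re (N1 z * cpow_rhp z (- sigma))) &
         (forall z : R[i], 0 < complex.Re z ->
            laplace N z = (alpha +i* 0)%C * cpow_rhp z (- gamma)
                          + cpow_rhp z (- gamma - sigma) * N1 z)]) /\
  (exists p : {poly R}, forall t : R, 0 < t ->
     \int[leb R]_(s in `]0, t[) `|N s| < p.[t]).

Definition L2 (R : realType) (g : R -> R) : Prop :=
  measurable_fun `]0, pi[ g /\
  (\int[leb R]_(x in `]0%R, pi[) ((g x) ^+ 2)%:E < +oo)%E.

Definition L2dist2 (R : realType) (g h : R -> R) : \bar R :=
  (\int[leb R]_(x in `]0%R, pi[) ((g x - h x) ^+ 2)%:E)%E.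

Definition L2inner (R : realType) (g h : R -> R) : R :=
  \int[leb R]_(x in `]0, pi[) (g x * h x).

Definition L2eq (R : realType) (g h : R -> R) : Prop :=
  g = h %[ae leb R in `]0, pi[].

Definition CL2 (R : realType) (T : R) (u : R -> R -> R) : Prop :=
  (forall t, t \in `[0, T] -> L2 (u t)) /\
  (forall t, t \in `[0, T] -> forall e : R, 0 < e ->
     exists2 d : R, 0 < d & forall s, s \in `[0, T] -> `|s - t| < d ->
       (L2dist2 (u s) (u t) < e%:E)%E).

(* w t = \int_0^t k(t-s) u(s) ds  (L^2(0,pi)-valued integral, characterized
   weakly: <w t, phi> = \int_0^t k(t-s) <u s, phi> ds for all phi in L^2;
   for continuous u this is the Bochner integral) *)
Definition is_conv_integral (R : realType) (T : R) (k : R -> R)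
    (u w : R -> R -> R) : Prop :=
  forall t, t \in `[0, T] ->
    L2 (w t) /\
    forall phi : R -> R, L2 phi ->
      L2inner (w t) phi = \int[leb R]_(s in `]0, t[) (k (t - s) * L2inner (u s) phi).

(* w belongs to D(A) = H^2(0,pi) \cap H^1_0(0,pi) and A w = w'' = v.
   H^2(0,pi) is described by its classical characterization on an interval:
   w has a representative U with U, U' absolutely continuous on [0,pi]
   and U'' = v in L^2(0,pi). *)
Definition domA_with_value (R : realType) (w v : R -> R) : Prop :=
  L2 v /\
  exists U U1 : R -> R,
    [/\ L2eq w U,
        (forall x, x \in `[0, pi] -> U x = U 0 + \int[leb R]_(y in `]0, x[) U1 y),
        (forall x, x \in `[0, pi] -> U1 x = U1 0 + \int[leb R]_(y in `]0, x[) v y),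
        U 0 = 0 & U pi = 0].

Definition C1_on (R : realType) (T : R) (f : R -> R) : Prop :=
  {within `[0, T], continuous f} /\
  (forall t, t \in `]0, T[ -> derivable f t 1) /\
  exists2 g : R -> R, {within `[0, T], continuous g} &
    forall t, t \in `]0, T[ -> f^`() t = g t.

Definition is_solution (R : realType) (N : R -> R) (T : R) (f : R -> R)
    (theta : R -> R -> R) : Prop :=
  let eta := fun t x => theta t x - (pi - x) / pi * f t in
  CL2 T eta /\
  exists w v : R -> R -> R,
    [/\ is_conv_integral T (relax_a N) eta w,
        (forall t, t \in `[0, T] -> domA_with_value (w t) (v t)),
        CL2 T v &
        (forall t, t \in `[0, T] ->
           L2eq (eta t) (fun x => v t x - (pi - x) / pi * f t))].

(* Main.v *)
(* In the basis of the sines, the mode of index n of [eta] is -2/(pi n) times the solution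
   y of the scalar Volterra equation y + n^2 (a * y) = f.  Since f(0) = 0 and f is C^1, the
   modes are summable in L^2 as soon as y is bounded uniformly in n.  With z(t) = e^{-t} y(t)
   and M(r) = e^{-r} N(r), the energy identity for z(tau)^2 contains the factor n^2 only
   through - n^2 \int z (M * z), and this is nonpositive because Re \hat N >= 0 on the line
   Re lambda = 1.  The positivity is obtained without Fourier inversion: the second
   differences of sum (1 - cos nx) / n^2 = pi x / 2 - x^2 / 4 exhibit tent functions as
   limits of cosine sums with nonnegative coefficients, and narrow tents are an
   approximate identity.

   For uniqueness, two integrations by parts show that the modes of the difference of two
   solutions solve homogeneous Volterra equations, so they vanish.  The same quadratic
   series, taken at x - xi and x + xi, says that a function orthogonal to all sines is
   orthogonal to the Green function pi min(x, xi) - x xi, and it is therefore zero. *)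

(* The obstacle is that [N] is merely integrable while n^2 is unbounded: a Gronwall estimate for y +
   n^2 (a * y) = f grows with n. Since a * y = N * Y with Y the primitive of y, the equation can be
   differentiated without touching [N], giving y' = f' - n^2 (N * y). This is where f in C^1 enters;
   f(0) = 0 lets f be continued by 0 to negative times without a jump. The factor e^{-t} gives a
   kernel integrable on the half-line, where [laplace N] is controlled for Re lambda > 0 only, and
   it adds to (z^2)' the term - 2 z^2, which absorbs the source. Bounded y give coefficients of eta
   of order 1/n, so its series is controlled in L^2 and not pointwise. The element of D(A) is
   therefore built from the other end, as a double primitive of theta whose slope at 0 is read off a
   cosine series; its value at pi is then the limit of sine sums that vanish there. Nearly all
   limits are taken along n = 8^k with explicit errors, so that an identity reduces to a bound of a
   difference by c / 2^k for every k. *)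
Require Import Defs.
From mathcomp Require Import all_boot all_order all_algebra.
From mathcomp Require Import all_classical all_reals all_analysis.
From mathcomp Require Import complex.
From mathcomp Require Import measurable_realfun ring lra.
Import Order.TTheory GRing.Theory Num.Theory.
Import numFieldNormedType.Exports.

Set Implicit Arguments.
Unset Strict Implicit.
Unset Printing Implicit Defensive.

Local Open Scope ring_scope.
Local Open Scope classical_set_scope.

(** * Lebesgue integrals of real functions *)

Section toolkit.
Context {R : realType}.
Notation mu := (leb R).
Implicit Types (D : set (measurableTypeR R)) (f g h : R -> R).

Lemma integrable_fun D f : mu.-integrable D (EFin \o f) -> measurable_fun D f.
Proof. by move/measurable_int/measurable_EFinP. Qed.

Lemma integrable_le D f g : measurable D -> measurable_fun D f ->
  (forall x, D x -> `|f x| <= g x) ->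
  mu.-integrable D (EFin \o g) -> mu.-integrable D (EFin \o f).
Proof.
move=> mD mf fg; apply: le_integrable => //; first exact/measurable_EFinP.
move=> x Dx; rewrite /= lee_fin (le_trans (fg _ Dx))//; exact: ler_norm.
Qed.

Lemma integrable_scale D f (k : R) : measurable D ->
  mu.-integrable D (EFin \o f) -> mu.-integrable D (EFin \o (fun x => k * f x)).
Proof. by move=> mD fi; exact: (integrableZl mD k fi). Qed.

Lemma integrable_add D f g : measurable D -> mu.-integrable D (EFin \o f) ->
  mu.-integrable D (EFin \o g) -> mu.-integrable D (EFin \o (fun x => f x + g x)).
Proof. by move=> mD fi gi; exact: (integrableD mD fi gi). Qed.

Lemma integrable_sub D f g : measurable D -> mu.-integrable D (EFin \o f) ->
  mu.-integrable D (EFin \o g) -> mu.-integrable D (EFin \o (fun x => f x - g x)).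
Proof.
move=> mD fi gi; have := integrableB mD fi gi.
by congr integrable; apply/funext => x /=; rewrite EFinB.
Qed.

Lemma integrable_mul_bounded D f h (B : R) : measurable D ->
  mu.-integrable D (EFin \o f) -> measurable_fun D h ->
  (forall x, D x -> `|h x| <= B) ->
  mu.-integrable D (EFin \o (fun x => f x * h x)).
Proof.
move=> mD fi mh hB.
apply: (@integrable_le D _ (fun x => B * `|f x|)) => //.
- by apply: measurable_funM => //; exact: integrable_fun.
- by move=> x Dx; rewrite normrM mulrC ler_wpM2r// hB.
- by apply: integrable_scale => //; exact: integrable_norm.
Qed.

Lemma le_norm_Rintegral_mul D f h (B : R) : measurable D ->
  mu.-integrable D (EFin \o f) -> measurable_fun D h ->
  (forall x, D x -> `|h x| <= B) ->
  `|\int[mu]_(x in D) (f x * h x)| <= B * \int[mu]_(x in D) `|f x|.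
Proof.
move=> mD fi mh hB.
have fhi := integrable_mul_bounded mD fi mh hB.
apply: le_trans (le_normr_Rintegral mD fhi) _.
rewrite -RintegralZl//; last exact: integrable_norm.
apply: le_Rintegral => //; first exact: integrable_norm.
- by apply: integrable_scale => //; exact: integrable_norm.
- by move=> x Dx; rewrite normrM mulrC ler_wpM2r// hB.
Qed.

Lemma mu_itvoo (a b : R) : a <= b -> mu `]a, b[ = (b - a)%:E.
Proof.
move=> ab; rewrite lebesgue_measure_itv/= lte_fin.
by move: ab; case: ltgtP => // -> _; rewrite subrr.
Qed.

Lemma mu_itvoo_lty (a b : R) : (mu `]a, b[ < +oo)%E.
Proof. by rewrite lebesgue_measure_itv/=; case: ifPn => // _; rewrite ltry. Qed.

Lemma integrable_cst_itv (a b c : R) : mu.-integrable `]a, b[ (EFin \o cst c).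
Proof.
apply: measurable_bounded_integrable => //; first exact: mu_itvoo_lty.
exact: bounded_cst.
Qed.

Lemma integrable_bounded_itv (a b B : R) h : measurable_fun `]a, b[ h ->
  (forall x, a < x < b -> `|h x| <= B) ->
  mu.-integrable `]a, b[ (EFin \o h).
Proof.
move=> mh hB; apply: (@integrable_le _ _ (cst B)) => //.
exact: integrable_cst_itv.
Qed.

Lemma Rintegral_cst_itv (a b c : R) : a <= b ->
  \int[mu]_(x in `]a, b[) c = c * (b - a).
Proof. by move=> ab; rewrite Rintegral_cst//; have := mu_itvoo ab; rewrite /= => ->. Qed.

Lemma le_norm_Rintegral_itv (a b B : R) h : a <= b ->
  measurable_fun `]a, b[ h ->
  (forall x, a < x < b -> `|h x| <= B) ->
  `|\int[mu]_(x in `]a, b[) h x| <= B * (b - a).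
Proof.
move=> ab mh hB; have hi := integrable_bounded_itv mh hB.
apply: le_trans (le_normr_Rintegral _ hi) _ => //.
rewrite -Rintegral_cst_itv//; apply: le_Rintegral => //.
- exact: integrable_norm.
- exact: integrable_cst_itv.
Qed.

Lemma continuous_integrable_itv (a b : R) h : {within `[a, b], continuous h} ->
  mu.-integrable `]a, b[ (EFin \o h).
Proof.
move=> ch; have := continuous_compact_integrable (@segment_compact _ a b) ch.
by apply: integrableS => //; exact: subset_itv_oo_cc.
Qed.

Lemma Rintegral_sum D (I : Type) (s : seq I) (P : pred I) (F : I -> R -> R) :
  measurable D -> (forall i, mu.-integrable D (EFin \o F i)) ->
  mu.-integrable D (EFin \o (fun x => \sum_(i <- s | P i) F i x)) /\
  \int[mu]_(x in D) (\sum_(i <- s | P i) F i x) =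
  \sum_(i <- s | P i) \int[mu]_(x in D) F i x.
Proof.
move=> mD Fi; elim: s => [|i s [IH1 IH2]].
  split; first by under eq_fun do rewrite big_nil; exact: integrable0.
  rewrite big_nil; under eq_Rintegral do rewrite big_nil.
  by rewrite Rintegral_cst// mul0r.
rewrite big_cons; case: ifPn => Pi.
  rewrite -IH2 -RintegralD//; split; last first.
    by apply: eq_Rintegral => x _; rewrite big_cons Pi.
  move: (integrable_add mD (Fi i) IH1); congr integrable.
  by apply/funext => x /=; rewrite big_cons Pi.
rewrite -IH2; split.
  by move: IH1; congr integrable; apply/funext => x/=; rewrite big_cons (negbTE Pi).
by apply: eq_Rintegral => x _; rewrite big_cons (negbTE Pi).
Qed.

Lemma Rdominated_cvg D (F : nat -> R -> R) f g : measurable D ->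
  (forall n, measurable_fun D (F n)) ->
  {ae mu, forall x, D x -> F ^~ x @ \oo --> f x} ->
  measurable_fun D f ->
  mu.-integrable D (EFin \o g) ->
  (forall n x, D x -> `|F n x| <= g x) ->
  (fun n => \int[mu]_(x in D) F n x) @ \oo --> \int[mu]_(x in D) f x.
Proof.
move=> mD mF Ff mf gi Fg.
have [|||||fi _ h] := @dominated_convergence _ _ _ mu D mD
  (fun n => EFin \o F n) (EFin \o f) (EFin \o g).
- by move=> n; exact/measurable_EFinP.
- exact/measurable_EFinP.
- apply: filterS Ff => x h /h; move=> H; apply: cvg_EFin => //; exact: nearW.
- by [].
- by apply: aeW => x n Dx; rewrite /= lee_fin Fg.
apply: fine_cvg.
by rewrite fineK//; exact: integrable_fin_num.
Qed.

Lemma FTC2_itv (a b : R) (F f : R -> R) : a <= b ->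
  {within `[a, b], continuous F} ->
  {within `[a, b], continuous f} ->
  (forall x, a < x < b -> is_derive x 1 F (f x)) ->
  \int[mu]_(x in `]a, b[) f x = F b - F a.
Proof.
rewrite le_eqVlt => /orP[/eqP <- _ _ _|ab cF cf dF].
  by rewrite set_itvoo0 ?Rintegral_set0 ?subrr.
have fi := continuous_integrable_itv cf.
rewrite /Rintegral.
have := @integral_itv_bndoo R a b (EFin \o f) true false.
move=> <-; last exact: (measurable_int mu).
rewrite (continuous_FTC2 (F := F))//=.
- split.
  + by move=> x; rewrite in_itv => xab; have := dF x xab; exact: @ex_derive.
  + by move/(continuous_within_itvP _ ab) : cF => [].
  + by move/(continuous_within_itvP _ ab) : cF => [].
- by move=> x; rewrite in_itv => xab; rewrite derive1E; have h := dF x xab; exact: derive_val.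
Qed.

Lemma EFin_Rintegral D f : measurable D -> mu.-integrable D (EFin \o f) ->
  (\int[mu]_(x in D) (f x)%:E)%E = (\int[mu]_(x in D) f x)%:E.
Proof. by move=> mD fi; rewrite /Rintegral fineK//; exact: integrable_fin_num. Qed.

Lemma Rintegral_indic D (P : set R) f :
  \int[mu]_(x in D) (f x * \1_P x) = \int[mu]_(x in D `&` P) f x.
Proof.
rewrite Rintegral_mkcondr; apply: eq_Rintegral => x _.
by rewrite patchE indicE; case: ifPn => _; rewrite ?mulr1 ?mulr0.
Qed.

(** Fubini for a product cut off by a region. The triangle y < x yields integration by parts, and
    the triangle s + r < t yields the associativity behind [relax_a_convol]. *)
Lemma Rintegral_swap_indic (D D' : set (measurableTypeR R)) (p q : R -> R)
    (E : set (measurableTypeR R * measurableTypeR R)) :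
  measurable D -> measurable D' -> measurable E ->
  mu.-integrable D (EFin \o p) -> mu.-integrable D' (EFin \o q) ->
  \int[mu]_(x in D) (p x * \int[mu]_(y in D') (q y * \1_E (x, y))) =
  \int[mu]_(y in D') (q y * \int[mu]_(x in D) (p x * \1_E (x, y))).
Proof.
move=> mD mD' mE pi qi.
have mp := integrable_fun pi; have mq := integrable_fun qi.
pose p0 := p \_ D; pose q0 := q \_ D'.
have mp0 : measurable_fun [set: measurableTypeR R] p0.
  by apply/(measurable_restrictT _ _).1.
have mq0 : measurable_fun [set: measurableTypeR R] q0.
  by apply/(measurable_restrictT _ _).1.
have p0i : mu.-integrable setT (EFin \o p0).
  by rewrite /p0 -restrict_EFin; apply/(integrable_mkcond _ mD).
have q0i : mu.-integrable setT (EFin \o q0).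
  by rewrite /q0 -restrict_EFin; apply/(integrable_mkcond _ mD').
pose F (z : measurableTypeR R * measurableTypeR R) : R := p0 z.1 * q0 z.2 * \1_E z.
have mF : measurable_fun setT F.
  apply: measurable_funM; last exact: measurable_indic.
  by apply: measurable_funM; apply: measurableT_comp.
have mEx x : measurable_fun setT (fun y : measurableTypeR R => \1_E (x, y) : R).
  by apply: (@measurableT_comp _ _ _ _ _ _ (\1_E : _ -> R)) => //;
     exact: measurable_indic.
have mEy y : measurable_fun setT (fun x : measurableTypeR R => \1_E (x, y) : R).
  by apply: (@measurableT_comp _ _ _ _ _ _ (\1_E : _ -> R)) => //;
     exact: measurable_indic.
have E1 z : `|\1_E z : R| <= 1 by rewrite indicE; case: (_ \in _); rewrite ?normr1 ?normr0.
have q1 x : mu.-integrable setT (EFin \o (fun y => q0 y * \1_E (x, y))).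
  by apply: (@integrable_mul_bounded _ _ _ 1) => //; exact: q0i.
have p1 y : mu.-integrable setT (EFin \o (fun x => p0 x * \1_E (x, y))).
  by apply: (@integrable_mul_bounded _ _ _ 1) => //; exact: p0i.
(* The indicator is at most 1, so the double integral of |F| is at most the product of the L^1 norms
   of [p0] and [q0]. *)
have FiF : (mu \x mu)%E.-integrable setT (EFin \o F).
  apply/integrable12ltyP; first exact/measurable_EFinP.
  apply: (@le_lt_trans _ _ (\int[mu]_x (`|p0 x|%:E * (\int[mu]_y `|q0 y|)%:E))%E).
    apply: ge0_le_integral => //.
    - by move=> x _; exact: integral_ge0.
    - apply: (@measurable_fun_fubini_tonelli_F _ _ (measurableTypeR R)
        (measurableTypeR R) R mu (fun z => `|(F z)%:E|%E)) => //.
      by apply/measurable_EFinP; apply: measurableT_comp.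
    - apply/measurable_EFinP; apply: measurable_funM => //.
      exact: measurableT_comp.
    - move=> x _; rewrite -EFinM -RintegralZl//; last exact: integrable_norm.
      rewrite -EFin_Rintegral//; last first.
        by apply: integrable_scale => //; exact: integrable_norm.
      apply: ge0_le_integral => //.
      + apply/measurable_EFinP; apply: measurableT_comp => //.
        by apply: (@measurableT_comp _ _ _ _ _ _ F).
      + apply/measurable_EFinP; apply: measurable_funM => //.
        exact: measurableT_comp.
      + move=> y _; rewrite /= lee_fin /F /= !normrM.
        by rewrite -[leRHS]mulr1 ler_wpM2l// mulr_ge0.
  have h : mu.-integrable setT
      (EFin \o (fun x => (\int[mu]_y `|q0 y|) * `|p0 x|)).
    by apply: integrable_scale => //; exact: integrable_norm.
  have := integrable_lty measurableT h.
  by congr (_ < _)%E; apply: eq_integral => x _ /=; rewrite EFinM muleC.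
have /(congr1 fine) := Fubini FiF.
have -> : (\int[mu]_x \int[mu]_y (EFin \o F) (x, y))%E =
          (\int[mu]_x (p0 x * \int[mu]_y (q0 y * \1_E (x, y)))%:E)%E.
  apply: eq_integral => x _; rewrite -RintegralZl// -EFin_Rintegral//; last first.
    exact: integrable_scale.
  by apply: eq_integral => y _; rewrite /= /F /= mulrA.
have -> : (\int[mu]_y \int[mu]_x (EFin \o F) (x, y))%E =
          (\int[mu]_y (q0 y * \int[mu]_x (p0 x * \1_E (x, y)))%:E)%E.
  apply: eq_integral => y _; rewrite -RintegralZl// -EFin_Rintegral//; last first.
    exact: integrable_scale.
  by apply: eq_integral => x _; rewrite /= /F /= mulrA (mulrC (q0 y)).
have e1 x : \int[mu]_y (q0 y * \1_E (x, y)) = \int[mu]_(y in D') (q y * \1_E (x, y)).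
  rewrite [RHS]Rintegral_mkcond; apply: eq_Rintegral => y _.
  by rewrite /q0 !patchE; case: ifPn; rewrite ?mul0r.
have e2 y : \int[mu]_x (p0 x * \1_E (x, y)) = \int[mu]_(x in D) (p x * \1_E (x, y)).
  rewrite [RHS]Rintegral_mkcond; apply: eq_Rintegral => x _.
  by rewrite /p0 !patchE; case: ifPn; rewrite ?mul0r.
move=> h; rewrite [LHS]Rintegral_mkcond [RHS]Rintegral_mkcond.
move: h; congr (_ = _); apply: eq_Rintegral => x _.
  by rewrite e1 /p0 !patchE; case: ifPn; rewrite ?mul0r.
by rewrite e2 /q0 !patchE; case: ifPn; rewrite ?mul0r.
Qed.

Lemma integrable_itvcc (a b : R) (p : R -> R) :
  mu.-integrable `]a, b[ (EFin \o p) -> mu.-integrable `[a, b] (EFin \o p).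
Proof.
move=> ip; have mp := integrable_fun ip.
case/integrableP : ip => _ fp; apply/integrableP; split.
  by apply/measurable_EFinP; exact: measurable_fun_itv_cc mp.
have h := @integral_itv_bndoo R a b (abse \o (EFin \o p)) true false.
rewrite h//; apply: measurableT_comp => //; exact/measurable_EFinP.
Qed.

Lemma integrable_itv_sub (a b c d : R) (p : R -> R) : a <= c -> d <= b ->
  mu.-integrable `]a, b[ (EFin \o p) -> mu.-integrable `]c, d[ (EFin \o p).
Proof.
by move=> ac db; apply: integrableS => //; apply: subset_itvW.
Qed.

Lemma continuous_primitive (b : R) (p : R -> R) : 0 <= b ->
  mu.-integrable `]0, b[ (EFin \o p) ->
  {within `[0, b], continuous (fun x => \int[mu]_(y in `]0, x[) p y)}.
Proof.
move=> b0 pi.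
have pi' := integrable_itvcc pi.
have := parameterized_integral_continuous b0 pi'.
apply: subspace_eq_continuous => x; rewrite inE/= in_itv/= => /andP[x0 xb].
rewrite /from_subspace /parameterized_integral.
have mp : measurable_fun `]0, x[ p.
  apply: measurable_funS (integrable_fun pi) => //.
  by apply: subset_itvl; rewrite bnd_simp.
rewrite /Rintegral; congr fine.
have := @integral_itv_bndoo R 0 x (EFin \o p) true false.
by apply; exact/measurable_EFinP.
Qed.

Lemma measurable_primitive (b : R) (p : R -> R) :
  mu.-integrable `]0, b[ (EFin \o p) ->
  measurable_fun `]0, b[ (fun x => \int[mu]_(y in `]0, x[) p y).
Proof.
have [b0 _|b0 pi] := leP b 0.
  rewrite set_itv_ge ?bnd_simp -?leNgt//; exact: measurable_fun_set0.
apply: (@measurable_funS _ _ _ _ `[0, b]) => //; first exact: subset_itv_oo_cc.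
apply: subspace_continuous_measurable_fun => //.
exact: continuous_primitive (ltW b0) pi.
Qed.

Lemma le_norm_primitive (b : R) (p : R -> R) x : 0 < x < b ->
  mu.-integrable `]0, b[ (EFin \o p) ->
  `|\int[mu]_(y in `]0, x[) p y| <= \int[mu]_(y in `]0, b[) `|p y|.
Proof.
move=> /andP[x0 xb] pi.
have pix : mu.-integrable `]0, x[ (EFin \o p).
  exact: (integrable_itv_sub (lexx 0) (ltW xb)).
apply: le_trans (le_normr_Rintegral _ pix) _ => //.
rewrite /Rintegral fine_le ?integrable_fin_num//; last first.
- apply: ge0_subset_integral => //.
  + by apply/measurable_EFinP; apply: measurableT_comp => //; exact: integrable_fun.
  + by apply: subset_itvl; rewrite bnd_simp ltW.
- exact: integrable_norm.
- exact: integrable_norm.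
Qed.

(** Fubini on the triangle y < x. The two functions appear through their primitives, so
    integrability replaces differentiability. *)
Lemma Rintegral_by_parts (b : R) (p q : R -> R) :
  mu.-integrable `]0, b[ (EFin \o p) -> mu.-integrable `]0, b[ (EFin \o q) ->
  \int[mu]_(x in `]0, b[) (p x * \int[mu]_(y in `]0, x[) q y) =
  \int[mu]_(x in `]0, b[) p x * \int[mu]_(x in `]0, b[) q x -
  \int[mu]_(x in `]0, b[) (q x * \int[mu]_(y in `]0, x[) p y).
Proof.
move=> pi qi.
pose E : set (measurableTypeR R * measurableTypeR R) := [set z | z.2 < z.1].
have mE : measurable E.
  rewrite -[E]setTI; apply: (@measurable_fun_ltr _ _ _ setT snd fst _ _ measurableT [set true]) => //.
have h := Rintegral_swap_indic (measurable_itv _) (measurable_itv _) mE pi qi.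
have qx (x : R) : 0 < x < b -> \int[mu]_(y in `]0, b[) (q y * \1_E (x, y)) =
    \int[mu]_(y in `]0, x[) q y.
  move=> /andP[x0 xb]; rewrite [LHS]Rintegral_mkcond [RHS]Rintegral_mkcond.
  apply: eq_Rintegral => y _; rewrite !patchE !mem_setE !in_itv/= indicE.
  rewrite (_ : ((x, y) \in E) = (y < x)); last by apply/idP/idP; rewrite inE.
  case: (ltP y x) => yx; last by rewrite mulr0 andbF if_same.
  by rewrite (lt_trans yx xb) mulr1.
have py (y : R) : 0 < y < b -> \int[mu]_(x in `]0, b[) (p x * \1_E (x, y)) =
    \int[mu]_(x in `]0, b[) p x - \int[mu]_(x in `]0, y[) p x.
  move=> /andP[y0 yb].
  have piy : mu.-integrable `]0, y[ (EFin \o p).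
    exact: (integrable_itv_sub (lexx 0) (ltW yb)).
  have := @Rintegral_itvB R p (BRight 0) (BLeft b) y pi.
  rewrite !bnd_simp (ltW y0) yb => /(_ erefl erefl).
  rewrite -(Rintegral_itv_bndo_bndc piy) => ->.
  rewrite [LHS]Rintegral_mkcond [RHS]Rintegral_mkcond.
  apply: eq_Rintegral => x _; rewrite !patchE !mem_setE !in_itv/= indicE.
  rewrite (_ : ((x, y) \in E) = (y < x)); last by apply/idP/idP; rewrite inE.
  case: (ltP y x) => yx; last by rewrite mulr0 if_same.
  by rewrite (lt_trans y0 yx) mulr1.
transitivity (\int[mu]_(x in `]0, b[) (p x * \int[mu]_(y in `]0, b[) (q y * \1_E (x, y)))).
  by apply: eq_Rintegral => x; rewrite inE/= in_itv => xb; rewrite qx.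
rewrite h.
clear h qx mE.
have [b0|b0] := leP b 0.
  have -> : `]0, b[%classic = set0 :> set R.
    by apply/eqP; rewrite set_itv_ge// bnd_simp -leNgt.
  by rewrite !Rintegral_set0 mulr0 subr0.
have mP := measurable_primitive pi.
have bP := fun x xb => @le_norm_primitive b p x xb pi.
set Pb := \int[mu]_(x in `]0, b[) p x in py *.
set P := fun x => \int[mu]_(y in `]0, x[) p y in mP.
have {}bP x : 0 < x < b -> `|P x| <= \int[mu]_(y in `]0, b[) `|p y| by exact: bP.
have {}py y : 0 < y < b -> \int[mu]_(x in `]0, b[) (p x * \1_E (x, y)) = Pb - P y.
  exact: py.
transitivity (\int[mu]_(y in `]0, b[) (q y * Pb - q y * P y)).
  by apply: eq_Rintegral => x; rewrite inE/= in_itv => /py ->; rewrite mulrBr.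
rewrite -[\int[mu]_(x in _) (q x * _)]/(\int[mu]_(x in `]0, b[) (q x * P x)).
move: P Pb (\int[mu]_(y in `]0, b[) `|p y|) bP mP {py} => P Pb B bP mP.
have qPi : mu.-integrable `]0, b[ (EFin \o (fun y => q y * P y)).
  by apply: (@integrable_mul_bounded _ _ _ B) => // x; rewrite /= in_itv; exact: bP.
have qPbi : mu.-integrable `]0, b[ (EFin \o (fun y => q y * Pb)).
  by apply: (@integrable_mul_bounded _ _ _ `|Pb|).
by rewrite RintegralB// RintegralZr// mulrC.
Qed.

(** Because y vanishes on the negative axis, the lower limit 0 can be moved to any negative point;
    every u then becomes an interior point, including u <= 0. *)
Lemma is_derive_primitive (y : R -> R) (u : R) : continuous y ->
  (forall t, t <= 0 -> y t = 0) ->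
  is_derive u 1 (fun t => \int[mu]_(s in `]0, t[) y s) (y u).
Proof.
move=> cy y0.
(* A lower limit strictly below both 0 and u. *)
pose a := Num.min 0 u - 1.
have yi v w : mu.-integrable `]v, w[ (EFin \o y).
  by apply: continuous_integrable_itv; apply: continuous_subspaceT.
have yi' v w : mu.-integrable `]v, w] (EFin \o y).
  have := yi v (w + 1); apply: integrableS => //.
  by apply: subset_itvl; rewrite bnd_simp ltrDl.
have a0 : a < 0 by rewrite /a; case: (lerP 0 u) => ?; lra.
have au : a < u by rewrite /a; case: (lerP 0 u) => ?; lra.
have -> : (fun t => \int[mu]_(s in `]0, t[) y s) =
          (fun t => \int[mu]_(s in `]a, t]) y s).
  apply/funext => t; rewrite Rintegral_itv_bndo_bndc//.
  rewrite [LHS]Rintegral_mkcond [RHS]Rintegral_mkcond.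
  apply: eq_Rintegral => x _; rewrite !patchE !mem_setE !in_itv/=.
  have [x0|x0] := lerP x 0.
    by rewrite (y0 _ x0) !if_same.
  by rewrite (lt_trans a0 x0).
have [||h1 h2] := @continuous_FTC1 R y (BRight a) u (u + 1) _ (yi' _ _) _ (cy u).
- by rewrite ?ltrDl ?bnd_simp.
- by rewrite ?ltrDl ?bnd_simp.
by apply: DeriveDef; [exact: h1|rewrite -derive1E; exact: h2].
Qed.

Lemma continuous_bounded_itv (a b : R) (f : R -> R) :
  {within `[a, b], continuous f} ->
  exists2 B, 0 <= B & forall x, a <= x <= b -> `|f x| <= B.
Proof.
move=> cf.
have [ab|ba] := leP a b; last first.
  by exists 0 => // x /andP[ax xb]; have := le_trans ax xb; rewrite leNgt ba.
have cnf : {within `[a, b], continuous (fun x => `|f x|)}.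
  by move=> x; apply: cvg_norm; exact: cf.
have [c cab hc] := EVT_max ab cnf.
by exists `|f c| => // x xab; apply: hc; rewrite in_itv.
Qed.

Lemma continuous_sumn (F : nat -> R -> R) n : (forall i, continuous (F i)) ->
  continuous (fun x => \sum_(i < n) F i x).
Proof.
move=> cF; elim: n => [|n IH] x.
  by under eq_fun do rewrite big_ord0; exact: cvg_cst.
rewrite (_ : (fun y => _) = (fun y => \sum_(i < n) F i y + F n y)).
  by apply: cvgD; [exact: IH|exact: cF].
by apply/funext => y; rewrite big_ord_recr.
Qed.

Lemma cvg_ge0 (u : nat -> R) (l : R) : (forall n, 0 <= u n) -> u @ \oo --> l -> 0 <= l.
Proof.
move=> u0 ul; rewrite -(cvg_lim _ ul)//; apply: limr_ge; first by apply: cvgP ul.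
exact: nearW.
Qed.

End toolkit.

(** * The Fourier series of a quadratic polynomial *)

Section fourier.
Context {R : realType}.
Implicit Types (x u c e : R) (n m N K : nat).

Lemma le_div_nat c e : 0 < e -> exists K, forall N, (K <= N)%N -> c / N.+1%:R <= e.
Proof.
move=> e0; exists (Num.bound (`|c| / e)) => N KN.
have h : `|c| / e < N.+1%:R.
  apply: lt_le_trans (archi_boundP _) _; first by rewrite divr_ge0// ltW.
  by rewrite ler_nat ltnW.
rewrite ler_pdivrMr ?ltr0n// mulrC -ler_pdivrMr//.
by apply: le_trans (ltW h); rewrite ler_pM2r ?invr_gt0// ler_norm.
Qed.

Lemma is_derive_sin_mul c x : is_derive x 1 (fun y : R => sin (c * y)) (c * cos (c * x)).
Proof.
have h : is_derive x (1 : R) (fun y : R => c * y) c.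
  by apply: is_derive_eq; rewrite scaler1.
have := @is_derive1_comp R (@sin R) (fun y : R => c * y) x _ _ (is_derive_sin _) h.
by rewrite mulrC.
Qed.

Lemma is_derive_cos_mul c x : is_derive x 1 (fun y : R => cos (c * y)) (- (c * sin (c * x))).
Proof.
have h : is_derive x (1 : R) (fun y : R => c * y) c.
  by apply: is_derive_eq; rewrite scaler1.
have := @is_derive1_comp R (@cos R) (fun y : R => c * y) x _ _ (is_derive_cos _) h.
by rewrite mulNr mulrC.
Qed.

Lemma is_derive_sumn (F dF : nat -> R -> R) n x :
  (forall i, is_derive x 1 (F i) (dF i x)) ->
  is_derive x 1 (fun y => \sum_(i < n) F i y) (\sum_(i < n) dF i x).
Proof.
move=> FdF; elim: n => [|n IH].
  under eq_fun do rewrite big_ord0; rewrite big_ord0; exact: is_derive_cst.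
under eq_fun do rewrite big_ord_recr; rewrite big_ord_recr.
exact: is_deriveD.
Qed.

(** Partial sums of the Fourier series of the sawtooth (pi - x) / 2. The sums [versum] are their
    primitives vanishing at 0, so they tend to pi x / 2 - x^2 / 4 with no appeal to the value of the
    sum of 1 / n^2. *)
Definition sinsum N x : R := \sum_(i < N) sin (i.+1%:R * x) / i.+1%:R.
Definition versum N x : R := \sum_(i < N) (1 - cos (i.+1%:R * x)) / i.+1%:R ^+ 2.

Lemma is_derive_sinsum N x : is_derive x 1 (sinsum N) (\sum_(i < N) cos (i.+1%:R * x)).
Proof.
apply: (@is_derive_sumn (fun i x => sin (i.+1%:R * x) / i.+1%:R)
  (fun i x => cos (i.+1%:R * x))) => i.
have h := is_derive_sin_mul i.+1%:R x.
rewrite (_ : (fun y => _) = (fun y => sin (i.+1%:R * y)) * cst (i.+1%:R^-1))//.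
by apply: is_derive_eq; rewrite /= scaler0 add0r /GRing.scale /= mulKf ?pnatr_eq0.
Qed.

Lemma is_derive_versum N x : is_derive x 1 (versum N) (sinsum N x).
Proof.
apply: (@is_derive_sumn (fun i x => (1 - cos (i.+1%:R * x)) / i.+1%:R ^+ 2)
  (fun i x => sin (i.+1%:R * x) / i.+1%:R)) => i.
have h := is_derive_cos_mul i.+1%:R x.
rewrite (_ : (fun y => _) = (cst 1 - (fun y => cos (i.+1%:R * y))) * cst ((i.+1%:R ^+ 2)^-1))//.
have n0 : i.+1%:R != 0 :> R by rewrite pnatr_eq0.
by apply: is_derive_eq; rewrite /= scaler0 add0r /GRing.scale /=; field.
Qed.

(** Telescoping of 2 sin (x / 2) cos (n x) = sin ((n + 1/2) x) - sin ((n - 1/2) x). *)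
Lemma dirichlet_kernel N x :
  2 * sin (x / 2) * \sum_(i < N) cos (i.+1%:R * x) = sin ((N%:R + 2^-1) * x) - sin (x / 2).
Proof.
elim: N => [|N IH].
  by rewrite big_ord0 mulr0 add0r mulrC subrr.
rewrite big_ord_recr /= mulrDr IH.
have -> : (N.+1%:R + 2^-1) * x = N.+1%:R * x + x / 2 by ring.
have -> : (N%:R + 2^-1) * x = N.+1%:R * x - x / 2.
  by rewrite -natr1; field.
by rewrite (sinD _ (- _)) sinD cosN sinN; ring.
Qed.

Lemma sin_nat_pi n : sin (n%:R * pi) = 0 :> R.
Proof.
elim: n => [|n IH]; first by rewrite mul0r sin0.
by rewrite -natr1 mulrDl mul1r sinDpi IH oppr0.
Qed.

(** Meant for c = N + 1/2 and M = 2 N + 1. Differentiating the cosine of the added quotient then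
    produces - sin (c y) / (2 sin (y / 2)), which cancels the oscillating part of the Dirichlet
    kernel and leaves a remainder of order 1 / M. *)
Lemma is_derive_corrector (S : R -> R) (dS c M y : R) :
  (M == 0) = false -> (sin (y / 2) == 0) = false -> is_derive y 1 S dS ->
  is_derive y 1 (fun y => S y - (pi - y) / 2 + cos (c * y) / (M * sin (2^-1 * y)))
    (dS + 2^-1 + (- c * sin (c * y) * sin (y / 2) - cos (c * y) * cos (y / 2) / 2)
       / (M * sin (y / 2) ^+ 2)).
Proof.
move=> M0 s0 hS.
have h2 := is_derive_cos_mul c y.
have h3 := is_derive_sin_mul 2^-1 y.
have h4 : is_derive y 1 (fun y => M * sin (2^-1 * y)) (M * (2^-1 * cos (2^-1 * y))).
  by apply: is_derive_eq.
have nz : M * sin (2^-1 * y) != 0 by rewrite mulf_neq0 ?M0// mulrC s0.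
have h5 := @is_deriveV R (fun y => M * sin (2^-1 * y)) y _ 1 nz h4.
have hpi := is_deriveB (is_derive_cst (pi : R) y 1) (is_derive_id y 1).
have := is_deriveD (is_deriveB hS (is_deriveM hpi (is_derive_cst (2^-1 : R) y 1)))
  (is_deriveM h2 h5).
congr is_derive; rewrite /cst /= /GRing.scale /= !(mulrC 2^-1 y).
by field; rewrite M0 s0.
Qed.

(** An integration by parts in the Dirichlet kernel, in differentiated form: the corrected error G
    vanishes at pi and has derivative O(1 / N) away from 0, so the mean value theorem on [u, pi]
    bounds it. *)
Lemma sinsum_bound (d u : R) N : 0 < d -> d <= u -> u <= pi ->
  `|sinsum N u - (pi - u) / 2| <= ((sin (d / 2))^-1 + 2 * (sin (d / 2)) ^- 2) / (2 * N%:R + 1).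
Proof.
move=> d0 du upi; have pi0 := pi_gt0 R.
have half (y : R) : 0 < y -> y <= pi -> 0 < sin (y / 2).
  by move=> ? ?; apply: sin_gt0_pi; lra.
have mono y : d <= y -> y <= pi -> sin (d / 2) <= sin (y / 2).
  move=> dy ypi; rewrite le_eqVlt; have [->|ne] := eqVneq d y; first by rewrite eqxx.
  apply/orP; right; rewrite ltr_sin ?in_itv/=.
  - by rewrite ltr_pM2r// lt_neqAle ne.
  - lra.
  - lra.
have M0 : 0 < 2 * N%:R + 1 :> R by have := ler0n R N; lra.
have s0 : 0 < sin (d / 2) by apply: half => //; lra.
pose c := N%:R + 2^-1 : R.
pose G y := sinsum N y - (pi - y) / 2 + cos (c * y) / ((2 * N%:R + 1) * sin (2^-1 * y)).
pose dG y := - (cos (c * y) * cos (y / 2)) / (2 * (2 * N%:R + 1) * sin (y / 2) ^+ 2).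
have GdG y : d <= y -> y <= pi -> is_derive y 1 G (dG y).
  move=> dy ypi; have sy : 0 < sin (y / 2) by apply: half => //; lra.
  have h1 := is_derive_sinsum N y.
  have D : \sum_(i < N) cos (i.+1%:R * y) =
      (sin (c * y) - sin (y / 2)) / (2 * sin (y / 2)).
    rewrite -dirichlet_kernel mulrC mulKf//; apply: mulf_neq0 => //; lra.
  rewrite D in h1.
  have := is_derive_corrector c (gt_eqF M0) (gt_eqF sy) h1.
  congr is_derive; rewrite /dG.
  have -> : c = (2 * N%:R + 1) / 2 by rewrite /c; field.
  by field; rewrite !gt_eqF.
(* The half-integer frequency makes cos (c pi) vanish, so the corrector adds nothing at pi. *)
have Gpi : G pi = 0.
  rewrite /G subrr mul0r subr0.
  have -> : cos (c * pi) = 0.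
    have -> : c * pi = N%:R * pi + pi / 2 by rewrite /c; ring.
    by rewrite cosDpihalf sin_nat_pi oppr0.
  rewrite mul0r addr0 /sinsum big1// => i _.
  by rewrite sin_nat_pi mul0r.
have sdG y : d <= y -> y <= pi -> `|dG y| <= (sin (d / 2)) ^- 2 / (2 * (2 * N%:R + 1)).
  move=> dy ypi; rewrite /dG normrM normrN normfV [`|_ * _ ^+ 2|]ger0_norm; last first.
    by rewrite mulr_ge0// ?sqr_ge0// mulr_ge0// ltW.
  rewrite -[leRHS]mulrC [in leRHS]mulrC -[leRHS]mul1r -invfM.
  apply: ler_pM => //.
  - by rewrite invr_ge0 mulr_ge0 ?sqr_ge0// mulr_ge0// ltW.
  - by rewrite normrM mulr_ile1// cos_max.
  rewrite lef_pV2 ?posrE; last 2 first.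
  - by rewrite mulr_gt0 ?exprn_gt0 ?mulr_gt0// half//; lra.
  - by rewrite mulr_gt0 ?exprn_gt0 ?mulr_gt0.
  rewrite mulrC ler_pM2l ?mulr_gt0//.
  by rewrite ler_sqr ?nnegrE ?mono// ltW// half//; lra.
have Gu : `|G u| <= 2 * (sin (d / 2)) ^- 2 / (2 * N%:R + 1).
  have [->|upi'] := eqVneq u pi.
    by rewrite Gpi normr0 !mulr_ge0// ?invr_ge0 ?ltW ?exprn_gt0.
  have ltupi : u < pi by rewrite lt_neqAle upi'.
  have [y||y] := @MVT R G dG u pi ltupi.
  - rewrite in_itv/= => /andP[uy ypi]; apply: GdG; lra.
  - apply: derivable_within_continuous => y; rewrite in_itv/= => /andP[uy ypi].
    by have h := GdG y (le_trans du uy) ypi; exact: ex_derive.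
  rewrite in_itv/= => /andP[uy ypi]; rewrite Gpi sub0r => /(congr1 Num.norm).
  rewrite normrN normrM => ->.
  have hy := sdG y (le_trans du (ltW uy)) (ltW ypi).
  (* The factor 4 bounds the length pi - u in the mean value theorem. *)
  apply: le_trans (_ : (sin (d / 2)) ^- 2 / (2 * (2 * N%:R + 1)) * 4 <= _).
    apply: ler_pM => //; rewrite ger0_norm; have := pihalf_lt2 R; lra.
  by rewrite le_eqVlt; apply/orP; left; apply/eqP; field; rewrite !gt_eqF.
have -> : sinsum N u - (pi - u) / 2 = G u - cos (c * u) / ((2 * N%:R + 1) * sin (2^-1 * u)).
  by rewrite /G addrK.
apply: le_trans (ler_normB _ _) _.
rewrite [leRHS]mulrDl [leRHS]addrC lerD// normrM normfV [`|_ * sin _|]ger0_norm; last first.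
  by rewrite mulr_ge0 1?ltW// mulrC half//; lra.
rewrite invfM mulrCA mulrC -[leRHS]mul1r mulrA ler_pM2r ?invr_gt0//.
apply: ler_pM; rewrite ?cos_max// ?invr_ge0; first by rewrite mulrC ltW// half//; lra.
rewrite lef_pV2 ?posrE//; last by rewrite mulrC half//; lra.
by rewrite (mulrC 2^-1) mono.
Qed.

Lemma norm_sin_le x : `|sin x| <= `|x|.
Proof.
wlog x0 : x / 0 <= x => [h|].
  have [/h//|/ltW x0] := leP 0 x.
  by rewrite -normrN -sinN -[`|x|]normrN; apply: h; rewrite oppr_ge0.
have [->|xn0] := eqVneq x 0; first by rewrite sin0 normr0.
have {xn0}x0 : 0 < x by rewrite lt_neqAle eq_sym xn0.
have [|y _] := @MVT R sin cos 0 x x0.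
- by apply: continuous_subspaceT; exact: continuous_sin.
rewrite sin0 !subr0 => ->; rewrite normrM -[leRHS]mul1r ler_wpM2r//.
exact: cos_max.
Qed.

Lemma versin_le x : 1 - cos x <= x ^+ 2 / 2.
Proof.
have -> : cos x = 1 - 2 * sin (x / 2) ^+ 2.
  have {1}-> : x = (x / 2) *+ 2 by rewrite mulr2n; field.
  by rewrite cos_mulr2n cos2sin2; ring.
have := norm_sin_le (x / 2); rewrite -(ler_sqr (normr_ge0 _)) ?nnegrE//.
rewrite !real_normK ?num_real//; lra.
Qed.

Lemma versin_div_ge0 x (i : nat) : 0 <= (1 - cos x) / i.+1%:R ^+ 2.
Proof. by rewrite divr_ge0 ?sqr_ge0// subr_ge0 cos_le1. Qed.

(** Comparison with the telescoping series of 1 / i - 1 / (i + 1) = 1 / (i (i + 1)). *)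
Lemma sum_invsqr_tail m N : (0 < m)%N ->
  \sum_(m <= i < N) (i.+1%:R ^+ 2)^-1 <= m%:R^-1 :> R.
Proof.
move=> m0; have [mN|Nm] := leqP m N; last by rewrite big_geq ?invr_ge0// ltnW.
have h : \sum_(m <= i < N) (i.+1%:R ^+ 2)^-1 <= m%:R^-1 - N%:R^-1 :> R.
  elim: N mN => [|N IH]; first by rewrite leqn0 => /eqP m00; rewrite m00 in m0.
  rewrite leq_eqVlt => /orP[/eqP <-|]; first by rewrite big_geq// subrr.
  rewrite ltnS => mN; rewrite big_nat_recr//=.
  apply: le_trans (lerD (IH mN) (lexx _)) _.
  have N0 : 0 < N%:R :> R by rewrite ltr0n (leq_trans m0).
  suff : (N.+1%:R ^+ 2)^-1 <= N%:R^-1 - N.+1%:R^-1 :> R.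
    by move: (m%:R^-1) (N%:R^-1) (N.+1%:R^-1) (N.+1%:R ^- 2) => *; lra.
  rewrite -natr1; have : 0 < N%:R + 1 :> R by lra.
  move: (N%:R : R) N0 => a a0 a1.
  have -> : a^-1 - (a + 1)^-1 = (a * (a + 1))^-1 by field; rewrite !gt_eqF.
  by rewrite lef_pV2 ?posrE ?exprn_gt0 ?mulr_gt0// expr2 ler_wpM2r; lra.
by apply: le_trans h _; rewrite gerBl invr_ge0.
Qed.

Lemma versum_tail m N x : (0 < m)%N -> (m <= N)%N ->
  0 <= versum N x - versum m x <= 2 / m%:R.
Proof.
move=> m0 mN; rewrite /versum -!(big_mkord xpredT (fun i => (1 - cos (i.+1%:R * x)) / i.+1%:R ^+ 2)).
rewrite (big_cat_nat (leq0n m) mN)//= addrAC subrr add0r; apply/andP; split.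
  by apply: sumr_ge0 => i _; exact: versin_div_ge0.
apply: le_trans (_ : 2 * \sum_(m <= i < N) (i.+1%:R ^+ 2)^-1 <= _).
  rewrite mulr_sumr; apply: ler_sum => i _; rewrite ler_wpM2r ?invr_ge0 ?sqr_ge0//.
  have := cos_geN1 (i.+1%:R * x); lra.
by rewrite ler_wpM2l// sum_invsqr_tail.
Qed.

(** Each of the first m terms is at most x^2 / 2 and the rest is a tail. The bound is uniform in N
    and covers the neighbourhood of 0, where [sinsum_bound] degenerates. *)
Lemma versum_small m N x : (0 < m)%N ->
  0 <= versum N x <= m%:R * x ^+ 2 / 2 + 2 / m%:R.
Proof.
move=> m0; have small n : 0 <= versum n x <= n%:R * x ^+ 2 / 2.
  apply/andP; split; first by apply: sumr_ge0 => i _; exact: versin_div_ge0.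
  apply: le_trans (_ : \sum_(i < n) x ^+ 2 / 2 <= _); last first.
    by rewrite sumr_const card_ord -[_ *+ n]mulr_natl mulrA.
  apply: ler_sum => i _; rewrite ler_pdivrMr ?exprn_gt0 ?ltr0n//.
  by apply: le_trans (versin_le _) _; rewrite exprMn; lra.
have [mN|Nm] := leqP m N.
  have /andP[? ?] := versum_tail x m0 mN; have /andP[? ?] := small m; lra.
have /andP[-> h] := small N; apply: le_trans h _; rewrite -[leLHS]addr0 lerD//.
by rewrite !ler_wpM2r// ?sqr_ge0// ler_nat ltnW.
Qed.

(** At a small d both the partial sum and the quadratic are small; from d to x their difference
    moves little, since its derivative is the error of [sinsum], uniformly small on [d, x]. *)
Lemma versum_cvg x e : 0 < x <= pi -> 0 < e ->
  exists K, forall N, (K <= N)%N -> `|versum N x - (pi * x / 2 - x ^+ 2 / 4)| <= e.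
Proof.
move=> /andP[x0 xpi] e0.
have [m0 /(_ m0 (leqnn _)) hm] := le_div_nat 2 (divr_gt0 e0 (ltr0n R 4)).
set m := m0.+1 in hm.
have m1 : 1 <= m%:R :> R by rewrite ler1n.
(* With m fixed by 2 / m <= e / 4, this d makes m d^2 / 2 and the quadratic at d small as well. *)
pose d := Num.min x (Num.min 1 (e / (4 * (m%:R + 4)))).
have d0 : 0 < d.
  rewrite /d !lt_min x0 ltr01/= divr_gt0// mulr_gt0//; lra.
have dx : d <= x by rewrite /d ge_min lexx.
have d1 : d <= 1 by rewrite /d !ge_min lexx orbT.
have de : d * (4 * (m%:R + 4)) <= e.
  rewrite -ler_pdivlMr; last by rewrite mulr_gt0//; lra.
  by rewrite /d !ge_min lexx !orbT.
set C := (sin (d / 2))^-1 + 2 * (sin (d / 2)) ^- 2.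
have [K hK] := le_div_nat (C * 4) (divr_gt0 e0 (ltr0n R 4)).
have s0 : 0 < sin (d / 2) by apply: sin_gt0_pi; have := pi_gt0 R; lra.
have C0 : 0 <= C by rewrite addr_ge0// ?mulr_ge0// ?invr_ge0 ?sqr_ge0// ltW.
exists K => N KN.
pose P y : R := versum N y - (pi * y / 2 - y ^+ 2 / 4).
have dP (y : R) : is_derive y 1 P (sinsum N y - (pi - y) / 2).
  have h := is_derive_versum N y.
  rewrite (_ : P = versum N - (cst (pi / 2) * id - cst 4^-1 * (id * id))).
    by apply: is_derive_eq; rewrite /cst /= /GRing.scale /=; field.
  by apply/funext => z; rewrite /P /= !fctE /cst /=; field.
have Pd : `|P d| <= e / 4 * 3.
  have /andP[v0 v1] := @versum_small m N d isT.
  have p4 : pi < 4 :> R by have := pihalf_lt2 R; lra.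
  have pd : 0 <= pi * d <= 4 * d.
    by rewrite mulr_ge0 ?ler_wpM2r ?(ltW d0) ?(ltW p4)// pi_ge0.
  have d2 : 0 <= d ^+ 2 <= d.
    by rewrite sqr_ge0 expr2 -[leRHS]mulr1 ler_wpM2l// ltW.
  have md : m%:R * d ^+ 2 <= m%:R * d by rewrite ler_wpM2l//; lra.
  rewrite /P ler_norml; move: (m%:R * d ^+ 2) md v1 => u md v1.
  move: de; rewrite mulrCA mulrDr => de; rewrite (mulrC d m%:R) in de.
  have md0 : 0 <= m%:R * d by rewrite mulr_ge0 ?ltW.
  move: (m%:R * d) md0 md de (pi * d) pd (d ^+ 2) d2 => a *.
  apply/andP; split; lra.
have Pxd : `|P x - P d| <= e / 4.
  have [<-|ne] := eqVneq d x; first by rewrite subrr normr0 divr_ge0// ltW.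
  have {ne}dx' : d < x by rewrite lt_neqAle ne.
  have [|y] := @MVT R P (fun y => sinsum N y - (pi - y) / 2) d x dx'.
    apply: derivable_within_continuous => y _.
    by have h := dP y; exact: ex_derive.
  rewrite in_itv/= => /andP[dy yx] ->; rewrite normrM.
  have h := @sinsum_bound d y N d0 (ltW dy) (le_trans (ltW yx) xpi).
  apply: le_trans (_ : C / (2 * N%:R + 1) * 4 <= _).
    by apply: ler_pM => //; rewrite ger0_norm; have := pihalf_lt2 R; lra.
  rewrite mulrAC; apply: le_trans (hK N KN).
  rewrite ler_wpM2l ?mulr_ge0// lef_pV2 ?posrE ?ltr0n//.
    by have := ler0n R N; lra.
have := ler_normD (P x - P d) (P d); rewrite subrK => h.
by apply: le_trans h _; move: (`|P d|) (`|P x - P d|) Pd Pxd => *; lra.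
Qed.

(* The Fourier series of the quadratic Bernoulli polynomial, which carries the
   completeness of the sine system. *)
Lemma versum_quadratic N x : (0 < N)%N -> 0 <= x <= 2 * pi ->
  `|versum N x - (pi * x / 2 - x ^+ 2 / 4)| <= 2 / N%:R.
Proof.
move=> N0 /andP[x0 x2pi].
(* Both the partial sum and the quadratic are invariant under x -> 2 pi - x. *)
wlog xpi : x x0 x2pi / x <= pi => [h|].
  have [/(h x x0 x2pi)//|xpi] := leP x pi.
  have := h (2 * pi - x); rewrite subr_ge0 => /(_ x2pi).
  have p0 := pi_ge0 R.
  have -> : versum N (2 * pi - x) = versum N x.
    apply: eq_bigr => i _; congr ((1 - _) / _).
    rewrite -cosN; have -> : - (i.+1%:R * (2 * pi - x)) = i.+1%:R * x - 2 * (i.+1%:R * pi) by ring.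
    have -> : 2 * (i.+1%:R * pi) = (i.+1%:R * pi) *+ 2 :> R by rewrite mulr_natl.
    rewrite cosB cos_mulr2n sin_mulr2n sin_nat_pi mulr0 mul0rn mulr0 addr0.
    by rewrite cos2sin2 sin_nat_pi expr0n subr0 mulr2n addrK mulr1.
  have -> : pi * (2 * pi - x) / 2 - (2 * pi - x) ^+ 2 / 4 = pi * x / 2 - x ^+ 2 / 4 by field.
  by apply; lra.
have [->|xn0] := eqVneq x 0.
  rewrite /versum big1 => [|i _]; last by rewrite mulr0 cos0 subrr mul0r.
  by rewrite mulr0 !mul0r expr0n mul0r subrr subr0 normr0 divr_ge0.
have {xn0}x0 : 0 < x by rewrite lt_neqAle eq_sym xn0.
apply/ler_addgt0Pr => e e0.
(* [versum_cvg] has no rate. The rate 2 / N is the tail bound between N and a larger index at which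
   the sum is within e of its limit. *)
have [K hK] := @versum_cvg x e (introT andP (conj x0 xpi)) e0.
have {}hK := hK (maxn K N) (leq_maxl _ _).
have /andP[h1 h2] := versum_tail x N0 (leq_maxr K N).
have := ler_distD (versum (maxn K N) x) (versum N x) (pi * x / 2 - x ^+ 2 / 4).
rewrite distrC [`|versum N x - _|]distrC.
rewrite (ger0_norm h1); lra.
Qed.

End fourier.

(** * Convolution of an integrable weight with a bounded function *)

Section convol.
Context {R : realType}.
Notation mu := (leb R).
Implicit Types (D : set (measurableTypeR R)) (p K : R -> R) (B u : R).

(** The domain of integration does not move with u, so limits and derivatives in u pass under the
    integral. A causal cut-off is expressed by K vanishing on the negative axis. *)
Definition convol D p K (u : R) : R := \int[mu]_(s in D) (p s * K (u - s)).

Lemma measurable_reflect D K u : measurable_fun setT K ->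
  measurable_fun D (fun s : measurableTypeR R => K (u - s)).
Proof.
move=> mK; apply: measurable_funTS.
by apply: (@measurableT_comp _ _ _ _ _ _ K) => //; exact: measurable_funB.
Qed.

Lemma integrable_conv D p K B u : measurable D -> mu.-integrable D (EFin \o p) ->
  measurable_fun setT K -> (forall x, `|K x| <= B) ->
  mu.-integrable D (EFin \o (fun s => p s * K (u - s))).
Proof.
move=> mD ip mK KB; apply: (@integrable_mul_bounded _ _ _ _ B) => //.
exact: measurable_reflect.
Qed.

Lemma le_norm_conv D p K B u : measurable D -> mu.-integrable D (EFin \o p) ->
  measurable_fun setT K -> (forall x, `|K x| <= B) ->
  `|convol D p K u| <= B * \int[mu]_(s in D) `|p s|.
Proof.
move=> mD ip mK KB; apply: le_norm_Rintegral_mul => //.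
exact: measurable_reflect.
Qed.

Lemma continuous_conv D p K B : measurable D -> mu.-integrable D (EFin \o p) ->
  continuous K -> (forall x, `|K x| <= B) -> continuous (convol D p K).
Proof.
move=> mD ip cK KB u.
have mK : measurable_fun setT K by exact: continuous_measurable_fun.
apply: (@continuity_under_integral R _ (measurableTypeR R) mu
  (fun u s => p s * K (u - s)) D mD (u - 1) (u + 1) _ _ (fun s => B * `|p s|)).
- by move=> x _; exact: (@integrable_conv D p K B x).
- apply: aeW => s _ x _; apply: cvgM; first exact: cvg_cst.
  by apply: continuous_comp; [apply: cvgB; [exact: cvg_id|exact: cvg_cst]|exact: cK].
- by apply: integrable_scale => //; exact: integrable_norm.
- by move=> x _; apply: aeW => s _; rewrite normrM mulrC ler_wpM2r.
- by rewrite inE/= in_itv/=; lra.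
Qed.

Lemma conv0 D p u : convol D p (cst 0) u = 0.
Proof.
rewrite /convol (_ : (fun s => _) = cst 0) /Rintegral ?integral0//.
by apply/funext => s; rewrite mulr0.
Qed.

Lemma convD D p K1 K2 B1 B2 u : measurable D -> mu.-integrable D (EFin \o p) ->
  measurable_fun setT K1 -> (forall x, `|K1 x| <= B1) ->
  measurable_fun setT K2 -> (forall x, `|K2 x| <= B2) ->
  convol D p (fun x => K1 x + K2 x) u = convol D p K1 u + convol D p K2 u.
Proof.
move=> mD ip mK1 K1B mK2 K2B.
rewrite /convol -RintegralD//; [|exact: (@integrable_conv D p K1 B1 u)|
  exact: (@integrable_conv D p K2 B2 u)].
by apply: eq_Rintegral => s _; rewrite mulrDr.
Qed.

Lemma convZ D p K B c u : measurable D -> mu.-integrable D (EFin \o p) ->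
  measurable_fun setT K -> (forall x, `|K x| <= B) ->
  convol D p (fun x => c * K x) u = c * convol D p K u.
Proof.
move=> mD ip mK KB.
rewrite /convol -RintegralZl//; last exact: (@integrable_conv D p K B u).
by apply: eq_Rintegral => s _; rewrite mulrCA.
Qed.

Lemma cvg_conv D p (Kn : nat -> R -> R) K B u : measurable D ->
  mu.-integrable D (EFin \o p) ->
  (forall n, measurable_fun setT (Kn n)) -> measurable_fun setT K ->
  (forall n x, `|Kn n x| <= B) ->
  {ae mu, forall s, D s -> Kn ^~ (u - s) @ \oo --> K (u - s)} ->
  (fun n => convol D p (Kn n) u) @ \oo --> convol D p K u.
Proof.
move=> mD ip mKn mK KB KnK.
have mp := integrable_fun ip.
apply: (@Rdominated_cvg _ _ _ _ (fun s => B * `|p s|)) => //.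
- by move=> n; apply: measurable_funM => //; exact: measurable_reflect.
- by apply: filterS KnK => s h /h hs; apply: cvgM => //; exact: cvg_cst.
- by apply: measurable_funM => //; exact: measurable_reflect.
- by apply: integrable_scale => //; exact: integrable_norm.
- by move=> n s _; rewrite normrM mulrC ler_wpM2r.
Qed.

End convol.

(** * Positive definite kernels *)

Section tent.
Context {R : realType}.
Notation mu := (leb R).
Implicit Types (h u v x : R).

Definition tent h v : R := Num.max (h - `|v|) 0.

Lemma tent_ge0 h v : 0 <= tent h v.
Proof. by rewrite /tent le_max lexx orbT. Qed.

Lemma tent_le h v : 0 <= h -> tent h v <= h.
Proof. by move=> h0; rewrite /tent ge_max h0 lerBlDr lerDl normr_ge0. Qed.

Lemma continuous_tent h : continuous (tent h).
Proof.
move=> v; apply: (@continuous_max R R (fun v => h - `|v|) (cst 0)); last exact: cvg_cst.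
by apply: cvgB; [exact: cvg_cst|apply: cvg_norm; exact: cvg_id].
Qed.

Lemma continuous_tent_reflect h u : continuous (fun s : R => tent h (u - s)).
Proof.
move=> s; apply: (@continuous_comp _ _ _ (fun s => u - s) (tent h)).
  by apply: cvgB; [exact: cvg_cst|exact: cvg_id].
exact: continuous_tent.
Qed.

Lemma Rintegral_itv_split (a c b : R) (f : R -> R) : a <= c -> c < b ->
  mu.-integrable `]a, b[ (EFin \o f) ->
  \int[mu]_(x in `]a, b[) f x = \int[mu]_(x in `]a, c[) f x + \int[mu]_(x in `]c, b[) f x.
Proof.
move=> ac cb fi.
have := @Rintegral_itvB R f (BRight a) (BLeft b) c fi.
rewrite !bnd_simp ac cb => /(_ erefl erefl) <-.
rewrite -Rintegral_itv_bndo_bndc; first by rewrite addrCA subrr addr0.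
exact: (integrable_itv_sub (lexx a) (ltW cb)).
Qed.

Lemma is_derive_affine_sqr (a b c x : R) :
  is_derive x 1 (fun y : R => a * y ^+ 2 + b * y + c) (2 * a * x + b).
Proof.
have hx := @is_derive_id R R x 1.
have := is_deriveD (is_deriveD (is_deriveZ a (is_deriveM hx hx)) (is_deriveZ b hx))
  (is_derive_cst c x 1).
by congr is_derive; rewrite /GRing.scale /=; ring.
Qed.

Lemma Rintegral_tent h u : 0 < h ->
  \int[mu]_(s in `](u - h)%R, (u + h)%R[) tent h (u - s) = h ^+ 2.
Proof.
move=> h0.
have ti a b : mu.-integrable `]a, b[ (EFin \o (fun s => tent h (u - s))).
  apply: continuous_integrable_itv; apply: continuous_subspaceT.
  exact: continuous_tent_reflect.
rewrite (@Rintegral_itv_split _ u)//; [|lra|lra].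
have cP (a b c x y : R) : {within `[x, y], continuous (fun y : R => a * y ^+ 2 + b * y + c)}.
  apply: derivable_within_continuous => t _.
  by have d := is_derive_affine_sqr a b c t; exact: ex_derive.
have ca (b c x y : R) : {within `[x, y], continuous (fun y : R => b * y + c)}.
  apply: continuous_subspaceT => t; apply: cvgD; last exact: cvg_cst.
  by apply: cvgM; [exact: cvg_cst|exact: cvg_id].
have -> : \int[mu]_(s in `](u - h)%R, u[) tent h (u - s) =
          \int[mu]_(s in `](u - h)%R, u[) (1 * s + (h - u)).
  apply: eq_Rintegral => s; rewrite inE/= in_itv/= => /andP[s1 s2].
  rewrite /tent ger0_norm; last by lra.
  by rewrite max_l; lra.
have -> : \int[mu]_(s in `]u, (u + h)%R[) tent h (u - s) =
          \int[mu]_(s in `]u, (u + h)%R[) (-1 * s + (h + u)).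
  apply: eq_Rintegral => s; rewrite inE/= in_itv/= => /andP[s1 s2].
  rewrite /tent ler0_norm; last by lra.
  by rewrite max_l; lra.
have -> : \int[mu]_(s in `](u - h)%R, u[) (1 * s + (h - u)) =
    (2^-1 * u ^+ 2 + (h - u) * u + 0) - (2^-1 * (u - h) ^+ 2 + (h - u) * (u - h) + 0).
  apply: (@FTC2_itv _ _ _ (fun s => 2^-1 * s ^+ 2 + (h - u) * s + 0)) => //; first by lra.
  move=> x _; have := is_derive_affine_sqr 2^-1 (h - u) 0 x.
  by congr is_derive; field.
have -> : \int[mu]_(s in `]u, (u + h)%R[) (-1 * s + (h + u)) =
    (- 2^-1 * (u + h) ^+ 2 + (h + u) * (u + h) + 0) - (- 2^-1 * u ^+ 2 + (h + u) * u + 0).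
  apply: (@FTC2_itv _ _ _ (fun s => - 2^-1 * s ^+ 2 + (h + u) * s + 0)) => //; first by lra.
  move=> x _; have := is_derive_affine_sqr (- 2^-1) (h + u) 0 x.
  by congr is_derive; field.
by field.
Qed.

(** The normalised tent is a probability density, so an average of f stays as close to c as f does.
    With c = 0 this bounds the mollified function, and with c = f u it gives convergence. *)
Lemma tent_mollify h u c e (f : R -> R) : 0 < h -> measurable_fun setT f ->
  (forall s, `|s - u| < h -> `|f s - c| <= e) ->
  `|(h ^+ 2)^-1 * (\int[mu]_(s in `](u - h)%R, (u + h)%R[) (tent h (u - s) * f s)) - c| <= e.
Proof.
move=> h0 mf fc.
have h2 : 0 < h ^+ 2 by rewrite exprn_gt0.
have ti : mu.-integrable `](u - h)%R, (u + h)%R[ (EFin \o (fun s => tent h (u - s))).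
  apply: continuous_integrable_itv; apply: continuous_subspaceT.
  exact: continuous_tent_reflect.
have near s : `](u - h)%R, (u + h)%R[%classic s -> `|s - u| < h.
  rewrite /= in_itv/= => /andP[s1 s2]; rewrite ltr_norml; apply/andP; split; lra.
have mfc : measurable_fun `](u - h)%R, (u + h)%R[ (fun s => f s - c).
  by apply: measurable_funTS; apply: measurable_funB.
have fci := integrable_mul_bounded (measurable_itv _) ti mfc (fun s hs => fc s (near s hs)).
have := le_norm_Rintegral_mul (measurable_itv _) ti mfc (fun s hs => fc s (near s hs)).
have -> : \int[mu]_(s in `](u - h)%R, (u + h)%R[) `|tent h (u - s)| = h ^+ 2.
  by rewrite -(Rintegral_tent u h0); apply: eq_Rintegral => s _; rewrite ger0_norm ?tent_ge0.
move=> H.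
have -> : \int[mu]_(s in `](u - h)%R, (u + h)%R[) (tent h (u - s) * f s) =
   \int[mu]_(s in `](u - h)%R, (u + h)%R[) (tent h (u - s) * (f s - c)) + c * h ^+ 2.
  rewrite -(Rintegral_tent u h0) -RintegralZl// -RintegralD//; last exact: integrable_scale.
  by apply: eq_Rintegral => s _; ring.
rewrite mulrDr mulrCA mulVf ?gt_eqF// mulr1 addrK normrM gtr0_norm ?invr_gt0//.
by rewrite mulrC ler_pdivrMr.
Qed.

(** With w = v / L and k = h / L, the second difference of pi |w| / 2 - w^2 / 4 with step k is pi
    max (k - |w|, 0) - k^2 / 2. Adding k^2 / 2 and rescaling by L / pi gives a cosine sum with
    nonnegative coefficients close to [tent h v]. Letting L grow removes the periodicity, and L^2
    terms outweigh the factor L. *)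
Definition tent_sum (n : nat) h (v : R) : R :=
  let L := n.+1%:R in
  L / pi * ((h / L) ^+ 2 / 2 + \sum_(i < (n.+1 ^ 2)%N)
     2 * (1 - cos (i.+1%:R * (h / L))) / i.+1%:R ^+ 2 * cos (i.+1%:R / L * v)).

Lemma versumN N x : versum N (- x) = versum N x :> R.
Proof. by apply: eq_bigr => i _; rewrite mulrN cosN. Qed.

Lemma versum_second_difference N u h :
  versum N (u + h) + versum N (u - h) - 2 * versum N u =
  \sum_(i < N) 2 * (1 - cos (i.+1%:R * h)) / i.+1%:R ^+ 2 * cos (i.+1%:R * u) :> R.
Proof.
rewrite /versum mulr_sumr -big_split -sumrB; apply: eq_bigr => i _ /=.
by rewrite mulrDr mulrBr cosB cosD; ring.
Qed.

Lemma versum_abs N x : (0 < N)%N -> `|x| <= 2 * pi ->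
  `|versum N x - (pi * `|x| / 2 - x ^+ 2 / 4)| <= 2 / N%:R.
Proof.
move=> N0 xpi.
have -> : versum N x = versum N `|x| by case: (ger0P x) => // _; rewrite versumN.
by rewrite -[x ^+ 2]real_normK ?num_real// versum_quadratic// normr_ge0.
Qed.

(** The condition on v keeps w and w + k, w - k within 2 pi of 0, where the quadratic formula is
    valid. *)
Lemma tent_sum_near n h v : 0 < h <= 1 -> `|v| <= n.+1%:R ->
  `|tent_sum n h v - tent h v| <= 8 / n.+1%:R.
Proof.
move=> /andP[h0 h1] vL; rewrite /tent_sum /=.
set L : R := n.+1%:R; have L0 : 0 < L by rewrite ltr0n.
have L1 : 1 <= L by rewrite ler1n.
have p2 := pi_ge2 R.
pose w := v / L; pose k := h / L.
have w1 : `|w| <= 1 by rewrite normrM normfV (gtr0_norm L0) ler_pdivrMr// mul1r.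
have k0 : 0 < k by rewrite divr_gt0.
have k1 : k <= 1 by rewrite ler_pdivrMr// mul1r (le_trans h1).
have N0 : (0 < n.+1 ^ 2)%N by rewrite expn_gt0.
have -> : \sum_(i < (n.+1 ^ 2)%N)
     2 * (1 - cos (i.+1%:R * (h / L))) / i.+1%:R ^+ 2 * cos (i.+1%:R / L * v) =
   versum (n.+1 ^ 2)%N (w + k) + versum (n.+1 ^ 2)%N (w - k) - 2 * versum (n.+1 ^ 2)%N w.
  rewrite versum_second_difference; apply: eq_bigr => i _.
  by congr (_ * cos _); rewrite /w mulrAC mulrA.
have a1 : `|w + k| <= 2 * pi by apply: le_trans (ler_normD _ _) _; rewrite (gtr0_norm k0); lra.
have a2 : `|w - k| <= 2 * pi by apply: le_trans (ler_normB _ _) _; rewrite (gtr0_norm k0); lra.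
have a3 : `|w| <= 2 * pi by lra.
have := versum_abs N0 a1; have := versum_abs N0 a2; have := versum_abs N0 a3.
set V1 := versum _ (w + k); set V2 := versum _ (w - k); set V3 := versum _ w.
have -> : (n.+1 ^ 2)%:R = L ^+ 2 :> R by rewrite natrX.
(* For k >= 0, |w + k| + |w - k| - 2 |w| = 2 max (k - |w|, 0). *)
have tentE : tent h v = L / pi * (pi / 2 * (`|w + k| + `|w - k| - 2 * `|w|)).
  have -> : h = k * L by rewrite /k divfK// gt_eqF.
  have -> : v = w * L by rewrite /w divfK// gt_eqF.
  rewrite /tent normrM (gtr0_norm L0) -mulrBl.
  have -> : L / pi * (pi / 2 * (`|w + k| + `|w - k| - 2 * `|w|)) =
     (`|w + k| + `|w - k| - 2 * `|w|) / 2 * L by field; rewrite gt_eqF//; lra.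
  rewrite -[in LHS](mul0r L) -maxr_pMl 1?ltW//; congr (_ * _).
  clear a1 a2 a3 vL w1 h0 h1 L1 p2.
  case: (ger0P w) => w0; case: (ger0P (w + k)) => ?; case: (ger0P (w - k)) => ?;
  case: leP; lra.
move: tentE => ->; move: V1 V2 V3 => V1 V2 V3.
have sq : (w + k) ^+ 2 + (w - k) ^+ 2 - 2 * w ^+ 2 = 2 * k ^+ 2 by ring.
move: `|w + k| `|w - k| `|w| ((w + k) ^+ 2) ((w - k) ^+ 2) (w ^+ 2) sq => A1 A2 A3 s1 s2 s3 sq.
move=> e3 e2 e1.
rewrite -mulrBr normrM gtr0_norm ?divr_gt0//; last by lra.
have -> : k ^+ 2 / 2 + (V1 + V2 - 2 * V3) - pi / 2 * (A1 + A2 - 2 * A3) =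
  (V1 - (pi * A1 / 2 - s1 / 4)) + (V2 - (pi * A2 / 2 - s2 / 4))
   - 2 * (V3 - (pi * A3 / 2 - s3 / 4)) by lra.
(* The second difference uses four copies of the error 2 / L^2. *)
apply: le_trans (_ : L / pi * (8 / L ^+ 2) <= _).
  apply: ler_wpM2l; first by rewrite divr_ge0//; lra.
  move: e3 e2 e1; rewrite !ler_norml; move: ((L ^+ 2)^-1) => *; lra.
have -> : L / pi * (8 / L ^+ 2) = 8 / L / pi.
  by field; rewrite !gt_eqF//; lra.
by rewrite ler_pdivrMr ?ler_peMr ?divr_ge0//; lra.
Qed.

(** Nonnegative coefficients put the maximum at v = 0, where [tent_sum_near] gives at most h + 8.
    The bound holds for all v, as dominated convergence on the half-line requires. *)
Lemma tent_sum_bound n h v : 0 < h <= 1 -> `|tent_sum n h v| <= 9.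
Proof.
move=> h01; have /andP[h0 h1] := h01.
apply: le_trans (_ : tent_sum n h 0 <= _).
  rewrite /tent_sum /= normrM ger0_norm ?divr_ge0 ?pi_ge0//.
  rewrite ler_wpM2l ?divr_ge0 ?pi_ge0//.
  apply: le_trans (ler_normD _ _) _; apply: lerD.
    by rewrite ger0_norm// divr_ge0// sqr_ge0.
  apply: le_trans (ler_norm_sum _ _ _) _; apply: ler_sum => i _.
  rewrite mulr0 cos0 mulr1 normrM ger0_norm.
    by rewrite ler_piMr ?cos_max// -mulrA mulr_ge0// versin_div_ge0.
  by rewrite -mulrA mulr_ge0// versin_div_ge0.
have := @tent_sum_near n h 0 h01; rewrite normr0 => /(_ (ler0n _ _)).
have t0 := tent_le 0 (ltW h0).
have : 8 / n.+1%:R <= 8 :> R by rewrite ler_pdivrMr ?ltr0n// ler_peMr// ler1n.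
rewrite ler_norml; move: (8 / _) (tent_sum n h 0) (tent h 0) t0 => *; lra.
Qed.

Lemma tent_sum_cvg h v : 0 < h <= 1 -> (fun n => tent_sum n h v) @ \oo --> tent h v.
Proof.
move=> h01; apply/cvgrPdist_le => e e0.
have [K HK] := le_div_nat 8 e0.
have [K' HK'] := le_div_nat `|v| ltr01.
exists (maxn K K') => // n /=; rewrite geq_max => /andP[Kn Kn'].
rewrite distrC; apply: le_trans (HK n Kn); apply: tent_sum_near => //.
by have := HK' n Kn'; rewrite ler_pdivrMr ?ltr0n// mul1r.
Qed.

End tent.

(** * Positivity of the quadratic form of a kernel with nonnegative cosine transform *)

Section positivity.
Context {R : realType}.
Notation mu := (leb R).
Variables (M z : R -> R) (tau : R).
Implicit Types (H K : R -> R) (B c : R).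
Local Notation D := (`]0%R, +oo[%classic : set (measurableTypeR R)).
Local Notation I := (`]0%R, tau[%classic : set (measurableTypeR R)).
Hypothesis iM : mu.-integrable D (EFin \o M).
Hypothesis cz : continuous z.
Hypothesis M_pos : forall w : R, 0 <= \int[mu]_(r in D) (M r * cos (w * r)).

Let mD : measurable D. Proof. exact: measurable_itv. Qed.
Let mI : measurable I. Proof. exact: measurable_itv. Qed.
Let iz : mu.-integrable I (EFin \o z).
Proof. by apply: continuous_integrable_itv; exact: continuous_subspaceT. Qed.

(** Linear in H. For H = z cut off to ]0, tau[ it is the energy integral; for H = z * K it is that
    integral with one copy of z replaced by its convolution with K, so that K can be varied from
    cosines to tents. *)
Definition quad_form (H : R -> R) : R :=
  \int[mu]_(t in `]0, tau[) (z t * convol `]0, +oo[ M H t).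

Lemma continuous_bounded_conv2 K B : continuous K -> (forall x, `|K x| <= B) ->
  exists B', continuous (convol I z K) /\ forall x, `|convol I z K x| <= B'.
Proof.
move=> cK KB; exists (B * \int[mu]_(s in I) `|z s|); split.
  exact: (continuous_conv mI iz cK KB).
move=> x; apply: (le_norm_conv x mI iz _ KB).
exact: continuous_measurable_fun.
Qed.

Lemma integrable_quad_form H B : continuous H -> (forall x, `|H x| <= B) ->
  mu.-integrable I (EFin \o (fun t => z t * convol D M H t)).
Proof.
move=> cH HB.
apply: (@integrable_mul_bounded _ _ _ _ (B * \int[mu]_(s in D) `|M s|)) => //.
  apply: measurable_funTS; apply: continuous_measurable_fun.
  exact: (continuous_conv mD iM cH HB).
move=> x _; apply: (le_norm_conv x mD iM _ HB).
exact: continuous_measurable_fun.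
Qed.

Lemma quad_formD H1 H2 B1 B2 : continuous H1 -> (forall x, `|H1 x| <= B1) ->
  continuous H2 -> (forall x, `|H2 x| <= B2) ->
  quad_form (fun x => H1 x + H2 x) = quad_form H1 + quad_form H2.
Proof.
move=> c1 b1 c2 b2; rewrite /quad_form -RintegralD//;
  [|exact: (integrable_quad_form c1 b1)|exact: (integrable_quad_form c2 b2)].
apply: eq_Rintegral => t _; rewrite -mulrDr; congr (_ * _).
by apply: (convD t mD iM _ b1 _ b2); exact: continuous_measurable_fun.
Qed.

Lemma quad_formZ H B c : continuous H -> (forall x, `|H x| <= B) ->
  quad_form (fun x => c * H x) = c * quad_form H.
Proof.
move=> cH HB; rewrite /quad_form -RintegralZl//;
  last exact: (integrable_quad_form cH HB).
apply: eq_Rintegral => t _; rewrite mulrCA; congr (_ * _).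
by apply: (convZ c t mD iM _ HB); exact: continuous_measurable_fun.
Qed.

(** Convergence may fail at 0 and [tau], where the truncated z jumps; for each t these are only two
    values of the integration variable. *)
Lemma cvg_quad_form (Hn : nat -> R -> R) (H : R -> R) B :
  (forall n, continuous (Hn n)) -> measurable_fun setT H ->
  (forall n x, `|Hn n x| <= B) ->
  (forall x : R, x != 0 -> x != tau -> Hn ^~ x @ \oo --> H x) ->
  (fun n => quad_form (Hn n)) @ \oo --> quad_form H.
Proof.
move=> cHn mH HB HnH.
have mHn n : measurable_fun setT (Hn n) by exact: continuous_measurable_fun.
have cvgt t : (fun n => convol D M (Hn n) t) @ \oo --> convol D M H t.
  apply: (cvg_conv mD iM mHn mH HB).
  exists [set t; t - tau]; split.
  - by apply: measurableU; exact: measurable_set1.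
  - apply: countable_lebesgue_measure0; apply: finite_set_countable.
    exact: finite_set2.
  - move=> s /=; apply: contra_notP => /not_orP[st sttau] _.
    apply: HnH; first by rewrite subr_eq0; apply/eqP => e; apply: st.
    by apply/eqP => e; apply: sttau; rewrite -e; ring.
have mt n : measurable_fun I (convol D M (Hn n)).
  apply: measurable_funTS; apply: continuous_measurable_fun.
  exact: (continuous_conv mD iM (cHn n) (HB n)).
have mz := integrable_fun iz.
apply: (@Rdominated_cvg _ _ _ _ (fun t => (B * \int[mu]_(s in D) `|M s|) * `|z t|)) => //.
- by move=> n; exact: measurable_funM.
- by apply: aeW => t _; apply: cvgM; [exact: cvg_cst|exact: cvgt].
- apply: measurable_funM => //.
  apply: (@measurable_fun_cvg _ _ _ I (fun n => convol D M (Hn n))) => //.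
- by apply: integrable_scale => //; exact: integrable_norm.
- move=> n t _; rewrite normrM mulrC ler_wpM2r//.
  exact: (le_norm_conv t mD iM (mHn n) (HB n)).
Qed.

(** The addition formulas separate the variables. The terms with the sine transform Q of M cancel,
    and P (a^2 + b^2) remains, where P is the cosine transform of M. *)
Lemma quad_form_cos w : 0 <= quad_form (convol I z (fun v => cos (w * v))).
Proof.
have cc : continuous (fun v : R => cos (w * v)).
  move=> v; have h := is_derive_cos_mul w v.
  by apply: differentiable_continuous; apply/derivable1_diffP; exact: ex_derive.
have cs : continuous (fun v : R => sin (w * v)).
  move=> v; have h := is_derive_sin_mul w v.
  by apply: differentiable_continuous; apply/derivable1_diffP; exact: ex_derive.
have mc E : measurable_fun E (fun v : measurableTypeR R => cos (w * v)).
  by apply: measurable_funTS; exact: continuous_measurable_fun.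
have ms E : measurable_fun E (fun v : measurableTypeR R => sin (w * v)).
  by apply: measurable_funTS; exact: continuous_measurable_fun.
have izc : mu.-integrable I (EFin \o (fun s => z s * cos (w * s))).
  by apply: (@integrable_mul_bounded _ _ _ _ 1) => // s _; exact: cos_max.
have izs : mu.-integrable I (EFin \o (fun s => z s * sin (w * s))).
  by apply: (@integrable_mul_bounded _ _ _ _ 1) => // s _; exact: sin_max.
have iMc : mu.-integrable D (EFin \o (fun s => M s * cos (w * s))).
  by apply: (@integrable_mul_bounded _ _ _ _ 1) => // s _; exact: cos_max.
have iMs : mu.-integrable D (EFin \o (fun s => M s * sin (w * s))).
  by apply: (@integrable_mul_bounded _ _ _ _ 1) => // s _; exact: sin_max.
pose a := \int[mu]_(s in I) (z s * cos (w * s)).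
pose b := \int[mu]_(s in I) (z s * sin (w * s)).
pose P := \int[mu]_(s in D) (M s * cos (w * s)).
pose Q := \int[mu]_(s in D) (M s * sin (w * s)).
have E1 u : convol I z (fun v => cos (w * v)) u = a * cos (w * u) + b * sin (w * u).
  rewrite /a /b -!RintegralZr// -RintegralD//; last 2 first.
  - by apply: (@integrable_mul_bounded _ _ _ _ 1) => // s _; exact: cos_max.
  - by apply: (@integrable_mul_bounded _ _ _ _ 1) => // s _; exact: sin_max.
  by apply: eq_Rintegral => s _; rewrite mulrBr cosB; ring.
have E2 t : convol D M (convol I z (fun v => cos (w * v))) t =
    (a * P - b * Q) * cos (w * t) + (a * Q + b * P) * sin (w * t).
  transitivity (\int[mu]_(s in D) ((a * cos (w * t) + b * sin (w * t)) * (M s * cos (w * s)) +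
     (a * sin (w * t) - b * cos (w * t)) * (M s * sin (w * s)))).
    apply: eq_Rintegral => s _; rewrite E1 mulrBr cosB sinB; ring.
  rewrite RintegralD//; [|exact: integrable_scale|exact: integrable_scale].
  by rewrite !RintegralZl// -/P -/Q; ring.
have -> : quad_form (convol I z (fun v => cos (w * v))) = P * (a ^+ 2 + b ^+ 2).
  transitivity (\int[mu]_(t in I) ((a * P - b * Q) * (z t * cos (w * t)) +
     (a * Q + b * P) * (z t * sin (w * t)))).
    by apply: eq_Rintegral => t _; rewrite E2; ring.
  rewrite RintegralD//; [|exact: integrable_scale|exact: integrable_scale].
  by rewrite !RintegralZl// -/a -/b; ring.
by rewrite mulr_ge0 ?M_pos// addr_ge0 ?sqr_ge0.
Qed.

Lemma quad_form_cos_sum (N : nat) (c w : nat -> R) : (forall i, 0 <= c i) ->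
  0 <= quad_form (convol I z (fun v => \sum_(i < N) c i * cos (w i * v))).
Proof.
move=> c0.
have cc a b : continuous (fun v : R => a * cos (b * v)).
  move=> v; have h := is_derive_cos_mul b v.
  apply: cvgM; first exact: cvg_cst.
  by apply: differentiable_continuous; apply/derivable1_diffP; exact: ex_derive.
have bc a b (v : R) : `|a * cos (b * v)| <= `|a|.
  by rewrite normrM ler_piMr// cos_max.
have bs n (v : R) : `|\sum_(i < n) c i * cos (w i * v)| <= \sum_(i < n) `|c i|.
  by apply: le_trans (ler_norm_sum _ _ _) _; apply: ler_sum => i _; exact: bc.
have cs n : continuous (fun v : R => \sum_(i < n) c i * cos (w i * v)).
  by apply: (@continuous_sumn _ (fun i v => c i * cos (w i * v))) => i; exact: cc.
elim: N => [|N IH].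
  have -> : convol I z (fun v => \sum_(i < 0) c i * cos (w i * v)) = cst 0.
    apply/funext => u; rewrite -[RHS](@conv0 _ I z u).
    by congr convol; apply/funext => v; rewrite big_ord0.
  rewrite /quad_form (_ : (fun t => _) = cst 0) ?Rintegral_cst ?mul0r//.
  by apply/funext => t; rewrite [convol _ _ _ _](@conv0 _ D M t) mulr0.
have -> : convol I z (fun v => \sum_(i < N.+1) c i * cos (w i * v)) =
  (fun u => convol I z (fun v => \sum_(i < N) c i * cos (w i * v)) u +
            c N * convol I z (fun v => cos (w N * v)) u).
  apply/funext => u.
  have m1 : measurable_fun setT (fun v => cos (w N * v)).
    have := continuous_measurable_fun (cc 1 (w N)).
    by under eq_fun do rewrite mul1r.
  rewrite -(@convZ _ _ _ _ 1) => [||||x]; [|by []|exact: iz|exact: m1|exact: cos_max].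
  rewrite -(@convD _ _ _ _ _ (\sum_(i < N) `|c i|) `|c N|)//; last 2 first.
  - exact: continuous_measurable_fun.
  - exact: continuous_measurable_fun.
  by congr convol; apply/funext => v; rewrite big_ord_recr.
have [B1 [k1 b1]] := continuous_bounded_conv2 (cs N) (bs N).
have c1 : continuous (fun v : R => cos (w N * v)).
  by have := cc 1 (w N); under eq_fun do rewrite mul1r.
have [B2 [k2 b2]] := continuous_bounded_conv2 c1 (fun x => cos_max (w N * x)).
rewrite (@quad_formD _ _ B1 (c N * B2))//; last 2 first.
- by move=> x; apply: cvgM; [exact: cvg_cst|exact: k2].
- by move=> x; rewrite normrM (ger0_norm (c0 N)) ler_wpM2l.
rewrite (quad_formZ _ k2 b2); apply: addr_ge0; first exact: IH.
by apply: mulr_ge0; [exact: c0|exact: quad_form_cos].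
Qed.

Lemma quad_form_tent h : 0 < h <= 1 -> 0 <= quad_form (convol I z (tent h)).
Proof.
move=> h01.
(* The constant term of [tent_sum] becomes index 0, with frequency 0, so that the whole sum is one
   cosine sum. *)
pose c n i : R := if i is j.+1 then
    n.+1%:R / pi * (2 * (1 - cos (j.+1%:R * (h / n.+1%:R))) / j.+1%:R ^+ 2)
  else n.+1%:R / pi * ((h / n.+1%:R) ^+ 2 / 2).
pose w (n i : nat) : R := i%:R / n.+1%:R.
have tE n : tent_sum n h = fun v => \sum_(i < (n.+1 ^ 2).+1) c n i * cos (w n i * v).
  apply/funext => v; rewrite big_ord_recl /= /w mul0r mul0r cos0 mulr1.
  rewrite /tent_sum /= mulrDr mulr_sumr; congr (_ + _).
  by apply: eq_bigr => i _; rewrite -[RHS]mulrA.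
have c0 n i : 0 <= c n i.
  case: i => [|i] /=; rewrite mulr_ge0 ?divr_ge0 ?pi_ge0 ?sqr_ge0//.
have cs n : continuous (tent_sum n h).
  rewrite tE; apply: (@continuous_sumn _ (fun i v => c n i * cos (w n i * v))) => i v.
  apply: cvgM; first exact: cvg_cst.
  have d := is_derive_cos_mul (w n i) v.
  by apply: differentiable_continuous; apply/derivable1_diffP; exact: ex_derive.
have bs n (v : R) : `|tent_sum n h v| <= 9 by exact: tent_sum_bound.
have ct := @continuous_tent R h.
have bt v : `|tent h v| <= h.
  by rewrite ger0_norm ?tent_ge0// tent_le//; case/andP: h01 => /ltW.
have ms n : measurable_fun setT (tent_sum n h) by exact: continuous_measurable_fun.
have mt : measurable_fun setT (tent h) by exact: continuous_measurable_fun.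
apply: (@cvg_ge0 _ (fun n => quad_form (convol I z (tent_sum n h)))).
  by move=> n; rewrite tE; exact: quad_form_cos_sum.
apply: (@cvg_quad_form _ _ (9 * \int[mu]_(s in I) `|z s|)).
- by move=> n; exact: (continuous_conv mI iz (cs n) (bs n)).
- by apply: continuous_measurable_fun; exact: (continuous_conv mI iz ct bt).
- by move=> n x; exact: (le_norm_conv x mI iz (ms n) (bs n)).
- move=> x _ _; apply: (cvg_conv mI iz ms mt bs).
  by apply: aeW => s _; exact: tent_sum_cvg.
Qed.

(** The truncation turns the inner integral over ]0, t[ into a convolution over the half-line; its
    price is a jump at [tau], and at 0 if z 0 differs from 0. *)
Let zeta (s : R) : R := z s * \1_`]0%R, tau[%classic s.

Let zeta_in s : 0 < s < tau -> zeta s = z s.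
Proof. by move=> h; rewrite /zeta indicE mem_set ?mulr1//= in_itv. Qed.

Let zeta_out s : ~~ (0 < s < tau) -> zeta s = 0.
Proof. by move=> h; rewrite /zeta indicE memNset ?mulr0//= in_itv/=; apply/negP. Qed.

Let mzeta : measurable_fun setT zeta.
Proof.
apply: measurable_funM; first exact: continuous_measurable_fun.
exact: measurable_indic.
Qed.

Let conv_tent h u : 0 < h -> convol I z (tent h) u =
  \int[mu]_(s in `](u - h)%R, (u + h)%R[) (tent h (u - s) * zeta s).
Proof.
move=> h0; rewrite /convol [LHS]Rintegral_mkcond [RHS]Rintegral_mkcond.
apply: eq_Rintegral => s _; rewrite !patchE !mem_setE !in_itv/=.
case: ifPn => [s0|/zeta_out ->]; last by rewrite mulr0 if_same.
rewrite zeta_in//; case: ifPn => [_|]; first by rewrite mulrC.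
rewrite negb_and -!leNgt /tent => suh; rewrite max_r ?mulr0// subr_le0.
case/orP: suh => hs; first by apply: le_trans (ler_norm _); lra.
by rewrite distrC; apply: le_trans (ler_norm _); lra.
Qed.

(** The form is nonnegative when one copy of z is mollified by a tent, and narrowing the tents
    restores [zeta] away from its jumps. *)
Lemma positive_definite :
  0 <= \int[mu]_(t in `]0, tau[) (z t * \int[mu]_(r in `]0, t[) (M r * z (t - r))).
Proof.
have -> : \int[mu]_(t in `]0, tau[) (z t * \int[mu]_(r in `]0, t[) (M r * z (t - r))) =
   quad_form zeta.
  apply: eq_Rintegral => t; rewrite inE/= in_itv/= => /andP[t0 ttau]; congr (_ * _).
  rewrite /convol [LHS]Rintegral_mkcond [RHS]Rintegral_mkcond.
  apply: eq_Rintegral => r _; rewrite !patchE !mem_setE !in_itv/= andbT.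
  have [r0|//] := ltP 0 r; case: (ltP r t) => rt /=.
    by rewrite zeta_in// subr_gt0 rt/=; lra.
  by rewrite zeta_out ?mulr0// subr_gt0 ltNge rt.
have [Z Z0 HZ] := continuous_bounded_itv (continuous_subspaceT (A := `[0, tau]) cz).
have bz s : `|zeta s| <= Z.
  have [s0|s0] := boolP (0 < s < tau); last by rewrite zeta_out// normr0.
  by rewrite zeta_in// HZ//; case/andP: s0 => /ltW -> /ltW ->.
pose h (k : nat) : R := k.+1%:R^-1.
have h01 k : 0 < h k <= 1.
  by rewrite invr_gt0 ltr0n/= invf_le1 ?ltr0n// ler1n.
have h0 k : 0 < h k by case/andP: (h01 k).
have bt k v : `|tent (h k) v| <= h k by rewrite ger0_norm ?tent_ge0// tent_le// ltW.
have ck k : continuous (convol I z (tent (h k))).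
  exact: (continuous_conv mI iz (@continuous_tent _ _) (bt k)).
pose Hn k u := (h k ^+ 2)^-1 * convol I z (tent (h k)) u.
apply: (@cvg_ge0 _ (fun n => quad_form (Hn n))).
  move=> n; rewrite (@quad_formZ _ (h n * \int[mu]_(s in I) `|z s|))//.
    by rewrite mulr_ge0 ?invr_ge0 ?sqr_ge0// quad_form_tent.
  move=> x; apply: (le_norm_conv x mI iz _ (bt n)).
  by apply: continuous_measurable_fun; exact: continuous_tent.
apply: (@cvg_quad_form _ _ Z) => //.
- by move=> n x; apply: cvgM; [exact: cvg_cst|exact: ck].
- move=> n x; rewrite /Hn conv_tent//.
  have := @tent_mollify _ (h n) x 0 Z zeta (h0 n) mzeta; rewrite subr0; apply.
  by move=> s _; rewrite subr0.
move=> x x0 xtau; apply/cvgrPdist_le => e e0.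
(* Points closer to x than 0 and [tau] are lie on the same side of both, so the cut-off is constant
   near x and the continuity of z suffices. *)
have [d d0 Hd] : exists2 d, 0 < d & forall s, `|s - x| < d -> `|zeta s - zeta x| <= e.
  have czx : z y @[y --> x] --> z x by exact: cz.
  move/cvgrPdist_le : czx => /(_ e e0) czx; move/nbhs_ballP : czx => [d' /= d'0 Hd'].
  pose d := Num.min d' (Num.min `|x| `|x - tau|).
  have d0 : 0 < d by rewrite !lt_min d'0 !normr_gt0 x0 subr_eq0 xtau.
  exists d => // s sd.
  have sd' : `|s - x| < d' by apply: lt_le_trans sd _; rewrite ge_min lexx.
  have sx : `|s - x| < `|x| by apply: lt_le_trans sd _; rewrite !ge_min lexx orbT.
  have st : `|s - x| < `|x - tau| by apply: lt_le_trans sd _; rewrite !ge_min lexx !orbT.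
  have same : (0 < s < tau) = (0 < x < tau).
    move: sx st; rewrite !ltr_norml => /andP[s1 s2] /andP[s3 s4].
    apply/idP/idP => /andP[a b]; move: s1 s2 s3 s4.
      case: (ger0P x) => ?; case: (ger0P (x - tau)) => ?; lra.
    case: (ger0P x) => ?; case: (ger0P (x - tau)) => ?; lra.
  have [xin|xout] := boolP (0 < x < tau).
    rewrite !zeta_in ?same// distrC; apply: Hd'.
    by rewrite /ball/= distrC.
  by rewrite !zeta_out ?same// subrr normr0 ltW.
have [K HK] := le_div_nat 1 (divr_gt0 d0 (ltr0n R 2)).
exists K => // n /= Kn; rewrite distrC /Hn conv_tent//.
apply: (tent_mollify (h0 n) mzeta) => s hs; apply: Hd; apply: lt_trans hs _.
have hn := HK n Kn; rewrite mul1r in hn; apply: le_lt_trans hn _; lra.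
Qed.

End positivity.

(** * Scalar Volterra equations *)

Section within.
Context {R : realType}.
Implicit Types (f g : R -> R) (a b : R).

Lemma within_continuous_itvP a b f :
  {within `[a, b], continuous f} <->
  forall x : R, a <= x <= b -> forall e : R, 0 < e -> exists2 d : R, 0 < d &
    forall y : R, a <= y <= b -> `|y - x| < d -> `|f y - f x| <= e.
Proof.
split=> [/subspace_continuousP cf x xab e e0|h].
  have /cvgrPdist_le/(_ e e0) : f @ within `[a, b] (nbhs x) --> f x.
    by apply: cf; rewrite /= in_itv.
  rewrite near_withinE => /nbhs_ballP[d /= d0 hd].
  exists d => // y yab yd; rewrite distrC; apply: hd; last by rewrite /= in_itv.
  by rewrite /ball /= distrC.
apply/subspace_continuousP => x; rewrite /= in_itv/= => xab.
apply/cvgrPdist_le => e e0; have [d d0 hd] := h x xab e e0.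
rewrite near_withinE; apply/nbhs_ballP; exists d => //= y.
rewrite /ball/= => yd; rewrite in_itv/= => yab.
by rewrite distrC hd// distrC.
Qed.

(** The 1-Lipschitz projection onto [0, T]: composing with it extends a function continuous on
    [0, T] to the line, constant on each side. *)
Definition clamp (T t : R) : R := Num.min (Num.max t 0) T.

Lemma clamp_itv T t : 0 <= T -> 0 <= clamp T t <= T.
Proof.
by move=> T0; rewrite /clamp le_min T0 le_max lexx orbT ge_min lexx orbT.
Qed.

Lemma clamp_id T t : 0 <= t <= T -> clamp T t = t.
Proof. by move=> /andP[t0 tT]; rewrite /clamp max_l// min_l. Qed.

Lemma clamp_neg T t : 0 <= T -> t <= 0 -> clamp T t = 0.
Proof. by move=> T0 t0; rewrite /clamp max_r// min_l. Qed.

Lemma clamp_lip T t s : 0 <= T -> `|clamp T t - clamp T s| <= `|t - s|.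
Proof.
move=> T0; rewrite /clamp.
case: (lerP t 0) => t0; case: (lerP s 0) => s0;
  [have -> : Num.min 0 T = 0 by rewrite min_l|
   have -> : Num.min 0 T = 0 by rewrite min_l|
   have -> : Num.min 0 T = 0 by rewrite min_l|];
  rewrite ?subrr ?normr0 ?normr_ge0//.
- rewrite sub0r normrN ger0_norm; last by rewrite le_min T0 ltW.
  by rewrite ler0_norm; [rewrite ge_min; apply/orP; left; lra|lra].
- rewrite subr0 ger0_norm; last by rewrite le_min T0 ltW.
  by rewrite ger0_norm; [rewrite ge_min; apply/orP; left; lra|lra].
case: (lerP t T) => tT; case: (lerP s T) => sT; rewrite ?subrr ?normr0 ?normr_ge0//.
- by rewrite !ler0_norm; lra.
- by rewrite !ger0_norm; lra.
Qed.

Lemma continuous_clamp T f : 0 <= T -> {within `[0, T], continuous f} ->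
  continuous (fun t => f (clamp T t)).
Proof.
move=> T0 /within_continuous_itvP cf t; apply/cvgrPdist_le => e e0.
have [d d0 hd] := cf _ (clamp_itv t T0) e e0.
apply/nbhs_ballP; exists d => //= s; rewrite /ball/= => sd.
rewrite distrC; apply: hd; first exact: clamp_itv.
by apply: le_lt_trans (clamp_lip _ _ T0) _; rewrite distrC.
Qed.

(** The remaining increments from index k on sum to 2 C / 2^k, which gives both the Cauchy property
    and the rate. *)
Lemma geometric_cvg (u : nat -> R) (C : R) :
  (forall k, `|u k.+1 - u k| <= C / 2 ^+ k) ->
  exists2 l, u @ \oo --> l & forall k, `|l - u k| <= 2 * C / 2 ^+ k.
Proof.
move=> uC; pose g k : R := 2 * C / 2 ^+ k.
have p2 k : 0 < 2 ^+ k :> R by rewrite exprn_gt0.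
have gS k : g k - g k.+1 = C / 2 ^+ k.
  by rewrite /g exprS; field; rewrite gt_eqF.
have C0 : 0 <= C.
  by have := le_trans (normr_ge0 _) (uC 0%N); rewrite expr0 divr1.
have g0 k : 0 <= g k by rewrite divr_ge0 ?mulr_ge0// ltW.
have um m k : `|u (m + k)%N - u k| <= g k - g (m + k)%N.
  elim: m => [|m IH]; first by rewrite !subrr normr0.
  rewrite addSn.
  have -> : u (m + k).+1 - u k = (u (m + k).+1 - u (m + k)%N) + (u (m + k)%N - u k).
    by rewrite addrA subrK.
  apply: le_trans (ler_normD _ _) _; apply: le_trans (lerD (uC _) IH) _.
  by rewrite -gS; lra.
have unm n k : (k <= n)%N -> `|u n - u k| <= g k.
  by move=> kn; have := um (n - k)%N k; rewrite subnK// => h; have := g0 n; lra.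
have cu : cvgn u.
  apply: cauchy_cvg; apply: cauchy_exP => e /= e0.
  have [K HK] := le_div_nat (2 * C) (divr_gt0 e0 (ltr0n R 2)).
  exists (u K.+1); exists K.+1 => // n /= Kn; rewrite /ball/= distrC.
  apply: le_lt_trans (unm n K.+1 Kn) _; apply: le_lt_trans (_ : e / 2 < e); last by lra.
  apply: le_trans (HK K (leqnn _)); rewrite /g ler_wpM2l ?mulr_ge0// lef_pV2 ?posrE ?ltr0n//.
  by rewrite -natrX ler_nat ltnW// ltn_expl.
exists (limn u); first exact: cu.
move=> k; apply/ler_addgt0Pr => e e0.
have /cvgrPdist_le/(_ e e0)[n _ hn] := cu.
have := hn (maxn n k) (leq_maxl _ _); have := unm (maxn n k) k (leq_maxr _ _).
have := ler_distD (u (maxn n k)) (limn u) (u k); rewrite /g; lra.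
Qed.

End within.

Section geometric.
Context {R : realType}.

Lemma le_div_exp2 (c e : R) : 0 <= c -> 0 < e ->
  exists k : nat, c / 2 ^+ k <= e.
Proof.
move=> c0 e0; have [K HK] := le_div_nat c e0.
exists K.+1; apply: le_trans (HK K (leqnn _)).
rewrite ler_wpM2l// lef_pV2 ?posrE ?ltr0n ?exprn_gt0//.
by rewrite -natrX ler_nat ltnW// ltn_expl.
Qed.

Lemma eq0_geometric (x c : R) : (forall k : nat, `|x| <= c / 2 ^+ k) -> x = 0.
Proof.
move=> h; have c0 : 0 <= c.
  by have := le_trans (normr_ge0 _) (h 0%N); rewrite expr0 divr1.
apply/eqP; rewrite -normr_le0; apply/ler_addgt0Pr => e e0; rewrite add0r.
by have [k hk] := le_div_exp2 c0 e0; exact: le_trans (h k) hk.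
Qed.

End geometric.

Section volterra.
Context {R : realType}.
Notation mu := (leb R).
Implicit Types (y K : R -> R).

(** For a causal K and t <= T, [convol] over ]0, T[ is the Volterra integral over ]0, t[. Functions
    and equations thus live on the whole line, with no one-sided limits at 0. *)
Definition causal K := continuous K /\ forall t : R, t <= 0 -> K t = 0.

Definition primitive y (u : R) : R := \int[mu]_(s in `]0, u[) y s.

Lemma causal_bounded K (b : R) : causal K ->
  exists2 B, 0 <= B & forall x, x <= b -> `|K x| <= B.
Proof.
move=> [cK K0].
have [B B0 HB] := continuous_bounded_itv (continuous_subspaceT (A := `[0, b]) cK).
exists B => // x xb; have [x0|x0] := leP x 0; first by rewrite K0// normr0.
by rewrite HB// ltW.
Qed.

Lemma primitive_le0 y u : u <= 0 -> primitive y u = 0.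
Proof.
move=> u0; rewrite /primitive set_itv_ge ?Rintegral_set0//.
by rewrite bnd_simp -leNgt.
Qed.

Lemma is_derive_causal_primitive y (u : R) : causal y -> is_derive u 1 (primitive y) (y u).
Proof. by move=> [cy y0]; exact: is_derive_primitive. Qed.

Lemma causal_primitive y : causal y -> causal (primitive y).
Proof.
move=> cy; split; last by move=> t; exact: primitive_le0.
move=> u; have d := is_derive_causal_primitive u cy.
by apply: differentiable_continuous; apply/derivable1_diffP; exact: ex_derive.
Qed.

Lemma causalB K1 K2 : causal K1 -> causal K2 -> causal (fun t => K1 t - K2 t).
Proof.
move=> [c1 z1] [c2 z2]; split=> [t|t t0]; last by rewrite z1// z2// subrr.
by apply: cvgB; [exact: c1|exact: c2].
Qed.

Lemma causalZ (k : R) K : causal K -> causal (fun t => k * K t).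
Proof.
move=> [c1 z1]; split=> [t|t t0]; last by rewrite z1// mulr0.
by apply: cvgM; [exact: cvg_cst|exact: c1].
Qed.

Variables (N : R -> R) (T : R).
Hypothesis iN : mu.-integrable `]0, T[ (EFin \o N).
Hypothesis T0 : 0 < T.
Local Notation D := (`]0%R, T[%classic : set (measurableTypeR R)).
Let mD : measurable D. Proof. exact: measurable_itv. Qed.
Let m := \int[mu]_(r in D) `|N r|.

(** A causal function is bounded on half-lines x <= b only, while [continuous_conv] asks for a
    global bound. A convolution evaluated at t <= b does not see the change beyond b. *)
Lemma causal_truncate K (b : R) : causal K ->
  exists K' B, [/\ continuous K', forall x, `|K' x| <= B & forall x, x <= b -> K' x = K x].
Proof.
move=> cK; have [B B0 HB] := causal_bounded b cK; case: cK => cK K0.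
exists (fun x => K (Num.min x b)), B; split.
- move=> x; apply: (@continuous_comp _ _ _ (fun x => Num.min x b) K); last exact: cK.
  by apply: (@continuous_min R R id (cst b)); [exact: cvg_id|exact: cvg_cst].
- by move=> x; apply: HB; rewrite ge_min lexx orbT.
- by move=> x xb; rewrite min_l.
Qed.

Lemma conv_truncate K K' (b t : R) : (forall x, x <= b -> K' x = K x) -> t <= b ->
  convol D N K t = convol D N K' t.
Proof.
move=> KK' tb; apply: eq_Rintegral => r; rewrite inE/= in_itv/= => /andP[r0 _].
by rewrite KK'//; lra.
Qed.

Lemma integrable_causal_conv K t : causal K ->
  mu.-integrable D (EFin \o (fun r => N r * K (t - r))).
Proof.
move=> cK; have [B B0 HB] := causal_bounded t cK; case: cK => cK K0.
apply: (@integrable_mul_bounded _ _ _ _ B) => //.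
  by apply: measurable_reflect; exact: continuous_measurable_fun.
by move=> r /=; rewrite in_itv/= => /andP[r0 _]; apply: HB; lra.
Qed.

Lemma causal_conv K : causal K -> causal (convol D N K).
Proof.
move=> cK; split=> [t|t t0].
  have [K' [B [cK' HB KK']]] := causal_truncate (t + 1) cK.
  have ct := continuous_conv mD iN cK' HB (x := t).
  have e : {near t, convol D N K' =1 convol D N K}.
    apply/nbhs_ballP; exists 1 => //= s; rewrite /ball/= => ts.
    apply/esym; apply: (conv_truncate KK').
    by move: ts; rewrite ltr_norml; lra.
  rewrite /continuous_at (conv_truncate (K' := K') (b := t + 1))//; last by lra.
  by apply: cvg_trans ct; exact: near_eq_cvg.
rewrite /convol (_ : \int[mu]_(s in D) _ = \int[mu]_(s in D) cst 0 s).
  by rewrite Rintegral_cst ?mul0r.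
apply: eq_Rintegral => r; rewrite inE/= in_itv/= => /andP[r0 _].
by case: cK => _ ->; rewrite ?mulr0//; lra.
Qed.

Lemma conv_sub K1 K2 t : causal K1 -> causal K2 ->
  convol D N (fun x => K1 x - K2 x) t = convol D N K1 t - convol D N K2 t.
Proof.
move=> c1 c2; rewrite /convol -RintegralB//; [|exact: integrable_causal_conv..].
by apply: eq_Rintegral => r _; rewrite mulrBr.
Qed.

Lemma primitiveB y1 y2 u : causal y1 -> causal y2 ->
  primitive (fun x => y1 x - y2 x) u = primitive y1 u - primitive y2 u.
Proof.
move=> [c1 _] [c2 _]; rewrite /primitive -RintegralB//;
  by apply: continuous_integrable_itv; exact: continuous_subspaceT.
Qed.

Lemma conv_exp_bound K (c L t : R) : 0 <= c -> 0 <= L -> causal K ->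
  (forall x, `|K x| <= c * expR (L * x)) ->
  `|convol D N K t| <= m * c * expR (L * t).
Proof.
move=> c0 L0 [cK K0] HK; rewrite /m -mulrA mulrC.
apply: le_norm_Rintegral_mul => //.
  by apply: measurable_reflect; exact: continuous_measurable_fun.
move=> r /=; rewrite in_itv/= => /andP[r0 _]; apply: le_trans (HK _) _.
rewrite ler_wpM2l// ler_expR ler_wpM2l//; lra.
Qed.

(** The gain 1 / L in the weight e^{L x} is what makes the Volterra operator a contraction for large
    L. *)
Lemma primitive_exp_bound y (c L u : R) : 0 < L -> causal y ->
  (forall x, `|y x| <= c * expR (L * x)) ->
  `|primitive y u| <= c / L * expR (L * u).
Proof.
move=> L0 [cy y0] Hy.
have c0 : 0 <= c by have := le_trans (normr_ge0 _) (Hy 0); rewrite mulr0 expR0 mulr1.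
have [u0|u0] := leP u 0.
  by rewrite primitive_le0// normr0 mulr_ge0 ?expR_ge0// divr_ge0// ltW.
have yi : mu.-integrable `]0, u[ (EFin \o y).
  by apply: continuous_integrable_itv; exact: continuous_subspaceT.
have dE (x : R) : is_derive x 1 (fun x => c / L * expR (L * x)) (c * expR (L * x)).
  have h : is_derive x (1 : R) (fun y : R => L * y) L.
    by apply: is_derive_eq; rewrite scaler1.
  have h2 := @is_derive1_comp R (@expR R) (fun y : R => L * y) x _ _ (is_derive_expR _) h.
  have h3 : is_derive x 1 (fun x => c / L * expR (L * x)) (c / L * (expR (L * x) * L)).
    exact: is_deriveZ.
  by move: h3; congr is_derive; field; rewrite gt_eqF.
have cE : continuous (fun x : R => c * expR (L * x)).
  move=> x; have := dE x => d.
  apply: cvgM; first exact: cvg_cst.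
  apply: (@continuous_comp _ _ _ (fun x => L * x) expR); last exact: continuous_expR.
  by apply: cvgM; [exact: cvg_cst|exact: cvg_id].
have cF : continuous (fun x : R => c / L * expR (L * x)).
  move=> x; have d := dE x.
  by apply: differentiable_continuous; apply/derivable1_diffP; exact: ex_derive.
apply: le_trans (le_normr_Rintegral _ yi) _ => //.
apply: (@le_trans _ _ (\int[mu]_(s in `]0, u[) (c * expR (L * s)))).
  apply: le_Rintegral => //; first exact: integrable_norm.
  by apply: continuous_integrable_itv; exact: continuous_subspaceT.
rewrite (@FTC2_itv _ 0 u (fun x => c / L * expR (L * x)) (fun s => c * expR (L * s)) (ltW u0)).
- by rewrite mulr0 expR0 gerBl mulr1 divr_ge0// ltW.
- exact: continuous_subspaceT.
- exact: continuous_subspaceT.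
Qed.

(** The derivative falls on the primitive, under the integral; [N] enters the dominating function B
    |N| only. *)
Lemma is_derive_conv_primitive y (t : R) : causal y ->
  is_derive t 1 (convol D N (primitive y)) (convol D N y t).
Proof.
move=> cy; have cp := causal_primitive cy.
have [B B0 HB] := causal_bounded (t + 1) cy.
have d x r := is_derive_causal_primitive (x - r) cy.
have dd (x r : R) : is_derive x 1 (fun x => N r * primitive y (x - r)) (N r * y (x - r)).
  have h : is_derive x (1 : R) (fun x : R => x - r) 1.
    by apply: is_derive_eq; rewrite subr0.
  have h2 := @is_derive1_comp R (primitive y) (fun x : R => x - r) x _ _ (d x r) h.
  rewrite mulr1 in h2; exact: is_deriveZ.
have p1 x r : partial1of2 (fun x r => N r * primitive y (x - r)) x r = N r * y (x - r).
  by rewrite /partial1of2 derive1E; have := dd x r; exact: @derive_val.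
have It : `]t - 1, t + 1[%classic t by rewrite /= in_itv/=; lra.
have H1 : forall x, `]t - 1, t + 1[%classic x -> mu.-integrable D (EFin \o (fun r => N r * primitive y (x - r))).
  by move=> x _; exact: integrable_causal_conv.
have H2 : forall x r, `]t - 1, t + 1[%classic x -> D r -> derivable (fun x => N r * primitive y (x - r)) x 1.
  by move=> x r _ _; have h := dd x r; exact: ex_derive.
have H3 : forall r, 0 <= B * `|N r| by move=> r; rewrite mulr_ge0.
have H4 : mu.-integrable D (EFin \o (fun r => B * `|N r|)).
  by apply: integrable_scale => //; exact: integrable_norm.
have H5 : forall x r, `]t - 1, t + 1[%classic x -> D r ->
   `|partial1of2 (fun x r => N r * primitive y (x - r)) x r| <= B * `|N r|.
  move=> x r; rewrite /= !in_itv/= => /andP[_ xt] /andP[r0 _].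
  by rewrite p1 normrM mulrC ler_wpM2r// HB//; lra.
apply: DeriveDef.
  exact: (derivable_under_integral mD It H1 H2 H3 H4 H5).
rewrite -derive1E (differentiation_under_integral mD It H1 H2 H3 H4 H5).
by apply: eq_Rintegral => r _; rewrite p1.
Qed.

(** A linear contraction of factor 1/2 in the norm sup |y| e^{-L t}. The iteration starts at f, so
    the increments are at most F / 2^k times the weight, and the limit is continuous by local
    uniform convergence. *)
Lemma picard (W : (R -> R) -> R -> R) (f : R -> R) (L F : R) :
  causal f -> (forall t, `|f t| <= F * expR (L * t)) ->
  (forall y, causal y -> causal (W y)) ->
  (forall y1 y2 t, causal y1 -> causal y2 ->
     W (fun x => y1 x - y2 x) t = W y1 t - W y2 t) ->
  (forall y c, causal y -> (forall t, `|y t| <= c * expR (L * t)) ->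
     forall t, `|W y t| <= c / 2 * expR (L * t)) ->
  exists y, causal y /\ forall t, y t = f t - W y t.
Proof.
move=> cf fF cW WB Wc.
pose y k := iter k (fun y t => f t - W y t) f.
have cy k : causal (y k).
  by elim: k => [//|k IH]; rewrite /y iterS; apply: causalB => //; exact: cW.
have yS k t : y k.+1 t = f t - W (y k) t by rewrite /y iterS.
have dy k t : `|y k.+1 t - y k t| <= F / 2 ^+ k * expR (L * t).
  elim: k t => [|k IH] t.
    rewrite yS addrAC subrr sub0r normrN expr0 divr1.
    apply: le_trans (Wc _ F cf fF t) _; rewrite ler_wpM2r ?expR_ge0//.
    have := le_trans (normr_ge0 _) (fF 0); rewrite mulr0 expR0; lra.
  rewrite (yS k.+1) (yS k) opprB addrA addrAC (addrAC (f t)) subrr sub0r.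
  have := Wc (fun x => y k.+1 x - y k x) (F / 2 ^+ k) (causalB (cy _) (cy _)) IH t.
  by rewrite WB// -[F / _ / _]mulrA -invfM -exprSr distrC addrC.
have lim t : exists l, y ^~ t @ \oo --> l /\ forall k, `|l - y k t| <= 2 * F / 2 ^+ k * expR (L * t).
  have [|l h1 h2] := @geometric_cvg R (fun k => y k t) (F * expR (L * t)).
    by move=> k; apply: le_trans (dy k t) _; rewrite mulrAC.
  by exists l; split => // k; apply: le_trans (h2 k) _; rewrite mulrA mulrAC.
have /choice[l hl] := lim.
have ly t k : `|l t - y k t| <= 2 * F / 2 ^+ k * expR (L * t) by have [] := hl t.
have F0 : 0 <= F.
  by have := le_trans (normr_ge0 _) (fF 0); rewrite mulr0 expR0 mulr1.
have cl : causal l.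
  split=> [t|t t0]; last first.
    apply: (@eq0_geometric _ _ (2 * F * expR (L * t))) => k.
    by have := ly t k; have [_ ->//] := cy k; rewrite subr0 mulrAC.
  apply/cvgrPdist_le => e e0.
  (* A bound of the weight on the unit ball around t. *)
  pose X := expR (`|L| * (`|t| + 1)).
  have FX0 : 0 <= 2 * F * X by rewrite !mulr_ge0// expR_ge0.
  have [k hk] := le_div_exp2 FX0 (divr_gt0 e0 (ltr0n R 3)).
  have lyX x : `|t - x| < 1 -> `|l x - y k x| <= e / 3.
    move=> tx; apply: le_trans (ly x k) _; apply: le_trans hk.
    rewrite mulrAC ler_wpM2r ?invr_ge0 ?exprn_ge0// ler_wpM2l ?mulr_ge0//.
    rewrite ler_expR; apply: le_trans (ler_norm _) _; rewrite normrM ler_wpM2l//.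
    have -> : x = t - (t - x) by ring.
    by apply: le_trans (ler_normB _ _) _; rewrite lerD2l ltW.
  have ct : y k x @[x --> t] --> y k t by have [+ _] := cy k; exact.
  move/cvgrPdist_le : ct => /(_ _ (divr_gt0 e0 (ltr0n R 3))) /nbhs_ballP[d /= d0 hd].
  apply/nbhs_ballP; exists (Num.min d 1); first by rewrite /= lt_min d0 ltr01.
  move=> x; rewrite /ball/= lt_min => /andP[xd x1].
  have h1 := lyX t; rewrite subrr normr0 in h1.
  have h2 := lyX x x1; have h3 := hd x xd.
  have -> : l t - l x = (l t - y k t) + (y k t - y k x) - (l x - y k x) by ring.
  apply: le_trans (ler_normB _ _) _; apply: le_trans (lerD (ler_normD _ _) (lexx _)) _.
  have := h1 ltr01; move: h2 h3; move: (`|_|) (`|_|) (`|_|) => *; lra.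
exists l; split => // t.
apply/eqP; rewrite -subr_eq0; apply/eqP.
apply: (@eq0_geometric _ _ (2 * F * expR (L * t))) => k.
have -> : l t - (f t - W l t) = (l t - y k.+1 t) + (W l t - W (y k) t).
  by rewrite yS; ring.
rewrite -WB//; apply: le_trans (ler_normD _ _) _.
have lyk x : `|l x - y k x| <= 2 * F / 2 ^+ k * expR (L * x) by [].
have h1 := Wc _ _ (causalB cl (cy k)) lyk t.
apply: le_trans (lerD (ly t k.+1) h1) _.
rewrite exprS invfM; move: (2 ^+ k)^-1 (expR (L * t)) => p q.
by rewrite le_eqVlt; apply/orP; left; apply/eqP; field.
Qed.

Lemma volterra_exists (f : R -> R) (k F : R) : causal f -> 0 <= k ->
  (forall t, `|f t| <= F) ->
  exists y, causal y /\ forall t, y t = f t - k * convol D N (primitive y) t.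
Proof.
move=> cf k0 fF.
have m0 : 0 <= m by exact: Rintegral_ge0.
have F0 : 0 <= F := le_trans (normr_ge0 _) (fF 0).
(* Then k m / L <= 1/2, with m the L^1 norm of [N] on ]0, T[. *)
pose L := 2 * k * m + 1.
have L0 : 0 < L by rewrite ltr_wpDl// !mulr_ge0.
apply: (@picard (fun y t => k * convol D N (primitive y) t) f L F) => //.
- move=> t; have [t0|t0] := leP t 0.
    by have [_ ->//] := cf; rewrite normr0 mulr_ge0 ?expR_ge0.
  apply: le_trans (fF t) _; rewrite ler_peMr// -expR0 ler_expR mulr_ge0// ltW//.
- by move=> y cy; apply: causalZ; apply: causal_conv; exact: causal_primitive.
- move=> y1 y2 t c1 c2; rewrite -mulrBr; congr (_ * _).
  rewrite -conv_sub; [|exact: causal_primitive..].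
  by congr convol; apply/funext => x; exact: primitiveB.
- move=> y c cy Hy t; rewrite normrM (ger0_norm k0).
  have c0 : 0 <= c by have := le_trans (normr_ge0 _) (Hy 0); rewrite mulr0 expR0 mulr1.
  have h := fun x => primitive_exp_bound x L0 cy Hy.
  have h2 := conv_exp_bound t (divr_ge0 c0 (ltW L0)) (ltW L0) (causal_primitive cy) h.
  apply: le_trans (ler_wpM2l k0 h2) _.
  rewrite mulrA ler_wpM2r ?expR_ge0//.
  have -> : k * (m * (c / L)) = c * (k * m / L) by ring.
  rewrite ler_wpM2l// ler_pdivrMr// /L; lra.
Qed.

(** As a = 1 * N, associativity gives a * y = N * (1 * y); it is Fubini on the triangle s + r < t.
    The right side is the form that can be differentiated. *)
Lemma relax_a_convol y t : causal y -> 0 < t <= T ->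
  \int[mu]_(s in `]0, t[) (relax_a N (t - s) * y s) = convol D N (primitive y) t.
Proof.
move=> [cy y0] /andP[t0 tT].
pose E : set (measurableTypeR R * measurableTypeR R) := [set z | z.1 + z.2 < t].
have mE : measurable E.
  rewrite -[E]setTI; apply: (@measurable_fun_ltr _ (measurableTypeR R * measurableTypeR R)%type R setT
    (fun z => z.1 + z.2 : R) (cst t) _ _ measurableT [set true]) => //.
  exact: measurable_funD.
have iy : mu.-integrable `]0, t[ (EFin \o y).
  by apply: continuous_integrable_itv; exact: continuous_subspaceT.
have iNt : mu.-integrable `]0, t[ (EFin \o N) by exact: (integrable_itv_sub (lexx 0) tT).
have EE s r : ((s, r) \in E) = (s + r < t) by apply/idP/idP; rewrite inE.
transitivity (\int[mu]_(x in `]0, t[) (y x * \int[mu]_(y in `]0, t[) (N y * \1_E (x, y)))).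
  apply: eq_Rintegral => s; rewrite inE/= in_itv/= => /andP[s0 st].
  rewrite mulrC; congr (_ * _); rewrite /relax_a.
  rewrite [LHS]Rintegral_mkcond [RHS]Rintegral_mkcond.
  apply: eq_Rintegral => r _; rewrite !patchE !mem_setE !in_itv/= indicE EE.
  have [r0|//] := ltP 0 r => /=; rewrite ltrBrDl.
  have [sr|] := ltP (s + r) t; last by rewrite mulr0 if_same.
  have -> : r < t by lra.
  by rewrite mulr1.
rewrite (Rintegral_swap_indic (measurable_itv _) (measurable_itv _) mE iy iNt).
rewrite /convol [LHS]Rintegral_mkcond [RHS]Rintegral_mkcond.
apply: eq_Rintegral => r _; rewrite !patchE !mem_setE !in_itv/=.
have [r0|//] := ltP 0 r => /=; have [rt|tr] := ltP r t.
  have -> : r < T by lra.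
  congr (_ * _); rewrite /primitive [LHS]Rintegral_mkcond [RHS]Rintegral_mkcond.
  apply: eq_Rintegral => s _; rewrite !patchE !mem_setE !in_itv/= indicE EE ltrBrDr.
  have [s0|//] := ltP 0 s => /=.
  have [sr|] := ltP (s + r) t; last by rewrite mulr0 if_same.
  have -> : s < t by lra.
  by rewrite mulr1.
by rewrite primitive_le0 ?mulr0 ?if_same// subr_le0.
Qed.

Lemma is_derive_expRN (t : R) : is_derive t 1 (fun t : R => expR (- t)) (- expR (- t)).
Proof.
have h : is_derive t (1 : R) (fun t : R => - t) (-1) by exact: is_deriveN.
have := @is_derive1_comp R (@expR R) (fun t : R => - t) t _ _ (is_derive_expR _) h.
by rewrite mulrN1.
Qed.

(** Splitting e^{-t} = e^{-r} e^{-(t - r)} turns the damped N * y into the M * z of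
    [positive_definite]. *)
Lemma convol_damped y (t : R) : causal y -> 0 < t < T ->
  expR (- t) * convol D N y t =
  \int[mu]_(r in `]0, t[) (expR (- r) * N r * (expR (- (t - r)) * y (t - r))).
Proof.
move=> cy /andP[t0 tT]; rewrite /convol -RintegralZl//; last exact: integrable_causal_conv.
rewrite [LHS]Rintegral_mkcond [RHS]Rintegral_mkcond.
apply: eq_Rintegral => r _; rewrite !patchE !mem_setE !in_itv/=.
have [r0|//] := ltP 0 r => /=; have [rt|tr] := ltP r t.
  rewrite (lt_trans rt tT); have -> : - t = - r + - (t - r) by ring.
  by rewrite expRD; ring.
by case: cy => _ ->; rewrite ?mulr0 ?if_same// subr_le0.
Qed.

(** The bound does not contain k, hence serves all modes at once: k multiplies only a term of
    favourable sign in the identity for z(tau)^2. *)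
Lemma energy_bound (y f g : R -> R) (k G tau : R) :
  mu.-integrable `]0, +oo[ (EFin \o (fun r => expR (- r) * N r)) ->
  (forall w : R, 0 <= \int[mu]_(r in `]0, +oo[) (expR (- r) * N r * cos (w * r))) ->
  causal y -> 0 <= k ->
  (forall t, y t = f t - k * convol D N (primitive y) t) ->
  (forall t, 0 < t < T -> is_derive t 1 f (g t)) ->
  {within `[0, T], continuous g} ->
  (forall t, 0 <= t <= T -> `|g t| <= G) ->
  0 <= tau <= T -> `|y tau| <= expR T * (1 + G ^+ 2 * T).
Proof.
move=> iM Mpos cy k0 yE df cg gG /andP[tau0 tauT].
have G0 : 0 <= G by apply: le_trans (normr_ge0 (g 0)) (gG 0 _); rewrite lexx ltW.
pose q := convol D N y.
have [cq q0] : causal q by exact: causal_conv.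
have [yc y0] := cy.
pose z t := expR (- t) * y t.
have ce : continuous (fun t : R => expR (- t)).
  move=> t; have d := is_derive_expRN t.
  by apply: differentiable_continuous; apply/derivable1_diffP; exact: ex_derive.
have cz : continuous z by move=> t; apply: cvgM; [exact: ce|exact: yc].
have dz t : 0 < t < T -> is_derive t 1 z (expR (- t) * (g t - k * q t) - z t).
  move=> tT; have d1 := df t tT; have d2 := is_derive_conv_primitive t cy.
  have d3 : is_derive t 1 y (g t - k * q t).
    rewrite (_ : y = fun t => f t - k * convol D N (primitive y) t); last exact/funext.
    by apply: is_deriveB; exact: is_deriveZ.
  have d4 := is_derive_expRN t.
  have d5 := is_deriveM d4 d3.
  by move: d5; congr is_derive; rewrite /z /GRing.scale /=; ring.
(* The derivative of z^2 is P - 2 k Q: P holds the source and the damping, Q the memory term. *)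
pose P t := 2 * (z t * (expR (- t) * g t)) - 2 * (z t * z t).
pose Q t := z t * (expR (- t) * q t).
have sub0tau : (`[0, tau] : set R) `<=` `[0, T].
  by apply: subset_itvl; rewrite bnd_simp.
have cg' : {within `[0, tau], continuous g} by exact: continuous_subspaceW cg.
have cz' : {within `[0, tau], continuous z} by exact: continuous_subspaceT.
have ce' : {within `[0, tau], continuous (fun t : R => expR (- t))} by exact: continuous_subspaceT.
have cP : {within `[0, tau], continuous P}.
  move=> x; apply: cvgB; apply: cvgM; (try exact: cvg_cst); apply: cvgM.
  - exact: cz'.
  - by apply: cvgM; [exact: ce'|exact: cg'].
  - exact: cz'.
  - exact: cz'.
have cQ : continuous Q.
  by move=> x; apply: cvgM; [exact: cz|apply: cvgM; [exact: ce|exact: cq]].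
have cQ' : {within `[0, tau], continuous Q} by exact: continuous_subspaceT.
have iP := continuous_integrable_itv cP.
have iQ := continuous_integrable_itv cQ'.
have E : \int[mu]_(t in `]0, tau[) (P t - 2 * k * Q t) = z tau * z tau - z 0 * z 0.
  apply: (@FTC2_itv _ 0 tau (fun t => z t * z t)) => //.
  - by apply: continuous_subspaceT => x; apply: cvgM; exact: cz.
  - by move=> x; apply: cvgB; [exact: cP|apply: cvgM; [exact: cvg_cst|exact: cQ']].
  - move=> t /andP[t0 ttau]; have h : 0 < t < T by rewrite t0 (lt_le_trans ttau).
    have d := dz t h; have := is_deriveM d d.
    by congr is_derive; rewrite /P /Q /GRing.scale /=; ring.
have z0 : z 0 = 0 by rewrite /z y0 ?mulr0.
have Q0 : 0 <= \int[mu]_(t in `]0, tau[) Q t.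
  have := @positive_definite _ (fun r => expR (- r) * N r) z tau iM cz Mpos.
  congr (0 <= _); apply: eq_Rintegral => t; rewrite inE/= in_itv/= => /andP[t0 ttau].
  by rewrite /Q /q convol_damped// t0 (lt_le_trans ttau).
(* With b = e^{-t} g, the damping gives 2 z b - 2 z^2 <= b^2 <= G^2, so no Gronwall argument is
   involved. *)
have PG : \int[mu]_(t in `]0, tau[) P t <= G ^+ 2 * tau.
  rewrite -[tau in leRHS]subr0 -Rintegral_cst_itv//.
  apply: le_Rintegral => //; first exact: integrable_cst_itv.
  move=> t; rewrite /= in_itv/= => /andP[t0 ttau].
  have eg : `|expR (- t) * g t| <= G.
    rewrite normrM ger0_norm ?expR_ge0//.
    apply: le_trans (_ : 1 * `|g t| <= _).
      by rewrite ler_wpM2r// -expR0 ler_expR oppr_le0 ltW.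
    by rewrite mul1r gG// ltW//= ltW// (lt_le_trans ttau).
  rewrite /P; move: eg; rewrite -(ler_sqr (normr_ge0 _)) ?nnegrE// real_normK ?num_real//.
  move: (expR (- t) * g t) (z t) => b a; rewrite !expr2 => h.
  have := sqr_ge0 (a - b); rewrite expr2; have := sqr_ge0 a; rewrite expr2; lra.
have zt : z tau ^+ 2 <= G ^+ 2 * T.
  move: E; rewrite z0 mulr0 subr0 -expr2 RintegralB//; last exact: integrable_scale.
  rewrite RintegralZl// => <-.
  have : 0 <= 2 * k * \int[mu]_(t in `]0, tau[) Q t by rewrite !mulr_ge0.
  have : G ^+ 2 * tau <= G ^+ 2 * T by rewrite ler_wpM2l// sqr_ge0.
  lra.
have -> : y tau = expR tau * z tau by rewrite /z mulrA -expRD subrr expR0 mul1r.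
rewrite normrM ger0_norm ?expR_ge0//; apply: ler_pM; rewrite ?expR_ge0 ?ler_expR//.
(* The inequality |z| <= 1 + z^2 stands in for a square root. *)
have := sqr_ge0 (`|z tau| - 1); rewrite sqrrB1 real_normK ?num_real//.
move: (`|z tau|) (z tau ^+ 2) (normr_ge0 (z tau)) zt => a b a0 zt.
have := mulr_ge0 (sqr_ge0 G) (ltW T0); lra.
Qed.

End volterra.

(** * The space L2(0, pi) *)

Section L2.
Context {R : realType}.
Notation mu := (leb R).
Local Notation I := (`]0%R, pi[%classic : set (measurableTypeR R)).
Implicit Types (g h u phi : R -> R).

Let mI : measurable I. Proof. exact: measurable_itv. Qed.
Let pi_gt0 : 0 < pi :> R. Proof. exact: pi_gt0. Qed.

Definition L2sq g : R := \int[mu]_(x in `]0, pi[) g x ^+ 2.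

Lemma L2sq_ge0 g : 0 <= L2sq g.
Proof. by apply: Rintegral_ge0 => x _; rewrite sqr_ge0. Qed.

Lemma L2_measurable g : L2 g -> measurable_fun I g. Proof. by case. Qed.

Lemma L2P g : L2 g <->
  measurable_fun I g /\ mu.-integrable I (EFin \o (fun x => g x ^+ 2)).
Proof.
split=> [[mg fg]|[mg ig]]; split => //.
  apply/integrableP; split.
    by apply/measurable_EFinP; exact: measurable_funX.
  apply: le_lt_trans fg; rewrite le_eqVlt; apply/orP; left; apply/eqP.
  by apply: eq_integral => x _; rewrite /= ger0_norm// sqr_ge0.
exact: integrable_lty.
Qed.

Lemma L2_sqr_integrable g : L2 g -> mu.-integrable I (EFin \o (fun x => g x ^+ 2)).
Proof. by move=> /L2P[]. Qed.

Lemma le_L2 g h (c d : R) : measurable_fun I g -> L2 h ->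
  (forall x, 0 < x < pi -> g x ^+ 2 <= c * h x ^+ 2 + d) -> L2 g.
Proof.
move=> mg /L2P[mh ih] gh; apply/L2P; split => //.
apply: (@integrable_le _ _ _ (fun x => c * h x ^+ 2 + d)) => //.
- exact: measurable_funX.
- by move=> x; rewrite /= in_itv/= => xI; rewrite ger0_norm ?sqr_ge0// gh.
- by apply: integrable_add => //; [exact: integrable_scale|exact: integrable_cst_itv].
Qed.

Lemma L2_bounded g (B : R) : measurable_fun I g -> (forall x, 0 < x < pi -> `|g x| <= B) -> L2 g.
Proof.
move=> mg gB; apply/L2P; split => //; apply: (@integrable_bounded_itv _ _ _ (B ^+ 2)).
  exact: measurable_funX.
by move=> x /gB gx; rewrite normrX lerXn2r ?nnegrE// (le_trans _ gx).
Qed.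

Lemma L2_cst c : L2 (fun _ : R => c).
Proof. by apply: (@L2_bounded _ `|c|). Qed.

Lemma L2D g h : L2 g -> L2 h -> L2 (fun x => g x + h x).
Proof.
move=> Lg Lh; apply/L2P; split.
  by apply: measurable_funD; exact: L2_measurable.
apply: (@integrable_le _ _ _ (fun x => 2 * g x ^+ 2 + 2 * h x ^+ 2)) => //.
- by apply: measurable_funX; apply: measurable_funD; exact: L2_measurable.
- move=> x _; rewrite ger0_norm ?sqr_ge0//.
  by have := sqr_ge0 (g x - h x); rewrite sqrrB sqrrD; lra.
- by apply: integrable_add => //; apply: integrable_scale => //; exact: L2_sqr_integrable.
Qed.

Lemma L2Z c g : L2 g -> L2 (fun x => c * g x).
Proof.
move=> Lg; apply: (@le_L2 _ g (c ^+ 2) 0) => //.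
  by apply: measurable_funM => //; exact: L2_measurable.
by move=> x _; rewrite exprMn addr0.
Qed.

Lemma L2B g h : L2 g -> L2 h -> L2 (fun x => g x - h x).
Proof.
move=> Lg Lh; have := L2D Lg (L2Z (-1) Lh).
by congr L2; apply/funext => x; rewrite mulN1r.
Qed.

Lemma integrable_L2M g h : L2 g -> L2 h -> mu.-integrable I (EFin \o (fun x => g x * h x)).
Proof.
move=> Lg Lh.
apply: (@integrable_le _ _ _ (fun x => g x ^+ 2 + h x ^+ 2)) => //.
- by apply: measurable_funM; exact: L2_measurable.
- move=> x _; have := sqr_ge0 (g x - h x); have := sqr_ge0 (g x + h x).
  by rewrite sqrrB sqrrD => ? ?; rewrite ler_norml; apply/andP; split; lra.
- by apply: integrable_add => //; exact: L2_sqr_integrable.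
Qed.

Lemma integrable_L2 g : L2 g -> mu.-integrable I (EFin \o g).
Proof.
move=> Lg; have := integrable_L2M Lg (L2_cst 1).
by congr integrable; apply/funext => x /=; rewrite mulr1.
Qed.

Lemma L2_sum (F : nat -> R -> R) n : (forall i, L2 (F i)) -> L2 (fun x => \sum_(i < n) F i x).
Proof.
move=> LF; elim: n => [|n IH].
  by under eq_fun do rewrite big_ord0; exact: L2_cst.
by under eq_fun do rewrite big_ord_recr; exact: L2D.
Qed.

Lemma L2dist2E g h : L2 g -> L2 h -> L2dist2 g h = (L2sq (fun x => g x - h x))%:E.
Proof.
move=> Lg Lh; rewrite /L2dist2 EFin_Rintegral//.
by apply: L2_sqr_integrable; exact: L2B.
Qed.

Lemma L2sqB_triangle g h u : L2 g -> L2 h -> L2 u ->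
  L2sq (fun x => g x - u x) <= 2 * L2sq (fun x => g x - h x) + 2 * L2sq (fun x => h x - u x).
Proof.
move=> Lg Lh Lu.
have i1 := L2_sqr_integrable (L2B Lg Lh).
have i2 := L2_sqr_integrable (L2B Lh Lu).
have i3 := L2_sqr_integrable (L2B Lg Lu).
rewrite /L2sq -!RintegralZl// -RintegralD//; [|exact: integrable_scale..].
apply: le_Rintegral => //.
  by apply: integrable_add => //; exact: integrable_scale.
move=> x _; have := sqr_ge0 ((g x - h x) - (h x - u x)).
have -> : g x - u x = (g x - h x) + (h x - u x) by ring.
move: (g x - h x) (h x - u x) => A B; rewrite sqrrB sqrrD; lra.
Qed.

Lemma L2innerBl g h phi : L2 g -> L2 h -> L2 phi ->
  L2inner (fun x => g x - h x) phi = L2inner g phi - L2inner h phi.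
Proof.
move=> Lg Lh Lp; rewrite /L2inner -RintegralB//; [|exact: integrable_L2M..].
by apply: eq_Rintegral => x _; rewrite mulrBl.
Qed.

Lemma L2innerDl g h phi : L2 g -> L2 h -> L2 phi ->
  L2inner (fun x => g x + h x) phi = L2inner g phi + L2inner h phi.
Proof.
move=> Lg Lh Lp; rewrite /L2inner -RintegralD//; [|exact: integrable_L2M..].
by apply: eq_Rintegral => x _; rewrite mulrDl.
Qed.

Lemma L2innerZl c g phi : L2 g -> L2 phi ->
  L2inner (fun x => c * g x) phi = c * L2inner g phi.
Proof.
move=> Lg Lp; rewrite /L2inner -RintegralZl//; last exact: integrable_L2M.
by apply: eq_Rintegral => x _; rewrite mulrA.
Qed.

Lemma L2inner_sum (F : nat -> R -> R) n phi : (forall i, L2 (F i)) -> L2 phi ->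
  L2inner (fun x => \sum_(i < n) F i x) phi = \sum_(i < n) L2inner (F i) phi.
Proof.
move=> LF Lp; elim: n => [|n IH].
  rewrite big_ord0 /L2inner; under eq_Rintegral do rewrite big_ord0 mul0r.
  by rewrite Rintegral_cst ?mul0r.
rewrite big_ord_recr /= -IH -L2innerDl//; last exact: L2_sum.
by apply: eq_Rintegral => x _; rewrite big_ord_recr.
Qed.

(* With the parameter [c] this does the work of Cauchy-Schwarz without square roots. *)
Lemma L2inner_young (c : R) g phi : 0 < c -> L2 g -> L2 phi ->
  `|L2inner g phi| <= c * L2sq g + c^-1 * L2sq phi.
Proof.
move=> c0 Lg Lp.
have i1 := L2_sqr_integrable Lg.
have i2 := L2_sqr_integrable Lp.
rewrite /L2sq -!RintegralZl// -RintegralD//; [|exact: integrable_scale..].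
apply: le_trans (le_normr_Rintegral _ (integrable_L2M Lg Lp)) _ => //.
apply: le_Rintegral => //.
- by apply: integrable_norm; exact: integrable_L2M.
- by apply: integrable_add => //; exact: integrable_scale.
move=> x _; rewrite normrM -[g x ^+ 2]real_normK ?num_real// -[phi x ^+ 2]real_normK ?num_real//.
move: (normr_ge0 (g x)) (normr_ge0 (phi x)); move: (`|g x|) (`|phi x|) => a b a0 b0.
have : 0 <= c * (a - c^-1 * b) ^+ 2 by rewrite mulr_ge0 ?sqr_ge0// ltW.
have -> : c * (a - c^-1 * b) ^+ 2 = c * a ^+ 2 + c^-1 * b ^+ 2 - 2 * (a * b).
  by field; rewrite gt_eqF.
have := mulr_ge0 a0 b0; lra.
Qed.

Lemma Rintegral_cos_nat (a : R) : a != 0 -> sin (a * pi) = 0 ->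
  \int[mu]_(x in `]0, pi[) cos (a * x) = 0.
Proof.
move=> a0 sa.
transitivity (a^-1 * sin (a * pi) - a^-1 * sin (a * 0)); last first.
  by rewrite sa [a * 0]mulr0 sin0 !mulr0 subrr.
apply: (@FTC2_itv _ 0 pi (fun x => a^-1 * sin (a * x)) (fun x => cos (a * x)) (ltW pi_gt0)).
- apply: continuous_subspaceT => x; have d := is_derive_sin_mul a x.
  apply: cvgM; first exact: cvg_cst.
  by apply: differentiable_continuous; apply/derivable1_diffP; exact: ex_derive.
- apply: continuous_subspaceT => x; have d := is_derive_cos_mul a x.
  by apply: differentiable_continuous; apply/derivable1_diffP; exact: ex_derive.
- move=> x _; have := is_deriveZ a^-1 (is_derive_sin_mul a x).
  by congr is_derive; rewrite /GRing.scale /= mulKf.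
Qed.

Definition sine (n : nat) (x : R) : R := sin (n.+1%:R * x).

Lemma continuous_sine n : continuous (sine n).
Proof.
move=> x; have d := is_derive_sin_mul n.+1%:R x.
by apply: differentiable_continuous; apply/derivable1_diffP; exact: ex_derive.
Qed.

Lemma measurable_sine n D : measurable_fun (D : set (measurableTypeR R)) (sine n).
Proof. by apply: measurable_funTS; apply: continuous_measurable_fun; exact: continuous_sine. Qed.

Lemma L2_sine n : L2 (sine n).
Proof.
apply: (@L2_bounded _ 1); first exact: measurable_sine.
by move=> x _; exact: sin_max.
Qed.

Lemma integrable_cos_mul (a : R) : mu.-integrable I (EFin \o (fun x => cos (a * x))).
Proof.
apply: continuous_integrable_itv; apply: continuous_subspaceT => x.
have d := is_derive_cos_mul a x.
by apply: differentiable_continuous; apply/derivable1_diffP; exact: ex_derive.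
Qed.

Lemma sine_orthogonal n k : n != k -> L2inner (sine n) (sine k) = 0.
Proof.
move=> nk; rewrite /L2inner /sine.
transitivity (\int[mu]_(x in `]0, pi[) (2^-1 * cos ((n.+1%:R - k.+1%:R) * x) -
   2^-1 * cos ((n.+1%:R + k.+1%:R) * x))).
  by apply: eq_Rintegral => x _; rewrite mulrBl mulrDl cosB cosD; field.
rewrite RintegralB//; [|by apply: integrable_scale => //; exact: integrable_cos_mul..].
rewrite !RintegralZl//; [|exact: integrable_cos_mul..].
rewrite !Rintegral_cos_nat ?mulr0 ?subrr//.
- by rewrite subr_eq0 eqr_nat eqSS.
- by rewrite mulrBl sinB !sin_nat_pi mul0r mulr0 subrr.
- by rewrite -natrD sin_nat_pi.
Qed.

Lemma sine_norm n : L2inner (sine n) (sine n) = pi / 2.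
Proof.
rewrite /L2inner /sine.
transitivity (\int[mu]_(x in `]0, pi[) (2^-1 - 2^-1 * cos (2 * n.+1%:R * x))).
  apply: eq_Rintegral => x _.
  have -> : 2 * n.+1%:R * x = (n.+1%:R * x) *+ 2 by rewrite -mulrA mulr_natl.
  by rewrite cos_mulr2n cos2sin2; field.
rewrite RintegralB//; last 2 first.
- exact: integrable_cst_itv.
- by apply: integrable_scale => //; exact: integrable_cos_mul.
rewrite RintegralZl//; last exact: integrable_cos_mul.
rewrite Rintegral_cos_nat.
- by rewrite Rintegral_cst_itv ?(ltW pi_gt0)// mulr0 !subr0 mulrC.
- by rewrite mulf_neq0// pnatr_eq0.
- by rewrite -natrM sin_nat_pi.
Qed.

Lemma L2sq_sine_sum (c : nat -> R) n :
  L2sq (fun x => \sum_(i < n) c i * sine i x) = pi / 2 * \sum_(i < n) c i ^+ 2.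
Proof.
have LF k : L2 (fun x => \sum_(i < k) c i * sine i x).
  by apply: (@L2_sum (fun i x => c i * sine i x)) => i; apply: L2Z; exact: L2_sine.
elim: n => [|n IH].
  rewrite big_ord0 mulr0 /L2sq; under eq_Rintegral do rewrite big_ord0 expr0n.
  by rewrite Rintegral_cst ?mul0r.
have Ls := L2Z (c n) (L2_sine n).
transitivity (\int[mu]_(x in `]0, pi[) (((\sum_(i < n) c i * sine i x) ^+ 2 +
    2 * ((\sum_(i < n) c i * sine i x) * (c n * sine n x))) + (c n * sine n x) ^+ 2)).
  by apply: eq_Rintegral => x _; rewrite big_ord_recr sqrrD /= mulr_natl.
have i1 := L2_sqr_integrable (LF n).
have i2 := integrable_L2M (LF n) Ls.
have i3 := L2_sqr_integrable Ls.
rewrite RintegralD//; last by apply: integrable_add => //; exact: integrable_scale.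
rewrite RintegralD//; last exact: integrable_scale.
rewrite RintegralZl// -[X in X + _ + _]/(L2sq _) IH.
rewrite -[X in _ + 2 * X + _]/(L2inner _ _).
rewrite (@L2inner_sum (fun i x => c i * sine i x))//; last first.
  by move=> i; apply: L2Z; exact: L2_sine.
rewrite [\sum_(i < n) L2inner _ _]big1 ?mulr0 ?addr0; last first.
  move=> i _; rewrite L2innerZl//; last exact: L2_sine.
  have -> : L2inner (sine i) (fun x => c n * sine n x) = c n * L2inner (sine n) (sine i).
    rewrite -L2innerZl; [|exact: L2_sine..].
    by apply: eq_Rintegral => x _; rewrite mulrC.
  by rewrite sine_orthogonal ?mulr0// gtn_eqF.
have -> : \int[mu]_(x in `]0, pi[) (c n * sine n x) ^+ 2 = c n ^+ 2 * L2inner (sine n) (sine n).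
  rewrite /L2inner -RintegralZl//; last by apply: integrable_L2M; exact: L2_sine.
  by apply: eq_Rintegral => x _; rewrite exprMn expr2 [sine n x ^+ 2]expr2.
by rewrite sine_norm big_ord_recr /= mulrDr [_ * (pi / 2)]mulrC.
Qed.

(* Fast convergence makes the sum of the weighted squared increments integrable; it
   dominates the whole tail, so no Minkowski inequality is needed. *)
Lemma riesz_fischer (u : nat -> R -> R) (C : R) :
  (forall k, L2 (u k)) ->
  (forall k, L2sq (fun x => u k.+1 x - u k x) <= C / 8 ^+ k) ->
  exists2 v : R -> R, L2 v &
    forall k, L2sq (fun x => v x - u k x) <= 8 * C / 4 ^+ k.
Proof.
move=> Lu uC.
have C0 : 0 <= C by have := le_trans (L2sq_ge0 _) (uC 0%N); rewrite expr0 divr1.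
(* The weight leaves C / 2^k in the integral of the k-th term, and still forces increments at most
   sqrt (S x) / 2^k pointwise. *)
pose d k x : R := 4 ^+ k * (u k.+1 x - u k x) ^+ 2.
have d0 k x : 0 <= d k x.
  by apply: mulr_ge0; [exact: exprn_ge0|exact: sqr_ge0].
pose S x := (\sum_(k <oo) (d k x)%:E)%E.
have md k : measurable_fun I (d k).
  by apply: measurable_funM => //; apply: measurable_funX; apply: measurable_funB;
    exact: L2_measurable.
have S0 x : (0 <= S x)%E by apply: nneseries_ge0 => k _ _; rewrite lee_fin.
have mS : measurable_fun I S.
  apply: ge0_emeasurable_sum => // k.
    by move=> x _ _; rewrite lee_fin.
  by move=> _; apply/measurable_EFinP.
have iS : (\int[mu]_(x in I) S x <= (2 * C)%:E)%E.
  rewrite integral_nneseries//; last 2 first.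
  - by move=> k; apply/measurable_EFinP.
  - by move=> k x _; rewrite lee_fin.
  apply: lime_le.
    by apply: is_cvg_nneseries => k _ _; apply: integral_ge0 => x _; rewrite lee_fin.
  apply: nearW => n.
  apply: (@le_trans _ _ (\sum_(0 <= k < n) (C / 2 ^+ k)%:E)%E).
    apply: lee_sum => k _.
    have ik := L2_sqr_integrable (L2B (Lu k.+1) (Lu k)).
    rewrite EFin_Rintegral//; last exact: integrable_scale.
    rewrite lee_fin RintegralZl//; apply: le_trans (ler_wpM2l _ (uC k)) _.
      by rewrite exprn_ge0.
    rewrite mulrCA ler_wpM2l//.
    have -> : 8 ^+ k = 4 ^+ k * 2 ^+ k :> R by rewrite -exprMn -natrM.
    by rewrite invfM mulrA mulfV ?mul1r// expf_neq0.
  rewrite sumEFin lee_fin.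
  have : \sum_(0 <= k < n) C / 2 ^+ k = 2 * C - 2 * C / 2 ^+ n.
    elim: n => [|n IH]; first by rewrite big_geq// expr0 divr1 subrr.
    rewrite big_nat_recr//= IH exprS; field.
    by rewrite expf_neq0.
  by move=> ->; rewrite gerBl divr_ge0 ?mulr_ge0// exprn_ge0.
(* Off E the limit is set to 0; the estimate of [bnd] is trivial there because S is infinite. *)
pose E := I `&` [set x | S x < +oo]%E.
have mE : measurable E.
  exact: (measurable_lte mI mS (@measurable_cst _ _ _ _ I (+oo%E : \bar R))).
have lim x : exists l : R, (E x -> (fun k => u k x) @ \oo --> l /\
      forall k, (l - u k x) ^+ 2 <= 4 * fine (S x) / 4 ^+ k) /\ (~ E x -> l = 0).
  have [Ex|nEx] := pselect (E x); last by exists 0.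
  have Sx : S x = (fine (S x))%:E by rewrite fineK// ge0_fin_numE//; case: Ex.
  have s0 : 0 <= fine (S x) by rewrite fine_ge0.
  have ds k : d k x <= fine (S x).
    rewrite -lee_fin -Sx.
    have dx0 i : (0%N <= i)%N -> xpredT i -> (0 <= (d i x)%:E)%E by rewrite lee_fin.
    apply: le_trans (nneseries_lim_ge k.+1 dx0).
    rewrite sumEFin lee_fin big_nat_recr//= lerDr.
    by apply: sumr_ge0.
  have [|l h1 h2] := @geometric_cvg R (fun k => u k x) (Num.sqrt (fine (S x))).
    move=> k; rewrite ler_pdivlMr ?exprn_gt0//.
    rewrite -[X in `|_| * X]ger0_norm ?exprn_ge0// -normrM -sqrtr_sqr ler_wsqrtr//.
    by rewrite exprMn exprAC mulrC -natrX; exact: ds.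
  exists l; split => // _; split => // k.
  have := h2 k; rewrite -(ler_sqr (normr_ge0 _)); last first.
    by rewrite nnegrE divr_ge0 ?mulr_ge0 ?sqrtr_ge0// exprn_ge0.
  rewrite real_normK ?num_real// !exprMn exprVn sqr_sqrtr// exprAC.
  by rewrite -!natrX.
have {lim}/choice[v Hv] := lim.
have mv : measurable_fun I v.
  apply: (@measurable_fun_cvg _ _ _ I (fun k x => u k x * \1_E x)).
    by move=> k; apply: measurable_funM; [exact: L2_measurable|exact: measurable_indic].
  move=> x Ix; have [Ex|nEx] := pselect (E x).
    have [/(_ Ex)[h _] _] := Hv x.
    rewrite (_ : (fun k => _) = (fun k => u k x))//.
    by apply/funext => k; rewrite indicE mem_set// mulr1.
  have [_ /(_ nEx) ->] := Hv x.
  rewrite (_ : (fun k => _) = cst 0); first exact: cvg_cst.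
  by apply/funext => k; rewrite indicE memNset// mulr0.
have bnd k : (\int[mu]_(x in I) ((v x - u k x) ^+ 2)%:E <= (8 * C / 4 ^+ k)%:E)%E.
  apply: (@le_trans _ _ (\int[mu]_(x in I) ((4 / 4 ^+ k)%:E * S x))%E).
    apply: ge0_le_integral => //.
    - by move=> x _; rewrite lee_fin sqr_ge0.
    - by apply/measurable_EFinP; apply: measurable_funX; apply: measurable_funB => //; exact: L2_measurable.
    - by apply: measurable_funeM.
    - move=> x Ix; have [Ex|nEx] := pselect (E x).
        have Sx : S x = (fine (S x))%:E by rewrite fineK// ge0_fin_numE//; case: Ex.
        by rewrite Sx -EFinM lee_fin mulrAC; have [/(_ Ex)[_ h] _] := Hv x.
      have -> : S x = +oo%E.
        by apply/eqP; rewrite -leye_eq leNgt; apply/negP => h; apply: nEx; split.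
      by rewrite gt0_muley ?leey// lte_fin divr_gt0// exprn_gt0.
  rewrite ge0_integralZl_EFin ?divr_ge0 ?exprn_ge0//.
  apply: le_trans (lee_wpmul2l _ iS) _; first by rewrite lee_fin divr_ge0// exprn_ge0.
  rewrite -EFinM lee_fin le_eqVlt; apply/orP; left; apply/eqP; field.
  by rewrite expf_neq0.
have Lvu k : L2 (fun x => v x - u k x).
  split; first by apply: measurable_funB => //; exact: L2_measurable.
  exact: le_lt_trans (bnd k) (ltry _).
exists v.
  have := L2D (Lvu 0%N) (Lu 0%N).
  by congr L2; apply/funext => x; rewrite subrK.
move=> k; rewrite -lee_fin; apply: le_trans (bnd k).
by rewrite EFin_Rintegral//; exact: L2_sqr_integrable.
Qed.

Lemma sum_tail_bound (a : nat -> R) (A : R) m n : (0 < m)%N -> (m <= n)%N ->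
  (forall i, `|a i| <= A / i.+1%:R ^+ 2) ->
  `|\sum_(i < n) a i - \sum_(i < m) a i| <= A / m%:R.
Proof.
move=> m0 mn aA; have A0 : 0 <= A.
  by have := le_trans (normr_ge0 _) (aA 0%N); rewrite expr1n divr1.
rewrite -!(big_mkord xpredT a) (big_cat_nat (leq0n m) mn)//= addrAC subrr add0r.
apply: le_trans (ler_norm_sum _ _ _) _.
apply: le_trans (_ : \sum_(m <= i < n) A / i.+1%:R ^+ 2 <= _).
  by apply: ler_sum => i _; exact: aA.
by rewrite -mulr_sumr ler_wpM2l// sum_invsqr_tail.
Qed.

Lemma L2sq_sine_diff (c : nat -> R) m n : (m <= n)%N ->
  L2sq (fun x => \sum_(i < n) c i * sine i x - \sum_(i < m) c i * sine i x) =
  pi / 2 * (\sum_(i < n) c i ^+ 2 - \sum_(i < m) c i ^+ 2).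
Proof.
(* The difference is again a sine sum of length n, with the first m coefficients erased; E applies
   to the sums of sines and to the sums of squares. *)
move=> mn; pose c' i := if (i < m)%N then 0 else c i.
have E (F : R -> nat -> R) : (forall i, F 0 i = 0) ->
    \sum_(i < n) F (c i) i - \sum_(i < m) F (c i) i = \sum_(i < n) F (c' i) i.
  move=> F0.
  rewrite -(big_mkord xpredT (fun i => F (c i) i)) -(big_mkord xpredT (fun i => F (c' i) i)).
  rewrite -(big_mkord xpredT (fun i => F (c i) i)) !(big_cat_nat (leq0n m) mn)//=.
  rewrite addrAC subrr add0r.
  have -> : \sum_(0 <= i < m) F (c' i) i = 0.
    by rewrite big_nat_cond big1// => i /andP[/andP[_ im] _]; rewrite /c' im F0.
  rewrite add0r.
  rewrite big_nat_cond [RHS]big_nat_cond; apply: eq_bigr => i /andP[/andP[mi _] _].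
  by rewrite /c' ltnNge mi.
rewrite (E (fun c _ => c ^+ 2)); last by move=> _; rewrite expr0n.
rewrite -L2sq_sine_sum; congr L2sq; apply/funext => x.
by rewrite (E (fun c i => c * sine i x))// => i; rewrite mul0r.
Qed.

End L2.

(** * Existence *)

Section CL2.
Context {R : realType}.
Notation mu := (leb R).
Implicit Types (u : R -> R -> R) (phi g h : R -> R).

Lemma mem_itvcc (a b x : R) : (x \in `[a, b]) = (a <= x <= b).
Proof. by apply/idP/idP => [|h]; rewrite ?inE/= in_itv. Qed.

Lemma L2sq_sym g h : L2sq (fun x => g x - h x) = L2sq (fun x => h x - g x) :> R.
Proof. by apply: eq_Rintegral => x _; rewrite -opprB sqrrN. Qed.

Lemma CL2P T u : CL2 T u <->
  (forall t, 0 <= t <= T -> L2 (u t)) /\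
  (forall t, 0 <= t <= T -> forall e : R, 0 < e -> exists2 d : R, 0 < d &
    forall s, 0 <= s <= T -> `|s - t| < d -> L2sq (fun x => u s x - u t x) <= e).
Proof.
split=> -[Lu cu].
  have {}Lu t : 0 <= t <= T -> L2 (u t) by move=> tT; apply: Lu; rewrite mem_itvcc.
  split => // t tT e e0.
  have tT' : t \in `[0, T] by rewrite mem_itvcc.
  have [d d0 hd] := cu t tT' e e0.
  exists d => // s sT st; have := hd s; rewrite mem_itvcc => /(_ sT st).
  by rewrite L2dist2E ?lte_fin; [exact: ltW|exact: Lu|exact: Lu].
split=> t; rewrite mem_itvcc => tT; first exact: Lu.
move=> e e0; have [d d0 hd] := cu t tT (e / 2) (divr_gt0 e0 (ltr0n R 2)).
exists d => // s; rewrite mem_itvcc => sT st.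
rewrite L2dist2E ?lte_fin; [|exact: Lu|exact: Lu].
by apply: le_lt_trans (hd s sT st) _; lra.
Qed.

Lemma CL2_inner_continuous T u phi : CL2 T u -> L2 phi ->
  {within `[0, T], continuous (fun t => L2inner (u t) phi)}.
Proof.
move=> /CL2P[Lu cu] Lp; apply/within_continuous_itvP => t tT e e0.
(* The parameter for [L2inner_young]: the part with phi is at most e / 2, also when phi is null, and
   d makes the other part e / 2. *)
pose c := 2 * (L2sq phi + 1) / e.
have p0 := L2sq_ge0 phi.
have c0 : 0 < c by rewrite divr_gt0// mulr_gt0//; lra.
have [d d0 hd] := cu t tT (e / (2 * c)) (divr_gt0 e0 (mulr_gt0 (ltr0n R 2) c0)).
exists d => // s sT st; rewrite -L2innerBl//; [|exact: Lu|exact: Lu].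
apply: le_trans (L2inner_young c0 (L2B (Lu _ sT) (Lu _ tT)) Lp) _.
apply: le_trans (lerD (ler_wpM2l (ltW c0) (hd s sT st)) (lexx _)) _.
have -> : c * (e / (2 * c)) = e / 2 by field; rewrite gt_eqF.
have -> : c^-1 * L2sq phi = e / 2 * (L2sq phi / (L2sq phi + 1)).
  by rewrite /c; field; rewrite !gt_eqF//; lra.
have : L2sq phi / (L2sq phi + 1) <= 1 by rewrite ler_pdivrMr; lra.
have : 0 <= e / 2 by rewrite divr_ge0// ltW.
move=> e2 h; have := ler_wpM2l e2 h; lra.
Qed.

Lemma CL2D T u1 u2 : CL2 T u1 -> CL2 T u2 -> CL2 T (fun t x => u1 t x + u2 t x).
Proof.
move=> /CL2P[L1 c1] /CL2P[L2' c2]; apply/CL2P; split=> [t tT|t tT e e0].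
  by apply: L2D; [exact: L1|exact: L2'].
have e4 : 0 < e / 4 by rewrite divr_gt0.
have [d d0 hd] := c1 t tT _ e4; have [d' d'0 hd'] := c2 t tT _ e4.
exists (Num.min d d'); first by rewrite lt_min d0.
move=> s sT; rewrite lt_min => /andP[sd sd'].
have a1 := L2B (L1 s sT) (L1 t tT); have a2 := L2B (L2' s sT) (L2' t tT).
have a0 := L2_cst (0 : R).
have := L2sqB_triangle a1 a0 (L2Z (-1) a2).
have -> : L2sq (fun x => u1 s x - u1 t x - -1 * (u2 s x - u2 t x)) =
   L2sq (fun x => u1 s x + u2 s x - (u1 t x + u2 t x)).
  by congr L2sq; apply/funext => x; ring.
have -> : L2sq (fun x => u1 s x - u1 t x - 0) = L2sq (fun x => u1 s x - u1 t x).
  by congr L2sq; apply/funext => x; ring.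
have -> : L2sq (fun x => 0 - -1 * (u2 s x - u2 t x)) = L2sq (fun x => u2 s x - u2 t x).
  by congr L2sq; apply/funext => x; ring.
move=> /le_trans; apply; have := hd s sT sd; have := hd' s sT sd'; lra.
Qed.

Lemma CL2_separated T (f g : R -> R) : {within `[0, T], continuous f} -> L2 g ->
  CL2 T (fun t x => g x * f t).
Proof.
move=> /within_continuous_itvP cf Lg; apply/CL2P; split=> [t tT|t tT e e0].
  have := L2Z (f t) Lg; congr L2; apply/funext => x; exact: mulrC.
have g0 := L2sq_ge0 g.
(* The cap at 1 allows bounding the square of the increment of f by the increment itself. *)
pose e' := Num.min 1 (e / (L2sq g + 1)).
have e'0 : 0 < e' by rewrite lt_min ltr01 divr_gt0//; lra.
have [d d0 hd] := cf t tT e' e'0.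
exists d => // s sT sd; have h := hd s sT sd.
have -> : L2sq (fun x => g x * f s - g x * f t) = (f s - f t) ^+ 2 * L2sq g.
  rewrite /L2sq -RintegralZl//; last exact: L2_sqr_integrable.
  by apply: eq_Rintegral => x _; rewrite -mulrBr exprMn mulrC.
have h1 : `|f s - f t| <= 1 by apply: le_trans h _; rewrite ge_min lexx.
have h2 : `|f s - f t| <= e / (L2sq g + 1) by apply: le_trans h _; rewrite ge_min lexx orbT.
have h3 : (f s - f t) ^+ 2 <= e / (L2sq g + 1).
  rewrite -real_normK ?num_real// expr2; apply: le_trans (ler_wpM2l _ h1) _ => //.
  by rewrite mulr1.
apply: le_trans (ler_wpM2r g0 h3) _.
rewrite mulrAC ler_pdivrMr; last by lra.
by rewrite ler_wpM2l ?ltW//; lra.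
Qed.

End CL2.

Section existence.
Context {R : realType}.
Notation mu := (leb R).
Variables (N f : R -> R) (T C : R) (Y : nat -> R -> R).
Local Notation I := (`]0%R, pi[%classic : set (measurableTypeR R)).
Local Notation D := (`]0%R, T[%classic : set (measurableTypeR R)).
Hypothesis iN : mu.-integrable `]0, T[ (EFin \o N).
Hypothesis T0 : 0 < T.
Hypothesis cY : forall n, causal (Y n).
Hypothesis YE : forall n t, Y n t = f t - n.+1%:R ^+ 2 * convol D N (primitive (Y n)) t.
Hypothesis YC : forall n t, 0 <= t <= T -> `|Y n t| <= C.
Hypothesis fC : forall t, 0 <= t <= T -> `|f t| <= C.

Let mI : measurable I. Proof. exact: measurable_itv. Qed.
Let pi_gt0 : 0 < pi :> R. Proof. exact: pi_gt0. Qed.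
Let pi2 : 2 <= pi :> R. Proof. exact: pi_ge2. Qed.
Let pi4 : pi <= 4 :> R. Proof. by have := pihalf_lt2 R; lra. Qed.

(** The sine coefficients of the lift (pi - x) / pi. *)
Definition gam (i : nat) : R := 2 / (pi * i.+1%:R).
Definition mode_coef t i : R := - (gam i * Y i t).
(* The lacunary cut-offs [8 ^ k] provide the geometric rate required by [riesz_fischer]. *)
Definition partial_sol k t x : R := \sum_(i < (8 ^ k)%N) mode_coef t i * sine i x.
Definition lift_data (x : R) : R := (pi - x) / pi.

Let C0 : 0 <= C.
Proof. by apply: le_trans (normr_ge0 (f 0)) (fC _); rewrite lexx ltW. Qed.

Let e8 k : (0 < 8 ^ k)%N. Proof. by rewrite expn_gt0. Qed.

Let gam_gt0 i : 0 < gam i.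
Proof. by rewrite divr_gt0// mulr_gt0// ltr0n. Qed.

Let gam_le i : gam i <= i.+1%:R^-1.
Proof.
by rewrite /gam invfM mulrA ler_piMl ?invr_ge0 ?ler0n// ler_pdivrMr// mul1r.
Qed.

Let div8 k (c : R) : 0 <= c -> c / (8 ^ k)%:R <= c / 2 ^+ k.
Proof.
move=> c0; rewrite ler_wpM2l// lef_pV2 ?posrE ?ltr0n ?exprn_gt0//.
by rewrite natrX lerXn2r ?nnegrE//; lra.
Qed.

Lemma L2_partial_sol k t : L2 (partial_sol k t).
Proof.
apply: (@L2_sum _ (fun i x => mode_coef t i * sine i x)) => i.
by apply: L2Z; exact: L2_sine.
Qed.

(** The squared coefficients are O(1 / n^2) uniformly in t, so the blocks between 8^k and 8^{k+1}
    have squared norm O(8^{-k}). *)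
Lemma exists_solution_limit : exists eta : R -> R -> R, forall t, 0 <= t <= T ->
  L2 (eta t) /\ forall k, L2sq (fun x => eta t x - partial_sol k t x) <= 8 * C ^+ 2 / 4 ^+ k.
Proof.
suff /choice[eta h] : forall t, exists u, 0 <= t <= T ->
    L2 u /\ forall k, L2sq (fun x => u x - partial_sol k t x) <= 8 * C ^+ 2 / 4 ^+ k.
  by exists eta.
move=> t; have [tT|//] := boolP (0 <= t <= T); last by exists (cst 0).
have [|k|v h1 h2] := @riesz_fischer _ (fun k => partial_sol k t) (C ^+ 2).
- by move=> k; exact: L2_partial_sol.
- rewrite L2sq_sine_diff ?leq_exp2l//.
  have h i : `|mode_coef t i ^+ 2| <= C ^+ 2 * (4 / pi ^+ 2) / i.+1%:R ^+ 2.
    rewrite /mode_coef sqrrN exprMn normrM ger0_norm ?sqr_ge0// normrX.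
    have -> : C ^+ 2 * (4 / pi ^+ 2) / i.+1%:R ^+ 2 = gam i ^+ 2 * C ^+ 2.
      have n0 : i.+1%:R != 0 :> R by rewrite pnatr_eq0.
      rewrite /gam; have := pi_gt0; move: (pi : R) (i.+1%:R) n0 => p n n0 p0.
      by field; rewrite n0 gt_eqF.
    by rewrite ler_wpM2l ?sqr_ge0// lerXn2r ?nnegrE// YC.
  have := @sum_tail_bound _ (fun i => mode_coef t i ^+ 2) _ _ (8 ^ k.+1)%N (e8 k).
  rewrite leq_exp2l// => /(_ _ (leqnSn k) h); move/(le_trans (ler_norm _)) => h'.
  apply: le_trans (ler_wpM2l _ h') _; first by rewrite divr_ge0// ltW.
  rewrite natrX mulrA ler_wpM2r ?invr_ge0 ?exprn_ge0//.
  have -> : pi / 2 * (C ^+ 2 * (4 / pi ^+ 2)) = C ^+ 2 * (2 / pi).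
    by have := pi_gt0; move: (pi : R) => p p0; field; rewrite gt_eqF.
  by rewrite ler_piMr ?sqr_ge0// ler_pdivrMr// mul1r.
by exists v.
Qed.

Variable eta : R -> R -> R.
Hypothesis eta_L2 : forall t, 0 <= t <= T -> L2 (eta t).
Hypothesis eta_lim : forall t, 0 <= t <= T ->
  forall k, L2sq (fun x => eta t x - partial_sol k t x) <= 8 * C ^+ 2 / 4 ^+ k.

Lemma CL2_eta : CL2 T eta.
Proof.
apply/CL2P; split => // t tT e e0.
have E0 : 0 <= 8 * C ^+ 2 by rewrite mulr_ge0// sqr_ge0.
(* Two uses of the triangle inequality with its factor 2 cost 2/12 + 4/12 + 4/12 of e. *)
have [k hk] := le_div_exp2 E0 (divr_gt0 e0 (ltr0n R 12)).
have hk4 : 8 * C ^+ 2 / 4 ^+ k <= e / 12.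
  apply: le_trans hk; rewrite ler_wpM2l// lef_pV2 ?posrE ?exprn_gt0//.
  by rewrite lerXn2r ?nnegrE//; lra.
have ch : continuous (fun s => pi / 2 * \sum_(i < (8 ^ k)%N) (mode_coef s i - mode_coef t i) ^+ 2).
  move=> s; apply: cvgM; first exact: cvg_cst.
  apply: (@continuous_sumn _ (fun i s => (mode_coef s i - mode_coef t i) ^+ 2)) => i {}s.
  apply: (@continuous_comp _ _ _ (fun s => mode_coef s i - mode_coef t i) (fun x => x ^+ 2));
    last exact: exprn_continuous.
  apply: cvgB; last exact: cvg_cst.
  by apply: cvgN; apply: cvgM; [exact: cvg_cst|have [+ _] := cY i; exact].
have /cvgrPdist_le/(_ _ (divr_gt0 e0 (ltr0n R 12)))/nbhs_ballP[d /= d0 hd] := ch t.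
exists d => // s sT sd.
have hst : L2sq (fun x => partial_sol k s x - partial_sol k t x) <= e / 12.
  have -> : L2sq (fun x => partial_sol k s x - partial_sol k t x) =
      pi / 2 * \sum_(i < (8 ^ k)%N) (mode_coef s i - mode_coef t i) ^+ 2.
    rewrite -(@L2sq_sine_sum _ (fun i => mode_coef s i - mode_coef t i)).
    congr L2sq; apply/funext => x.
    by rewrite /partial_sol -sumrB; apply: eq_bigr => i _; rewrite mulrBl.
  have := hd s; rewrite /ball/= distrC => /(_ sd).
  have -> : \sum_(i < (8 ^ k)%N) (mode_coef t i - mode_coef t i) ^+ 2 = 0.
    by rewrite big1// => i _; rewrite subrr expr0n.
  rewrite mulr0 sub0r normrN.
  by move/(le_trans (ler_norm _)).
have Lk := L2_partial_sol k.
apply: le_trans (L2sqB_triangle (eta_L2 sT) (Lk s) (eta_L2 tT)) _.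
have h1 := eta_lim sT k; have h2 := eta_lim tT k.
rewrite L2sq_sym in h2.
have := L2sqB_triangle (Lk s) (Lk t) (eta_L2 tT); lra.
Qed.

Lemma L2_lift : L2 lift_data.
Proof.
apply: (@L2_bounded _ _ 1).
  apply: measurable_funM => //; apply: measurable_funB => //.
move=> x /andP[x0 xpi]; have px : 0 <= pi - x by rewrite subr_ge0 ltW.
by rewrite ger0_norm ?divr_ge0 ?(ltW pi_gt0)// ler_pdivrMr// mul1r; lra.
Qed.

(** This is theta. The equation eta = A (a * eta) - lift f forces A (a * eta) = theta, so [sol] is
    the second derivative that [potential] must have. *)
Definition sol (t x : R) : R := eta t x + lift_data x * f t.

Lemma L2_sol t : 0 <= t <= T -> L2 (sol t).
Proof.
move=> tT; apply: L2D; first exact: eta_L2.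
by have := L2Z (f t) L2_lift; congr L2; apply/funext => x; exact: mulrC.
Qed.

(** The sine coefficients of theta are gam (f - Y). Dividing by - n^2 gives those of a * eta, and
    one factor n restores the cosine coefficients of its x-derivative, which are O(1 / n^2). *)
Definition slope_coef t i : R := gam i / i.+1%:R * (Y i t - f t).
Definition partial_slope k t x : R := \sum_(i < (8 ^ k)%N) slope_coef t i * cos (i.+1%:R * x).
Definition partial_primitive k t x : R :=
  \sum_(i < (8 ^ k)%N) slope_coef t i / i.+1%:R * sine i x.

(** The slope at 0 is the sum of the cosine series there; this choice makes the double primitive
    vanish at pi. *)
Lemma exists_slope0 : exists c : R -> R, forall t, 0 <= t <= T ->
  forall k, `|c t - \sum_(i < (8 ^ k)%N) slope_coef t i| <= 4 * C / 2 ^+ k.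
Proof.
suff /choice[c h] : forall t, exists c, 0 <= t <= T ->
    forall k, `|c - \sum_(i < (8 ^ k)%N) slope_coef t i| <= 4 * C / 2 ^+ k.
  by exists c.
move=> t; have [tT|//] := boolP (0 <= t <= T); last by exists 0.
have h i : `|slope_coef t i| <= 2 * C / i.+1%:R ^+ 2.
  rewrite /slope_coef normrM ger0_norm; last by rewrite divr_ge0// ltW.
  rewrite mulrC expr2 invfM [X in _ <= X]mulrA; apply: le_trans (_ : 2 * C * (gam i / i.+1%:R) <= _).
    rewrite ler_wpM2r//; first by rewrite divr_ge0// ltW.
    apply: le_trans (ler_normB _ _) _; have := YC i tT; have := fC tT; lra.
  have -> : 2 * C / i.+1%:R / i.+1%:R = 2 * C * (i.+1%:R^-1 / i.+1%:R) by rewrite -!mulrA.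
  apply: ler_wpM2l; first by rewrite mulr_ge0.
  by apply: ler_wpM2r; [rewrite invr_ge0|exact: gam_le].
have [|l _ hl] := @geometric_cvg R (fun k => \sum_(i < (8 ^ k)%N) slope_coef t i) (2 * C).
  move=> k; have := @sum_tail_bound _ (slope_coef t) _ _ (8 ^ k.+1)%N (e8 k).
  rewrite leq_exp2l// => /(_ _ (leqnSn k) h) /le_trans; apply.
  by apply: div8; rewrite mulr_ge0.
by exists l => _ k; apply: le_trans (hl k) _; rewrite mulrA -natrM.
Qed.

Variable slope0 : R -> R.
Hypothesis slope0_lim : forall t, 0 <= t <= T ->
  forall k, `|slope0 t - \sum_(i < (8 ^ k)%N) slope_coef t i| <= 4 * C / 2 ^+ k.

(** As iterated primitives of [sol], [slope] and [potential] satisfy [domA_with_value] by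
    construction, except for the value at pi. *)
Definition slope (t x : R) : R := slope0 t + \int[mu]_(y in `]0, x[) sol t y.
Definition potential (t x : R) : R := \int[mu]_(y in `]0, x[) slope t y.

Lemma Rintegral_sine i x : 0 <= x ->
  \int[mu]_(y in `]0, x[) sine i y = (1 - cos (i.+1%:R * x)) / i.+1%:R.
Proof.
move=> x0; have n0 : i.+1%:R != 0 :> R by rewrite pnatr_eq0.
transitivity (- i.+1%:R^-1 * cos (i.+1%:R * x) - - i.+1%:R^-1 * cos (i.+1%:R * 0)).
  apply: (@FTC2_itv _ 0 x (fun x => - i.+1%:R^-1 * cos (i.+1%:R * x)) (sine i) x0).
  - apply: continuous_subspaceT => y; have d := is_derive_cos_mul i.+1%:R y.
    apply: cvgM; first exact: cvg_cst.
    by apply: differentiable_continuous; apply/derivable1_diffP; exact: ex_derive.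
  - by apply: continuous_subspaceT; exact: continuous_sine.
  - move=> y _; have := is_deriveZ (- i.+1%:R^-1) (is_derive_cos_mul i.+1%:R y).
    by congr is_derive; rewrite /GRing.scale /= mulrNN mulKf.
by rewrite mulr0 cos0; field; rewrite ?n0.
Qed.

Lemma Rintegral_lift x : 0 <= x ->
  \int[mu]_(y in `]0, x[) lift_data y = 2 / pi * (pi * x / 2 - x ^+ 2 / 4).
Proof.
move=> x0; transitivity ((- (2 * pi)^-1 * x ^+ 2 + 1 * x + 0) - (- (2 * pi)^-1 * 0 ^+ 2 + 1 * 0 + 0)).
  apply: (@FTC2_itv _ 0 x (fun x => - (2 * pi)^-1 * x ^+ 2 + 1 * x + 0) lift_data x0).
  - apply: continuous_subspaceT => y; have d := is_derive_affine_sqr (- (2 * pi)^-1) 1 0 y.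
    by apply: differentiable_continuous; apply/derivable1_diffP; exact: ex_derive.
  - apply: continuous_subspaceT => y; apply: cvgM; last exact: cvg_cst.
    by apply: cvgB; [exact: cvg_cst|exact: cvg_id].
  - move=> y _; have := is_derive_affine_sqr (- (2 * pi)^-1) 1 0 y.
    congr is_derive; rewrite /lift_data; have := pi_gt0; move: (pi : R) => p p0;
    by field; rewrite gt_eqF.
have := pi_gt0; move: (pi : R) => p p0;
by field; rewrite gt_eqF.
Qed.

(** The lift does not vanish at 0, so its sine series converges slowly. Integrated once it is 2 / pi
    times [versum], for which [versum_quadratic] has a uniform rate. *)
Lemma partial_slope_eq k t x : 0 <= x ->
  partial_slope k t x = \sum_(i < (8 ^ k)%N) slope_coef t i +
    \int[mu]_(y in `]0, x[) partial_sol k t y + f t * (2 / pi * versum (8 ^ k)%N x).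
Proof.
move=> x0.
have is1 i : mu.-integrable `]0, x[ (EFin \o sine i).
  by apply: continuous_integrable_itv; apply: continuous_subspaceT; exact: continuous_sine.
have -> : \int[mu]_(y in `]0, x[) partial_sol k t y =
    \sum_(i < (8 ^ k)%N) mode_coef t i * ((1 - cos (i.+1%:R * x)) / i.+1%:R).
  rewrite (proj2 (@Rintegral_sum _ `]0, x[ _ _ _ (fun i : 'I_(8 ^ k) => fun y => mode_coef t i * sine i y) _ _)).
  - by apply: eq_bigr => i _; rewrite RintegralZl// Rintegral_sine.
  - exact: measurable_itv.
  - by move=> i; exact: integrable_scale.
rewrite /partial_slope /versum !mulr_sumr -!big_split; apply: eq_bigr => i _ /=.
rewrite /mode_coef /slope_coef /gam; have n0 : i.+1%:R != 0 :> R by rewrite pnatr_eq0.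
have := pi_gt0; move: (pi : R) (i.+1%:R) n0 (cos _) => p n n0 c p0.
by field; rewrite n0 gt_eqF.
Qed.

(** The errors of [slope_bound] added up: 4 C from the slope at 0, 8 C^2 + 4 from the integral of
    eta, 2 C from the lift. *)
Let X : R := 8 * C ^+ 2 + 6 * C + 4.

Let X0 : 0 <= X.
Proof. by rewrite !addr_ge0// mulr_ge0// sqr_ge0. Qed.

Lemma slope_bound k t x : 0 <= t <= T -> 0 <= x <= pi ->
  `|slope t x - partial_slope k t x| <= X / 2 ^+ k.
Proof.
move=> tT /andP[x0 xpi]; rewrite partial_slope_eq// /slope.
have Lk := L2_partial_sol k t.
have sub h : L2 h -> mu.-integrable `]0, x[ (EFin \o h).
  by move=> Lh; exact: integrable_itv_sub (lexx 0) xpi (integrable_L2 Lh).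
have -> : \int[mu]_(y in `]0, x[) sol t y =
    \int[mu]_(y in `]0, x[) eta t y + f t * (2 / pi * (pi * x / 2 - x ^+ 2 / 4)).
  have sl := sub _ L2_lift.
  rewrite -Rintegral_lift// -RintegralZl//.
  rewrite -RintegralD//; [|by apply: sub; exact: eta_L2|exact: integrable_scale].
  by apply: eq_Rintegral => y _; rewrite /sol [f t * _]mulrC.
have h1 := slope0_lim tT k.
have h2 : `|f t * (2 / pi * (versum (8 ^ k)%N x - (pi * x / 2 - x ^+ 2 / 4)))| <= 2 * C / 2 ^+ k.
  have hv := @versum_quadratic R (8 ^ k)%N x (e8 k).
  have {}hv : `|versum (8 ^ k)%N x - (pi * x / 2 - x ^+ 2 / 4)| <= 2 / 2 ^+ k.
    apply: le_trans (hv _) (div8 _ _) => //; rewrite x0/=; lra.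
  have p1 : 0 <= (2 / pi : R) <= 1.
    apply/andP; split; first by rewrite divr_ge0// ltW.
    by rewrite ler_pdivrMr// mul1r.
  rewrite normrM; have -> : 2 * C / 2 ^+ k = C * (1 * (2 / 2 ^+ k)) by ring.
  apply: ler_pM => //; first exact: fC.
  rewrite normrM; apply: ler_pM => //.
  by case/andP: p1 => ? ?; rewrite ger0_norm.
have h3 : `|\int[mu]_(y in `]0, x[) eta t y - \int[mu]_(y in `]0, x[) partial_sol k t y| <=
    (8 * C ^+ 2 + 4) / 2 ^+ k.
  rewrite -RintegralB//; [|by apply: sub; exact: eta_L2|exact: sub].
  (* Integration up to x is a pairing with an indicator, so [L2inner_young] with parameter 2^k turns
     the squared L^2 error O(4^{-k}) into an error O(2^{-k}) uniform in x. *)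
  have L1 : L2 (\1_`]0%R, x[%classic : R -> R).
    apply: (@L2_bounded _ _ 1); first exact: measurable_indic.
    by move=> y _; rewrite indicE; case: (_ \in _); rewrite ?normr1 ?normr0.
  have -> : \int[mu]_(y in `]0, x[) (eta t y - partial_sol k t y) =
      L2inner (fun y => eta t y - partial_sol k t y) (\1_`]0%R, x[%classic).
    rewrite /L2inner Rintegral_indic; congr Rintegral.
    apply/seteqP; split => y /=; rewrite !in_itv/=; last by case.
    by move=> /andP[y0 yx]; split; rewrite y0// (lt_le_trans yx).
  have p2 : 0 < 2 ^+ k :> R by rewrite exprn_gt0.
  apply: le_trans (L2inner_young p2 (L2B (eta_L2 tT) Lk) L1) _.
  have l1 : L2sq (\1_`]0%R, x[%classic : R -> R) <= 4.
    apply: le_trans (_ : \int[mu]_(y in `]0, pi[) 1 <= _).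
      apply: le_Rintegral => //.
      - exact: L2_sqr_integrable.
      - exact: (integrable_cst_itv 0 pi 1).
    by rewrite Rintegral_cst_itv ?(ltW pi_gt0)// subr0 mul1r.
  have := ler_wpM2l (ltW p2) (eta_lim tT k).
  have -> : 2 ^+ k * (8 * C ^+ 2 / 4 ^+ k) = 8 * C ^+ 2 / 2 ^+ k.
    have -> : 4 ^+ k = 2 ^+ k * 2 ^+ k :> R by rewrite -exprMn -natrM.
    by field; rewrite gt_eqF.
  have : (2 ^+ k)^-1 * L2sq (\1_`]0%R, x[%classic : R -> R) <= 4 / 2 ^+ k.
    by rewrite mulrC; apply: ler_wpM2r l1; rewrite invr_ge0; exact: ltW.
  rewrite mulrDl; lra.
set a := \int[mu]_(y in `]0, x[) eta t y in h3 *.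
set b := \int[mu]_(y in `]0, x[) partial_sol k t y in h3 *.
move: a b h3 => a b h3.
have -> : slope0 t + (a + f t * (2 / pi * (pi * x / 2 - x ^+ 2 / 4))) -
    (\sum_(i < (8 ^ k)%N) slope_coef t i + b + f t * (2 / pi * versum (8 ^ k)%N x)) =
  (slope0 t - \sum_(i < (8 ^ k)%N) slope_coef t i) + (a - b) -
   f t * (2 / pi * (versum (8 ^ k)%N x - (pi * x / 2 - x ^+ 2 / 4))) by ring.
apply: le_trans (ler_normB _ _) _.
apply: le_trans (lerD (ler_normD _ _) (lexx _)) _.
have -> : X / 2 ^+ k = 4 * C / 2 ^+ k + (8 * C ^+ 2 + 4) / 2 ^+ k + 2 * C / 2 ^+ k.
  by rewrite /X -!mulrDl; congr (_ / _); ring.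
by apply: lerD => //; exact: lerD.
Qed.

Lemma Rintegral_cos i x : 0 <= x ->
  \int[mu]_(y in `]0, x[) cos (i.+1%:R * y) = sine i x / i.+1%:R.
Proof.
move=> x0; have n0 : i.+1%:R != 0 :> R by rewrite pnatr_eq0.
transitivity (i.+1%:R^-1 * sine i x - i.+1%:R^-1 * sine i 0); last first.
  by rewrite /sine mulr0 sin0 mulr0 subr0 mulrC.
apply: (@FTC2_itv _ 0 x (fun x => i.+1%:R^-1 * sine i x) (fun x => cos (i.+1%:R * x)) x0).
- apply: continuous_subspaceT => y; apply: cvgM; first exact: cvg_cst.
  exact: continuous_sine.
- apply: continuous_subspaceT => y; have d := is_derive_cos_mul i.+1%:R y.
  by apply: differentiable_continuous; apply/derivable1_diffP; exact: ex_derive.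
- move=> y _; have := is_deriveZ (i.+1%:R^-1) (is_derive_sin_mul i.+1%:R y).
  by congr is_derive; rewrite /GRing.scale /= mulKf.
Qed.

Lemma continuous_slope t : 0 <= t <= T -> {within `[0, pi], continuous (slope t)}.
Proof.
move=> tT; apply/within_continuous_itvP => x xp e e0.
have /within_continuous_itvP/(_ x xp e e0)[d d0 hd] :=
  continuous_primitive (ltW pi_gt0) (integrable_L2 (L2_sol tT)).
by exists d => // y yp /(hd y yp); rewrite /slope opprD addrACA subrr add0r.
Qed.

Lemma potential_bound k t x : 0 <= t <= T -> 0 <= x <= pi ->
  `|potential t x - partial_primitive k t x| <= 4 * X / 2 ^+ k.
Proof.
move=> tT xp; have /andP[x0 xpi] := xp.
have ic i : mu.-integrable `]0, x[ (EFin \o (fun y => cos (i.+1%:R * y))).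
  exact: integrable_itv_sub (lexx 0) xpi (integrable_cos_mul _).
have [ips Eps] := @Rintegral_sum R `]0, x[ _ (index_enum 'I_(8 ^ k)%N) xpredT
  (fun i y => slope_coef t i * cos (i.+1%:R * y)) (measurable_itv _)
  (fun i => integrable_scale (slope_coef t i) (measurable_itv _) (ic i)).
have isl : mu.-integrable `]0, x[ (EFin \o slope t).
  apply: (integrable_itv_sub (lexx 0) xpi).
  by apply: continuous_integrable_itv; exact: continuous_slope.
have -> : partial_primitive k t x = \int[mu]_(y in `]0, x[) partial_slope k t y.
  rewrite [RHS]Eps; apply: eq_bigr => i _.
  by rewrite RintegralZl// Rintegral_cos// mulrAC mulrA.
rewrite /potential -RintegralB//.
have X2 : 0 <= X / 2 ^+ k by rewrite divr_ge0.
have h : `|\int[mu]_(y in `]0, x[) (slope t y - partial_slope k t y)| <= X / 2 ^+ k * (x - 0).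
  apply: le_norm_Rintegral_itv => //.
    by apply: measurable_funB; exact: integrable_fun.
  move=> y /andP[y0 yx]; apply: slope_bound => //.
  by rewrite (ltW y0)/= (le_trans (ltW yx)).
apply: (le_trans h); rewrite subr0 mulrC -mulrA ler_wpM2r//.
exact: le_trans pi4.
Qed.

Lemma potential0 t : potential t 0 = 0.
Proof. by rewrite /potential set_itvoo0 Rintegral_set0. Qed.

(** The approximating sums consist of sines, which vanish at pi. *)
Lemma potential_pi t : 0 <= t <= T -> potential t pi = 0.
Proof.
move=> tT; apply: (@eq0_geometric _ _ (4 * X)) => k.
have := @potential_bound k t pi tT; rewrite (ltW pi_gt0) lexx => /(_ isT).
have -> : partial_primitive k t pi = 0; last by rewrite subr0.
by rewrite /partial_primitive big1// => i _; rewrite /sine sin_nat_pi mulr0.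
Qed.

Lemma L2_potential t : 0 <= t <= T -> L2 (potential t).
Proof.
move=> tT; have isl := continuous_integrable_itv (continuous_slope tT).
have [B _ HB] := continuous_bounded_itv (continuous_primitive (ltW pi_gt0) isl).
apply: (@L2_bounded _ _ B); first exact: measurable_primitive.
by move=> x /andP[x0 xpi]; apply: HB; rewrite !ltW.
Qed.

Lemma domA_potential t : 0 <= t <= T -> domA_with_value (potential t) (sol t).
Proof.
move=> tT; split; first exact: L2_sol.
exists (potential t), (slope t); split.
- by apply: aeW => x _.
- by move=> x _; rewrite potential0 add0r.
- by move=> x _; rewrite {2}/slope set_itvoo0 Rintegral_set0 addr0.
- exact: potential0.
- exact: potential_pi.
Qed.

Lemma L2_partial_primitive k t : L2 (partial_primitive k t).
Proof.
apply: (@L2_sum _ (fun i x => slope_coef t i / i.+1%:R * sine i x)) => i.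
by apply: L2Z; exact: L2_sine.
Qed.

(** Young's inequality with parameter 2^k again; 64 is 4^2 from [potential_bound] times 4 >= pi. *)
Lemma L2inner_potential k t phi : 0 <= t <= T -> L2 phi ->
  `|L2inner (potential t) phi - L2inner (partial_primitive k t) phi| <=
  (64 * X ^+ 2 + L2sq phi) / 2 ^+ k.
Proof.
move=> tT Lp; have Lw := L2_potential tT; have Lk := L2_partial_primitive k t.
rewrite -L2innerBl//; have p2 : 0 < 2 ^+ k :> R by rewrite exprn_gt0.
apply: le_trans (L2inner_young p2 (L2B Lw Lk) Lp) _.
rewrite [X in _ <= X]mulrDl [_^-1 * _]mulrC lerD2r.
have h : L2sq (fun x => potential t x - partial_primitive k t x) <=
    (4 * X / 2 ^+ k) ^+ 2 * (pi - 0).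
  apply: le_trans (ler_norm _) _; apply: le_norm_Rintegral_itv.
  - exact: ltW.
  - by apply: measurable_funX; apply: L2_measurable; exact: L2B.
  - move=> x /andP[x0 xpi]; rewrite normrX lerXn2r ?nnegrE//; last first.
      by apply: potential_bound; rewrite // !ltW.
    by rewrite divr_ge0 ?mulr_ge0// ltW.
apply: le_trans (ler_wpM2l (ltW p2) h) _.
have -> : 64 * X ^+ 2 / 2 ^+ k = 2 ^+ k * ((4 * X / 2 ^+ k) ^+ 2 * 4).
  by move: X (2 ^+ k) p2 => x q q0; field; rewrite gt_eqF.
apply: ler_wpM2l; first exact: ltW.
by apply: ler_wpM2l; rewrite ?sqr_ge0// subr0.
Qed.

(** A bounded continuous function on the line agreeing with [relax_a] on [0, T], which makes the
    products under Volterra integrals integrable. *)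
Lemma relax_a_extension : exists (a : R -> R) (B : R),
  [/\ continuous a, forall r, `|a r| <= B & forall r, 0 <= r <= T -> relax_a N r = a r].
Proof.
have c := continuous_primitive (ltW T0) iN.
have [B _ HB] := continuous_bounded_itv c.
exists (fun r => relax_a N (clamp T r)), B; split.
- exact: (continuous_clamp (ltW T0) c).
- by move=> r; apply: HB; exact: clamp_itv (ltW T0).
- by move=> r /clamp_id ->.
Qed.

Lemma relax_a_mode i t : 0 <= t <= T ->
  \int[mu]_(s in `]0, t[) (relax_a N (t - s) * Y i s) = convol D N (primitive (Y i)) t.
Proof.
move=> /andP[]; rewrite le_eqVlt => /predU1P[<- _|t0 tT].
  rewrite set_itvoo0 Rintegral_set0.
  by have [_ ->//] := causal_conv iN (causal_primitive (cY i)).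
by rewrite (relax_a_convol iN (cY i))// t0.
Qed.

(** Mode by mode this is the scalar equation: n^2 (a * Y) = f - Y, so convolving - gam Y with a
    gives gam (Y - f) / n^2. *)
Lemma L2inner_partial_primitive k t phi : 0 <= t <= T -> L2 phi ->
  L2inner (partial_primitive k t) phi =
  \int[mu]_(s in `]0, t[) (relax_a N (t - s) * L2inner (partial_sol k s) phi).
Proof.
move=> tT Lp; have /andP[t0 tT'] := tT.
have [a [B [ca aB aE]]] := relax_a_extension.
have iY i : mu.-integrable `]0, t[ (EFin \o (fun s => relax_a N (t - s) * Y i s)).
  have h : mu.-integrable `]0, t[ (EFin \o (fun s => a (t - s) * Y i s)).
    apply: continuous_integrable_itv; apply: continuous_subspaceT => s.
    apply: cvgM; last by have [+ _] := cY i; exact.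
    apply: (@continuous_comp _ _ _ (fun s => t - s) a); last exact: ca.
    by apply: cvgB; [exact: cvg_cst|exact: cvg_id].
  apply: eq_integrable h => // s; rewrite inE/= in_itv/= => /andP[s0 st].
  by rewrite /= aE// subr_ge0 (ltW st)/= lerBlDr (le_trans tT')// lerDl ltW.
transitivity (\int[mu]_(s in `]0, t[) \sum_(i < (8 ^ k)%N)
    (- (gam i * L2inner (sine i) phi) * (relax_a N (t - s) * Y i s))).
  rewrite (proj2 (@Rintegral_sum R `]0, t[ _ _ _
    (fun (i : 'I_(8 ^ k)%N) s => - (gam i * L2inner (sine i) phi) * (relax_a N (t - s) * Y i s)) _ _)).
  - rewrite (@L2inner_sum R (fun i x => slope_coef t i / i.+1%:R * sine i x))//; last first.
      by move=> i; apply: L2Z; exact: L2_sine.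
    apply: eq_bigr => i _; rewrite L2innerZl//; last exact: L2_sine.
    rewrite RintegralZl// relax_a_mode// /slope_coef.
    have -> : Y i t - f t = - (i.+1%:R ^+ 2 * convol D N (primitive (Y i)) t).
      by rewrite {1}YE addrC addKr.
    have n0 : i.+1%:R != 0 :> R by rewrite pnatr_eq0.
    by move: (i.+1%:R) n0 (convol _ _ _ _) (L2inner _ _) (gam i) => n n0 c l g; field.
  - exact: measurable_itv.
  - by move=> i; exact: integrable_scale.
apply: eq_Rintegral => s _.
rewrite (@L2inner_sum R (fun i x => mode_coef s i * sine i x))//; last first.
  by move=> i; apply: L2Z; exact: L2_sine.
rewrite mulr_sumr; apply: eq_bigr => i _; rewrite L2innerZl//; last exact: L2_sine.
by rewrite /mode_coef; ring.
Qed.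

Lemma L2inner_eta_bound k t phi : 0 <= t <= T -> L2 phi ->
  `|L2inner (eta t) phi - L2inner (partial_sol k t) phi| <=
  (8 * C ^+ 2 + L2sq phi) / 2 ^+ k.
Proof.
move=> tT Lp; have Lk := L2_partial_sol k t; have Le := eta_L2 tT.
rewrite -L2innerBl//; have p2 : 0 < 2 ^+ k :> R by rewrite exprn_gt0.
apply: le_trans (L2inner_young p2 (L2B Le Lk) Lp) _.
rewrite [X in _ <= X]mulrDl [_^-1 * _]mulrC lerD2r.
apply: le_trans (ler_wpM2l (ltW p2) (eta_lim tT k)) _.
have -> : 4 ^+ k = 2 ^+ k * 2 ^+ k :> R by rewrite -exprMn -natrM.
rewrite le_eqVlt; apply/orP; left; apply/eqP.
by move: (2 ^+ k) p2 => q q0; field; rewrite gt_eqF.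
Qed.

Lemma is_conv_integral_potential : is_conv_integral T (relax_a N) eta potential.
Proof.
move=> t; rewrite mem_itvcc => tT; split; first exact: L2_potential.
move=> phi Lp; apply/eqP; rewrite -subr_eq0; apply/eqP; have /andP[t0 tT'] := tT.
have [a [B [ca aB aE]]] := relax_a_extension.
have B0 : 0 <= B := le_trans (normr_ge0 _) (aB 0).
have car : continuous (fun s => a (t - s)).
  move=> s; apply: (@continuous_comp _ _ _ (fun s => t - s) a); last exact: ca.
  by apply: cvgB; [exact: cvg_cst|exact: cvg_id].
have aEr s : 0 < s < t -> relax_a N (t - s) = a (t - s).
  move=> /andP[s0 st].
  by rewrite aE// subr_ge0 (ltW st)/= lerBlDr (le_trans tT')// lerDl ltW.
(* The identity is exact for the partial sums. The first summand is the error of the left side, the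
   second that of the right side integrated against a. *)
pose Z := (64 * X ^+ 2 + L2sq phi) + B * (8 * C ^+ 2 + L2sq phi) * T.
apply: (@eq0_geometric _ _ Z) => k.
have ih : mu.-integrable `]0, t[ (EFin \o (fun s => L2inner (eta s) phi)).
  apply: (integrable_itv_sub (lexx 0) tT'); apply: continuous_integrable_itv.
  exact: CL2_inner_continuous CL2_eta Lp.
have ib : mu.-integrable `]0, t[ (EFin \o (fun s => L2inner (partial_sol k s) phi)).
  apply: continuous_integrable_itv; apply: continuous_subspaceT.
  under eq_fun => s do rewrite (@L2inner_sum R (fun i x => mode_coef s i * sine i x)
     (8 ^ k)%N phi (fun i => L2Z (mode_coef s i) (L2_sine i)) Lp).
  apply: (@continuous_sumn _ (fun i s => L2inner (fun x => mode_coef s i * sine i x) phi)) => i.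
  under eq_fun => s do rewrite (L2innerZl (mode_coef s i) (L2_sine i) Lp).
  move=> s; apply: cvgM; last exact: cvg_cst.
  by apply: cvgN; apply: cvgM; [exact: cvg_cst|have [+ _] := cY i; exact].
have aprod h : mu.-integrable `]0, t[ (EFin \o h) ->
    mu.-integrable `]0, t[ (EFin \o (fun s => h s * a (t - s))).
  move=> ihh; apply: (@integrable_mul_bounded R _ _ _ B) => //.
  by apply: measurable_funTS; exact: continuous_measurable_fun.
have -> : \int[mu]_(s in `]0, t[) (relax_a N (t - s) * L2inner (eta s) phi) =
    \int[mu]_(s in `]0, t[) (L2inner (eta s) phi * a (t - s)).
  apply: eq_Rintegral => s; rewrite inE/= in_itv/= => st.
  by rewrite aEr// mulrC.
have e1 : L2inner (partial_primitive k t) phi =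
    \int[mu]_(s in `]0, t[) (L2inner (partial_sol k s) phi * a (t - s)).
  rewrite L2inner_partial_primitive//; apply: eq_Rintegral => s.
  by rewrite inE/= in_itv/= => st; rewrite aEr// mulrC.
have h1 := L2inner_potential k tT Lp.
have h2 : `|\int[mu]_(s in `]0, t[) (L2inner (eta s) phi * a (t - s)) -
    \int[mu]_(s in `]0, t[) (L2inner (partial_sol k s) phi * a (t - s))| <=
    (8 * C ^+ 2 + L2sq phi) / 2 ^+ k * B * (t - 0).
  rewrite -RintegralB//; [|exact: aprod|exact: aprod].
  apply: le_norm_Rintegral_itv => //.
    by apply: measurable_funB; apply: integrable_fun; exact: aprod.
  move=> s /andP[s0 st]; rewrite -mulrBl normrM ler_pM//.
  by apply: L2inner_eta_bound => //; rewrite (ltW s0)/= (le_trans (ltW st)).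
rewrite e1 in h1.
set J := \int[mu]_(s in _) _ in h1 h2 *.
set H := \int[mu]_(s in _) _ in h2 *.
have -> : L2inner (potential t) phi - H = (L2inner (potential t) phi - J) - (H - J) by ring.
apply: le_trans (ler_normB _ _) _.
apply: le_trans (lerD h1 h2) _.
rewrite /Z [X in _ <= X]mulrDl lerD2l subr0.
have -> : B * (8 * C ^+ 2 + L2sq phi) * T / 2 ^+ k =
   (8 * C ^+ 2 + L2sq phi) / 2 ^+ k * B * T by ring.
apply: ler_wpM2l => //; apply: mulr_ge0 => //.
by rewrite divr_ge0 ?exprn_ge0// addr_ge0 ?L2sq_ge0// mulr_ge0// sqr_ge0.
Qed.

(** Here [f0] is the given boundary datum and [f] its causal extension. The witness for A (a * eta)
    is theta itself, so the final equation holds pointwise. *)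
Lemma is_solution_sol (f0 : R -> R) : {within `[0, T], continuous f0} ->
  (forall t, 0 <= t <= T -> f0 t = f t) ->
  let theta := fun t x => eta t x + lift_data x * f0 t in
  is_solution N T f0 theta /\ CL2 T theta.
Proof.
move=> c0 f0E theta.
have ct : CL2 T theta by apply: CL2D; [exact: CL2_eta|exact: CL2_separated c0 L2_lift].
split=> //.
have E : (fun t x => theta t x - (pi - x) / pi * f0 t) = eta.
  by apply/funext => t; apply/funext => x; rewrite /theta addrK.
rewrite /is_solution E; split; first exact: CL2_eta.
exists potential, theta; split => //.
- exact: is_conv_integral_potential.
- move=> t; rewrite mem_itvcc => tT; have := domA_potential tT.
  by congr domA_with_value; apply/funext => x; rewrite /sol /theta f0E.
- move=> t _; by apply: aeW => x _.
Qed.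

End existence.

Lemma exists_solution {R : realType} (N f f0 : R -> R) (T C : R) (Y : nat -> R -> R) :
  (leb R).-integrable `]0, T[ (EFin \o N) -> 0 < T ->
  (forall n, causal (Y n)) ->
  (forall n t, Y n t = f t - n.+1%:R ^+ 2 * convol `]0, T[ N (primitive (Y n)) t) ->
  (forall n t, 0 <= t <= T -> `|Y n t| <= C) ->
  (forall t, 0 <= t <= T -> `|f t| <= C) ->
  {within `[0, T], continuous f0} -> (forall t, 0 <= t <= T -> f0 t = f t) ->
  exists theta, is_solution N T f0 theta /\ CL2 T theta.
Proof.
move=> iN T0 cY YE YC fC c0 f0E.
have [eta heta] := exists_solution_limit T0 YC fC.
have [c hc] := exists_slope0 T0 YC fC.
exists (fun t x => eta t x + lift_data x * f0 t).
have e1 t tT := (heta t tT).1; have e2 t tT := (heta t tT).2.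
by have := is_solution_sol iN T0 cY YE fC e1 e2 hc c0 f0E.
Qed.

(** * Uniqueness *)

Section completeness.
Context {R : realType}.
Notation mu := (leb R).
Local Notation I := (`]0%R, pi[%classic : set (measurableTypeR R)).
Implicit Types (g h : R -> R).

Let mI : measurable I. Proof. exact: measurable_itv. Qed.
Let pi_gt0 : 0 < pi :> R. Proof. exact: pi_gt0. Qed.

(** Lebesgue differentiation applied to the extension of h by zero: its primitive from -oo vanishes
    below b, and so does its derivative. *)
Lemma ae_eq0_primitive h (b : R) : 0 < b -> mu.-integrable `]0, b[ (EFin \o h) ->
  (forall x, 0 < x < b -> \int[mu]_(y in `]0, x[) h y = 0) ->
  {ae mu, forall x, `]0, b[%classic x -> h x = 0}.
Proof.
move=> b0 ih h0.
pose H : R -> R := h \_ (`]0%R, b[%classic : set (measurableTypeR R)).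
have iH : mu.-integrable setT (EFin \o H).
  by rewrite /H -restrict_EFin -integrable_mkcond//; exact: measurable_itv.
have lH : locally_integrable setT H.
  by apply: integrable_locally => //; exact: openT.
have iH' y : mu.-integrable `]-oo, y] (EFin \o H).
  by apply: integrableS iH.
have HE x : x < b -> \int[mu]_(t in `]-oo, x]) H t = 0.
  move=> xb; rewrite -Rintegral_itv_bndo_bndc; last by apply: integrableS iH.
  have [x0|x0] := ltP 0 x; last first.
    rewrite Rintegral_mkcond -(@Rintegral_set0 _ _ _ mu H) [RHS]Rintegral_mkcond.
    apply: eq_Rintegral => y _; rewrite !patchE in_set0 mem_setE in_itv/= /H patchE mem_setE in_itv/=.
    by case: ifP => // yx; rewrite ltNge (le_trans (ltW yx) x0).
  rewrite -[RHS](h0 x) ?x0// [LHS]Rintegral_mkcond [RHS]Rintegral_mkcond.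
  apply: eq_Rintegral => y _; rewrite /H !patchE !mem_setE !in_itv/=.
  case: (ltP y x) => yx; rewrite ?andbF// andbT (lt_trans yx xb) andbT.
  by [].
have := FTC1Ny iH' lH; apply: filterS; first exact: (ae_filter_ringOfSetsType mu).
move=> x [_ dx]; rewrite /= in_itv/= => /andP[x0 xb].
have <- : H x = h x by rewrite /H patchE mem_setE in_itv/= x0 xb.
rewrite -dx derive1E.
have -> : 0 = 'D_1 (cst 0 : R -> R) x by rewrite derive_cst.
apply: near_eq_derive.
near=> y; rewrite /= HE//; near: y; exact: lt_nbhsl.
Unshelve. all: by end_near. Qed.

(** The mean of c - D over each ]x, y[ is 0, while near x it is close to c - D x. Intervals to the
    right of x include the case x = 0. *)
Lemma primitive_affine_cst (b c : R) (D : R -> R) : {within `[0, b], continuous D} ->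
  (forall x, 0 <= x < b -> \int[mu]_(y in `]0, x[) D y = c * x) ->
  forall x, 0 <= x < b -> D x = c.
Proof.
move=> cD hD x /andP[x0 xb].
have iD := continuous_integrable_itv cD.
apply/eqP; rewrite eq_sym -subr_eq0 -normr_le0; apply/ler_addgt0Pr => e e0; rewrite add0r.
have xI : 0 <= x <= b by rewrite x0 ltW.
have /within_continuous_itvP/(_ x xI e e0)[d d0 hd] := cD.
pose y := x + Num.min d (b - x) / 2.
have m0 : 0 < Num.min d (b - x) by rewrite lt_min d0 subr_gt0.
have md : Num.min d (b - x) <= d by rewrite ge_min lexx.
have mb : Num.min d (b - x) <= b - x by rewrite ge_min lexx orbT.
have xy : x < y by rewrite /y; lra.
have yb : y < b by rewrite /y; lra.
have yd : y - x < d by rewrite /y; lra.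
have iy : mu.-integrable `]0, y[ (EFin \o D) := integrable_itv_sub (lexx 0) (ltW yb) iD.
have ixy : mu.-integrable `]x, y[ (EFin \o D) := integrable_itv_sub x0 (ltW yb) iD.
have := Rintegral_itv_split x0 xy iy.
rewrite hD ?yb ?(le_trans x0 (ltW xy))// hD ?x0// => E.
have h : `|\int[mu]_(s in `]x, y[) (c - D x - (c - D s))| <= e * (y - x).
  apply: le_norm_Rintegral_itv; first exact: ltW.
    apply: measurable_funB => //; apply: measurable_funB => //.
    exact: integrable_fun.
  move=> s /andP[xs sy].
  have -> : c - D x - (c - D s) = D s - D x by ring.
  by apply: hd; rewrite ?(le_trans x0 (ltW xs))/= ?(le_trans (ltW sy) (ltW yb))//
    gtr0_norm ?subr_gt0//; lra.
have ic k : mu.-integrable `]x, y[ (EFin \o (fun=> k : R)) := integrable_cst_itv x y k.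
have Ecd : \int[mu]_(s in `]x, y[) (c - D s) = 0.
  rewrite RintegralB// Rintegral_cst_itv ?(ltW xy)//.
  by rewrite mulrBr E [c * x + _]addrC addrK subrr.
move: h; rewrite RintegralB//; last by apply: integrable_sub => //; exact: measurable_itv.
rewrite Ecd subr0 Rintegral_cst_itv ?(ltW xy)// normrM.
have yx : 0 < y - x by rewrite subr_gt0.
by rewrite (gtr0_norm yx) ler_pM2r.
Qed.

(** Orthogonality to the Green function says, after integration by parts, that the primitive of D is
    affine, where D is the primitive of h. Hence D is constant, equal to D 0 = 0, and h vanishes
    almost everywhere. *)
Lemma sine_complete h : L2 h -> (forall n, L2inner h (sine n) = 0) -> L2eq h (cst 0).
Proof.
move=> Lh h0.
have ih := integrable_L2 Lh.
pose D x := \int[mu]_(y in `]0, x[) h y.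
have cD : {within `[0, pi], continuous D} := continuous_primitive (ltW pi_gt0) ih.
have L1 xi : L2 (\1_`]0%R, xi[%classic : R -> R).
  apply: (@L2_bounded _ _ 1); first exact: measurable_indic.
  by move=> y _; rewrite indicE; case: (_ \in _); rewrite ?normr1 ?normr0.
pose H := \int[mu]_(x in `]0, pi[) h x.
pose m := \int[mu]_(x in `]0, pi[) (h x * x).
have Lid : L2 (fun x : R => x).
  apply: (@L2_bounded _ _ pi) => // x /andP[x0 xpi].
  by rewrite gtr0_norm// ltW.
(* Writing min (x, xi) as the primitive of an indicator prepares the integration by parts that
   brings in D. *)
have mink x xi : 0 <= x -> 0 <= xi ->
    \int[mu]_(y in `]0, x[) (\1_`]0%R, xi[%classic y : R) = Num.min x xi.
  move=> x0 xi0; have [xxi|xix] := leP x xi.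
    rewrite -[RHS]mul1r -{2}[x]subr0 -Rintegral_cst_itv//.
    apply: eq_Rintegral => y; rewrite inE/= in_itv/= => /andP[y0 yx].
    by rewrite indicE mem_setE in_itv/= y0 (lt_le_trans yx).
  rewrite -[RHS]mul1r -{2}[xi]subr0 -Rintegral_cst_itv//.
  rewrite [LHS]Rintegral_mkcond [RHS]Rintegral_mkcond.
  apply: eq_Rintegral => y _; rewrite !patchE !mem_setE !in_itv/= indicE mem_setE in_itv/=.
  case: (ltP 0 y) => y0//=; case: (ltP y xi) => yxi; last by case: ifP.
  by rewrite (lt_trans yxi).
have green xi : 0 <= xi < pi ->
    \int[mu]_(x in `]0, pi[) (h x * (pi * Num.min x xi - x * xi)) = 0.
  move=> /andP[xi0 xipi].
  have Lmin : L2 (fun x => pi * Num.min x xi - x * xi).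
    apply: L2B; apply: (@L2_bounded _ _ (pi * pi)).
    - apply: measurable_funM => //; exact: measurable_minr.
    - move=> x /andP[x0 xpi]; rewrite ger0_norm; last first.
        by rewrite mulr_ge0 ?(ltW pi_gt0)// le_min (ltW x0).
      by rewrite ler_wpM2l ?(ltW pi_gt0)// ge_min (ltW xpi).
    - exact: measurable_funM.
    - move=> x /andP[x0 xpi]; rewrite ger0_norm; last by rewrite mulr_ge0// ltW.
      by apply: ler_pM => //; exact: ltW.
  (* Equal to the difference of [versum] at x + xi and x - xi, whose limit is the Green function
     with error at most 4 / 2^k. *)
  pose S k x := \sum_(i < (8 ^ k)%N) (2 * sine i xi / i.+1%:R ^+ 2) * sine i x.
  have LS k : L2 (S k).
    apply: (@L2_sum _ (fun i x => 2 * sine i xi / i.+1%:R ^+ 2 * sine i x)) => i.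
    by apply: L2Z; exact: L2_sine.
  have S0 k : L2inner (S k) h = 0.
    rewrite (@L2inner_sum R (fun i x => 2 * sine i xi / i.+1%:R ^+ 2 * sine i x))//; last first.
      by move=> i; apply: L2Z; exact: L2_sine.
    rewrite big1// => i _; rewrite L2innerZl//; last exact: L2_sine.
    have -> : L2inner (sine i) h = L2inner h (sine i).
      by apply: eq_Rintegral => x _; rewrite mulrC.
    by rewrite h0 mulr0.
  apply: (@eq0_geometric _ _ (64 + L2sq h)) => k.
  have p2 : 0 < 2 ^+ k :> R by rewrite exprn_gt0.
  have -> : \int[mu]_(x in `]0, pi[) (h x * (pi * Num.min x xi - x * xi)) =
      L2inner (fun x => pi * Num.min x xi - x * xi - S k x) h.
    rewrite L2innerBl// S0 subr0; apply: eq_Rintegral => x _; exact: mulrC.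
  apply: le_trans (L2inner_young p2 (L2B Lmin (LS k)) Lh) _.
  rewrite [X in _ <= X]mulrDl [_^-1 * _]mulrC lerD2r.
  have e8 : (0 < 8 ^ k)%N by rewrite expn_gt0.
  have hb : L2sq (fun x => pi * Num.min x xi - x * xi - S k x) <= (4 / 2 ^+ k) ^+ 2 * (pi - 0).
    apply: le_trans (ler_norm _) _; apply: le_norm_Rintegral_itv.
    - exact: ltW.
    - by apply: measurable_funX; apply: L2_measurable; exact: L2B.
    - move=> x /andP[x0 xpi]; rewrite normrX lerXn2r ?nnegrE//.
      have -> : S k x = versum (8 ^ k)%N (x + xi) - versum (8 ^ k)%N (x - xi).
        rewrite /versum -sumrB; apply: eq_bigr => i _.
        rewrite /sine mulrBr mulrDr cosB cosD.
        have n0 : i.+1%:R != 0 :> R by rewrite pnatr_eq0.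
        by move: (i.+1%:R) n0 => n n0; field.
      have b1 : `|x - xi| <= 2 * pi by rewrite ler_norml; apply/andP; split; lra.
      have b2 : `|x + xi| <= 2 * pi by rewrite ler_norml; apply/andP; split; lra.
      have := versum_abs e8 b1; have := versum_abs e8 b2.
      move: (versum _ (x + xi)) (versum _ (x - xi)) => v2 v1 v2E v1E.
      have E : pi * Num.min x xi - x * xi = (pi * `|x + xi| / 2 - (x + xi) ^+ 2 / 4) -
        (pi * `|x - xi| / 2 - (x - xi) ^+ 2 / 4).
        rewrite (ger0_norm (_ : 0 <= x + xi)) ?addr_ge0 ?(ltW x0)//.
        case: (leP x xi) => xxi.
          by rewrite ler0_norm ?subr_le0//; move: (pi : R) => p; field.
        by rewrite gtr0_norm ?subr_gt0//; move: (pi : R) => p; field.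
      rewrite E.
      have q : 2 / (8 ^ k)%:R <= 2 / 2 ^+ k :> R.
        rewrite ler_wpM2l// lef_pV2 ?posrE ?ltr0n//.
        by rewrite natrX lerXn2r ?nnegrE//; lra.
      move: v1E v2E; move: (pi * `|x + xi| / 2 - (x + xi) ^+ 2 / 4)
        (pi * `|x - xi| / 2 - (x - xi) ^+ 2 / 4) => A B v1E v2E.
      have {}v1E := le_trans v1E q; have {}v2E := le_trans v2E q.
      have -> : 4 / 2 ^+ k = 2 / 2 ^+ k + 2 / 2 ^+ k :> R by rewrite -mulrDl -natrD.
      have -> : A - B - (v2 - v1) = (v1 - B) - (v2 - A) by ring.
      by apply: le_trans (ler_normB _ _) _; apply: lerD.
  apply: le_trans (ler_wpM2l (ltW p2) hb) _.
  have -> : 64 / 2 ^+ k = 2 ^+ k * ((4 / 2 ^+ k) ^+ 2 * 4) :> R.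
    by move: (2 ^+ k : R) p2 => q q0; field; rewrite gt_eqF.
  apply: ler_wpM2l; first exact: ltW.
  apply: ler_wpM2l; rewrite ?sqr_ge0// subr0.
  by have := pihalf_lt2 R; lra.
(* By parts, the integral of D is H xi minus that of h min (x, xi), and [green] replaces the latter
   by xi m / pi. *)
have DE xi : 0 <= xi < pi -> \int[mu]_(y in `]0, xi[) D y = (H - m / pi) * xi.
  move=> xiI; have /andP[xi0 xipi] := xiI; have G0 := green xi xiI.
  have i1 : mu.-integrable I (EFin \o (fun x => h x * Num.min x xi)).
    apply: (@integrable_mul_bounded R _ _ _ pi) => //; first exact: measurable_minr.
    move=> x; rewrite /= in_itv/= => /andP[x0 xpi]; rewrite ger0_norm.
      by rewrite ge_min (ltW xpi).
    by rewrite le_min xi0 ltW.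
  have i2 : mu.-integrable I (EFin \o (fun x => h x * x)) := integrable_L2M Lh Lid.
  transitivity (H * xi - \int[mu]_(x in `]0, pi[) (h x * Num.min x xi)).
    rewrite [X in _ = _ - X](_ : _ = \int[mu]_(x in `]0, pi[) (h x *
        \int[mu]_(y in `]0, x[) (\1_`]0%R, xi[%classic y : R))); last first.
      apply: eq_Rintegral => x; rewrite inE/= in_itv/= => /andP[x0 _].
      by rewrite mink// ltW.
    rewrite Rintegral_by_parts//; last exact: integrable_L2.
    rewrite mink ?(ltW pi_gt0)// min_r ?(ltW xipi)// -/H opprB addrC subrK.
    under [RHS]eq_Rintegral do rewrite mulrC.
    rewrite Rintegral_indic; congr Rintegral.
    apply/seteqP; split => y /=; rewrite !in_itv/=; last by case.
    by move=> /andP[y0 yx]; split; rewrite y0// (lt_trans yx).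
  move: G0; have -> : \int[mu]_(x in `]0, pi[) (h x * (pi * Num.min x xi - x * xi)) =
     pi * \int[mu]_(x in `]0, pi[) (h x * Num.min x xi) - xi * m.
    rewrite /m -!RintegralZl// -RintegralB//; try exact: integrable_scale.
    by apply: eq_Rintegral => x _; ring.
  move: (\int[mu]_(x in `]0, pi[) _) => J /eqP; rewrite subr_eq0 => /eqP E.
  have -> : J = xi * m / pi by rewrite -E mulrAC mulfV ?mul1r ?gt_eqF.
  by rewrite mulrBl; congr (_ - _); rewrite [xi * m]mulrC mulrAC.
have Dc := primitive_affine_cst cD DE.
have D0 : D 0 = 0 by rewrite /D set_itvoo0 Rintegral_set0.
have c0 : H - m / pi = 0 by rewrite -(Dc 0) ?D0// lexx pi_gt0.
have := ae_eq0_primitive pi_gt0 ih; apply => x /andP[x0 xpi].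
by rewrite -/(D x) Dc ?c0// ltW.
Qed.

End completeness.

Section uniqueness.
Context {R : realType}.
Notation mu := (leb R).
Local Notation I := (`]0%R, pi[%classic : set (measurableTypeR R)).
Implicit Types (N f : R -> R) (T : R).

Let mI : measurable I. Proof. exact: measurable_itv. Qed.
Let pi_gt0 : 0 < pi :> R. Proof. exact: pi_gt0. Qed.

Lemma L2inner_ae_eq (g h phi : R -> R) : measurable_fun I g -> measurable_fun I h ->
  measurable_fun I phi -> L2eq g h -> L2inner g phi = L2inner h phi.
Proof.
move=> mg mh mp gh; rewrite /L2inner /Rintegral; congr fine.
apply: ae_eq_integral => //.
- by apply/measurable_EFinP; exact: measurable_funM.
- by apply/measurable_EFinP; exact: measurable_funM.
- move: gh; apply: filterS; first exact: (ae_filter_ringOfSetsType mu).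
  by move=> x /= ghx xI; rewrite ghx.
Qed.

(** Two integrations by parts. The boundary terms vanish because U is 0 at both ends, so U1 has mean
    zero, and because the cosine has mean zero. *)
Lemma domA_mode (w v : R -> R) n : domA_with_value w v -> L2 w ->
  L2inner v (sine n) = - (n.+1%:R ^+ 2 * L2inner w (sine n)).
Proof.
move=> [Lv [U [U1 [wU UE U1E U0 Upi]]]] Lw.
have iv := integrable_L2 Lv.
have cv : {within `[0, pi], continuous U1}.
  apply/within_continuous_itvP => x xp e e0.
  have /within_continuous_itvP/(_ x xp e e0)[d d0 hd] := continuous_primitive (ltW pi_gt0) iv.
  exists d => // y yp /(hd y yp).
  by rewrite (U1E x) ?mem_itvcc// (U1E y) ?mem_itvcc// opprD addrACA subrr add0r.
have iU1 := continuous_integrable_itv cv.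
have mU : measurable_fun I U.
  apply: (eq_measurable_fun _ _ (measurable_primitive iU1)) => x.
  rewrite inE/= in_itv/= => /andP[x0 xpi].
  by rewrite (UE x) ?mem_itvcc ?(ltW x0) ?(ltW xpi)// U0 add0r.
have is1 := integrable_L2 (L2_sine n).
have n0 : n.+1%:R != 0 :> R by rewrite pnatr_eq0.
have ic : mu.-integrable I (EFin \o (fun x => cos (n.+1%:R * x))) := integrable_cos_mul _.
have spi : sine n pi = 0 :> R by rewrite /sine sin_nat_pi.
have Ic : \int[mu]_(x in `]0, pi[) cos (n.+1%:R * x) = 0.
  by rewrite Rintegral_cos ?(ltW pi_gt0)// spi mul0r.
have IU1 : \int[mu]_(x in `]0, pi[) U1 x = 0.
  have := UE pi; rewrite mem_itvcc (ltW pi_gt0) lexx => /(_ isT).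
  by rewrite U0 Upi add0r.
have iU1c : mu.-integrable I (EFin \o (fun x => U1 x * cos (n.+1%:R * x))).
  apply: (@integrable_mul_bounded R _ _ _ 1) => //; first exact: integrable_fun.
  by move=> x _; rewrite ler_norml cos_geN1 cos_le1.
have ivs : mu.-integrable I (EFin \o (fun x => v x * sine n x)) := integrable_L2M Lv (L2_sine n).
have E1 : L2inner w (sine n) = n.+1%:R^-1 * \int[mu]_(x in `]0, pi[) (U1 x * cos (n.+1%:R * x)).
  rewrite (@L2inner_ae_eq w U)//; [|exact: L2_measurable|exact: measurable_sine].
  transitivity (\int[mu]_(x in `]0, pi[) (sine n x * \int[mu]_(y in `]0, x[) U1 y)).
    apply: eq_Rintegral => x; rewrite inE/= in_itv/= => /andP[x0 xpi].
    by rewrite (UE x) ?mem_itvcc ?(ltW x0) ?(ltW xpi)// U0 add0r mulrC.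
  rewrite Rintegral_by_parts// IU1 mulr0 sub0r.
  transitivity (- \int[mu]_(x in `]0, pi[) (n.+1%:R^-1 * U1 x - n.+1%:R^-1 * (U1 x * cos (n.+1%:R * x)))).
    congr (- _); apply: eq_Rintegral => x; rewrite inE/= in_itv/= => /andP[x0 _].
    by rewrite Rintegral_sine ?(ltW x0)//; field.
  by rewrite RintegralB ?RintegralZl ?IU1 ?mulr0 ?sub0r ?opprK//; exact: integrable_scale.
have E2 : \int[mu]_(x in `]0, pi[) (U1 x * cos (n.+1%:R * x)) = - (n.+1%:R^-1 * L2inner v (sine n)).
  transitivity (\int[mu]_(x in `]0, pi[) (U1 0 * cos (n.+1%:R * x) +
      cos (n.+1%:R * x) * \int[mu]_(y in `]0, x[) v y)).
    apply: eq_Rintegral => x; rewrite inE/= in_itv/= => /andP[x0 xpi].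
    by rewrite (U1E x) ?mem_itvcc ?(ltW x0) ?(ltW xpi)//; ring.
  have [B _ HB] := continuous_bounded_itv (continuous_primitive (ltW pi_gt0) iv).
  rewrite RintegralD//; [|exact: integrable_scale|]; last first.
    apply: (@integrable_mul_bounded R _ _ _ B) => //; first exact: measurable_primitive.
    by move=> x; rewrite /= in_itv/= => /andP[x0 xpi]; apply: HB; rewrite !ltW.
  rewrite RintegralZl// Ic mulr0 add0r Rintegral_by_parts// Ic mul0r sub0r; congr (- _).
  rewrite /L2inner -RintegralZl//; apply: eq_Rintegral => x; rewrite inE/= in_itv/= => /andP[x0 xpi].
  by rewrite Rintegral_cos ?(ltW x0)//; field.
by rewrite E1 E2; field.
Qed.

(** Pairing with a sine closes the equation: the weak form of the convolution supplies the mode of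
    w, and [domA_mode] that of v. *)
Lemma solution_mode N T f (theta : R -> R -> R) n t : is_solution N T f theta -> 0 <= t <= T ->
  let d s := L2inner (fun x => theta s x - (pi - x) / pi * f s) (sine n) in
  d t = - (n.+1%:R ^+ 2 * \int[mu]_(s in `]0, t[) (relax_a N (t - s) * d s))
    - f t * L2inner lift_data (sine n).
Proof.
move=> [/CL2P[Leta _] [w [v [hw hA /CL2P[Lv _] hE]]]] tT d.
have tT' : t \in `[0, T] by rewrite mem_itvcc.
have [Lw /(_ _ (L2_sine n)) wE] := hw t tT'.
rewrite -wE -(domA_mode n (hA t tT') Lw).
have Ll := @L2_lift R.
rewrite -L2innerZl//; last exact: L2_sine.
rewrite -L2innerBl//; [|exact: Lv|exact: L2Z|exact: L2_sine].
apply: L2inner_ae_eq.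
- by apply: L2_measurable; exact: Leta.
- by apply: L2_measurable; apply: L2B; [exact: Lv|exact: L2Z].
- exact: measurable_sine.
- have := hE t tT'; apply: filterS; first exact: (ae_filter_ringOfSetsType mu).
  by move=> x /= h xI; rewrite h// [f t * _]mulrC.
Qed.

(** Each insertion of the bound E / 2^m e^{L t} into the equation halves it. Since e is known on
    [0, T] only, the argument uses a bound B of a and no causal extension. *)
Lemma volterra_unique N T (k : R) (e : R -> R) : mu.-integrable `]0, T[ (EFin \o N) -> 0 < T ->
  0 <= k -> {within `[0, T], continuous e} ->
  (forall t, 0 <= t <= T -> e t = - (k * \int[mu]_(s in `]0, t[) (relax_a N (t - s) * e s))) ->
  forall t, 0 <= t <= T -> e t = 0.
Proof.
move=> iN T0 k0 ce eE.
have [a [B [ca aB aE]]] := relax_a_extension iN T0.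
have B0 : 0 <= B := le_trans (normr_ge0 _) (aB 0).
have [E E0 HE] := continuous_bounded_itv ce.
(* Then k B / L <= 1/2, and L > 0 even if k B = 0. *)
pose L := 2 * (k * B + 1).
have L0 : 0 < L by rewrite mulr_gt0// ltr_wpDl// mulr_ge0.
have dexp (s : R) : is_derive s 1 (fun x : R => L^-1 * expR (L * x)) (expR (L * s)).
  have h : is_derive s 1 (fun x : R => L * x) L.
    by have := is_deriveZ L (is_derive_id s 1); congr is_derive; rewrite /GRing.scale/= mulr1.
  have := is_deriveZ L^-1 (is_derive1_comp (is_derive_expR (L * s)) h).
  by congr is_derive; rewrite /GRing.scale/= mulrCA mulVf ?mulr1// gt_eqF.
have cexp : continuous (fun s : R => expR (L * s)).
  move=> s; apply: (@continuous_comp _ _ _ (fun s => L * s) expR); last exact: continuous_expR.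
  by apply: cvgM; [exact: cvg_cst|exact: cvg_id].
have iexp (t : R) : 0 <= t -> \int[mu]_(s in `]0, t[) expR (L * s) = (expR (L * t) - 1) / L.
  move=> t0; transitivity (L^-1 * expR (L * t) - L^-1 * expR (L * 0)).
    apply: (@FTC2_itv _ 0 t (fun x => L^-1 * expR (L * x))) => //.
      apply: continuous_subspaceT => s; apply: cvgM; first exact: cvg_cst.
      exact: cexp.
    exact: continuous_subspaceT.
  by rewrite mulr0 expR0 -mulrBr mulrC.
have main m : forall t, 0 <= t <= T -> `|e t| <= E / 2 ^+ m * expR (L * t).
  elim: m => [|m IH] t tT; have /andP[t0 tT'] := tT.
    apply: le_trans (HE t tT) _; rewrite expr0 divr1 ler_peMr//.
    by rewrite -expR0 ler_expR mulr_ge0// ltW.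
  have q0 : 0 <= E / 2 ^+ m by rewrite divr_ge0// exprn_ge0.
  have ie : mu.-integrable `]0, t[ (EFin \o e).
    exact: integrable_itv_sub (lexx 0) tT' (continuous_integrable_itv ce).
  have ix' : mu.-integrable `]0, t[ (EFin \o (fun s => expR (L * s))).
    by apply: continuous_integrable_itv; exact: continuous_subspaceT.
  have ix : mu.-integrable `]0, t[ (EFin \o (fun s => E / 2 ^+ m * expR (L * s))).
    by apply: integrable_scale ix'; exact: measurable_itv.
  have h1 : `|\int[mu]_(s in `]0, t[) (relax_a N (t - s) * e s)| <=
      B * \int[mu]_(s in `]0, t[) `|e s|.
    have -> : \int[mu]_(s in `]0, t[) (relax_a N (t - s) * e s) =
        \int[mu]_(s in `]0, t[) (e s * a (t - s)).
      apply: eq_Rintegral => s; rewrite inE/= in_itv/= => /andP[s0 st].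
      by rewrite aE 1?mulrC// subr_ge0 (ltW st)/= lerBlDr (le_trans tT')// lerDl ltW.
    apply: le_norm_Rintegral_mul => //.
    by apply: measurable_reflect; exact: continuous_measurable_fun.
  have h2 : \int[mu]_(s in `]0, t[) `|e s| <= E / 2 ^+ m * ((expR (L * t) - 1) / L).
    rewrite -iexp// -RintegralZl//; apply: le_Rintegral => //.
    - exact: integrable_norm ie.
    - move=> s; rewrite /= in_itv/= => /andP[s0 st]; apply: IH.
      by rewrite (ltW s0)/= (le_trans (ltW st)).
  rewrite eE// normrN normrM (ger0_norm k0).
  apply: le_trans (ler_wpM2l k0 (le_trans h1 (ler_wpM2l B0 h2))) _.
  move: (expR _) (expR_ge0 (L * t)) q0 => x x0 q0.
  have -> : k * (B * (E / 2 ^+ m * ((x - 1) / L))) = E / 2 ^+ m * (k * B / L * (x - 1)) by ring.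
  have -> : E / 2 ^+ m.+1 * x = E / 2 ^+ m * (2^-1 * x).
    by rewrite exprS invfM; ring.
  apply: ler_wpM2l => //.
  have kB : 0 <= k * B by rewrite mulr_ge0.
  have : k * B / L <= 2^-1 by rewrite ler_pdivrMr// /L; lra.
  have : 0 <= k * B / L by rewrite divr_ge0// ltW.
  move: (k * B / L) => c c0 c1; have := ler_wpM2r x0 c1; nra.
move=> t tT; apply: (@eq0_geometric _ _ (E * expR (L * t))) => m.
by rewrite mulrAC; exact: main.
Qed.

(** The lift terms cancel in the difference, so its modes solve homogeneous Volterra equations and
    completeness concludes. *)
Lemma solution_unique N T f (theta1 theta2 : R -> R -> R) : mu.-integrable `]0, T[ (EFin \o N) -> 0 < T ->
  is_solution N T f theta1 -> is_solution N T f theta2 ->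
  forall t, 0 <= t <= T -> L2eq (theta1 t) (theta2 t).
Proof.
move=> iN T0 s1 s2 t tT.
have C1 := s1.1; have C2 := s2.1.
pose eta1 s x := theta1 s x - (pi - x) / pi * f s.
pose eta2 s x := theta2 s x - (pi - x) / pi * f s.
have L1 s : 0 <= s <= T -> L2 (eta1 s) by move=> sT; have /CL2P[+ _] := C1; apply.
have L2' s : 0 <= s <= T -> L2 (eta2 s) by move=> sT; have /CL2P[+ _] := C2; apply.
have mode n s : 0 <= s <= T -> L2inner (eta1 s) (sine n) - L2inner (eta2 s) (sine n) = 0.
  have c1 := CL2_inner_continuous C1 (L2_sine n).
  have c2 := CL2_inner_continuous C2 (L2_sine n).
  have ce : {within `[0, T], continuous (fun s => L2inner (eta1 s) (sine n) - L2inner (eta2 s) (sine n))}.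
    by move=> z; apply: cvgB; [exact: c1|exact: c2].
  apply: (volterra_unique iN T0 (sqr_ge0 n.+1%:R) ce) => {}s sT.
  have /andP[s0 sT'] := sT.
  have [a [B [ca aB aE]]] := relax_a_extension iN T0.
  have ia (u : R -> R) : {within `[0, T], continuous u} ->
      mu.-integrable `]0, s[ (EFin \o (fun r => relax_a N (s - r) * u r)).
    move=> cu; have iu : mu.-integrable `]0, s[ (EFin \o u).
      exact: integrable_itv_sub (lexx 0) sT' (continuous_integrable_itv cu).
    have h : mu.-integrable `]0, s[ (EFin \o (fun r => u r * a (s - r))).
      apply: (@integrable_mul_bounded R _ _ _ B) => //.
      by apply: measurable_reflect; exact: continuous_measurable_fun.
    apply: eq_integrable h => // r; rewrite inE/= in_itv/= => /andP[r0 rs].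
    by rewrite /= aE 1?mulrC// subr_ge0 (ltW rs)/= lerBlDr (le_trans sT')// lerDl ltW.
  have e1 := solution_mode n s1 sT; have e2 := solution_mode n s2 sT.
  rewrite /= in e1 e2; rewrite {1}/eta1 {1}/eta2 e1 e2.
  rewrite [X in _ = - (_ * X)](_ : _ =
     \int[mu]_(r in `]0, s[) (relax_a N (s - r) * L2inner (eta1 r) (sine n)) -
     \int[mu]_(r in `]0, s[) (relax_a N (s - r) * L2inner (eta2 r) (sine n))); last first.
    rewrite -RintegralB//; [|exact: ia|exact: ia].
    by apply: eq_Rintegral => r _; rewrite mulrBr.
  rewrite /eta1 /eta2; move: (\int[mu]_(_ in _) _) (\int[mu]_(_ in _) _) (L2inner _ _) => J1 J2 l.
  by ring.
have hmode n : L2inner (fun x => eta1 t x - eta2 t x) (sine n) = 0.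
  by rewrite L2innerBl ?mode//; [exact: L1|exact: L2'|exact: L2_sine].
have := sine_complete (L2B (L1 t tT) (L2' t tT)) hmode.
apply: filterS; first exact: (ae_filter_ringOfSetsType mu).
move=> x /= h xI; apply/eqP; rewrite -subr_eq0 -[X in _ == X](h xI); apply/eqP.
by rewrite /eta1 /eta2; ring.
Qed.

End uniqueness.

(** * Assembly of existence and uniqueness *)

Lemma Re_laplace {R : realType} (N : R -> R) (w : R) :
  complex.Re (laplace N (1 +i* w)%C) =
  \int[leb R]_(r in `]0, +oo[) (expR (- r) * N r * cos (w * r)).
Proof. by apply: eq_Rintegral => r _; rewrite /= mulN1r mulrAC. Qed.

Theorem mainTheorem1 (R : realType) (N : R -> R) (T : R) (f : R -> R) :
  kernel_assumptions N -> 0 < T -> C1_on T f -> f 0 = 0 ->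
  (exists theta : R -> R -> R, is_solution N T f theta /\ CL2 T theta) /\
  (forall theta1 theta2 : R -> R -> R,
     is_solution N T f theta1 -> is_solution N T f theta2 ->
     forall t, t \in `[0, T] -> L2eq (theta1 t) (theta2 t)).
Proof.
move=> [iN [iM [_ [Mpos _]]]] T0 [cf [df [g cg gE]]] f0.
split; last first.
  move=> theta1 theta2 s1 s2 t; rewrite mem_itvcc.
  exact: solution_unique (iN T T0) T0 s1 s2 t.
have T0' := ltW T0.
(* Constant continuation outside [0, T]; since f 0 = 0 it vanishes for t <= 0 and is causal. *)
pose F t := f (clamp T t).
have cF : causal F.
  split=> [|t t0]; first exact: continuous_clamp.
  by rewrite /F clamp_neg.
have FE t : 0 <= t <= T -> f t = F t by move=> tT; rewrite /F clamp_id.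
(* Restricted to interior times, since the continuation may have corners at 0 and T. *)
have dF (t : R) : 0 < t < T -> is_derive t 1 F (g t).
  move=> tT; have tT' : t \in `]0, T[ by rewrite inE/= in_itv.
  have nF : \near t, f t = F t.
    have tI : t \in Interval (BRight 0) (BLeft T) by rewrite in_itv/=.
    have := near_in_itvoo tI; apply: filterS => s.
    rewrite in_itv/= => /andP[s0 sT]; apply: FE; by rewrite !ltW.
  apply: (near_eq_is_derive nF).
  by apply: DeriveDef; [exact: df|rewrite -gE// derive1E].
have [Bf Bf0 HBf] := continuous_bounded_itv cf.
have FB t : `|F t| <= Bf by apply: HBf; exact: clamp_itv.
have [G G0 HG] := continuous_bounded_itv cg.
have lt01 : 0 < complex.Re (1 +i* 0 : R[i])%C by rewrite /= ltr01.
have iM1 : (leb R).-integrable `]0, +oo[ (EFin \o (fun r => expR (- r) * N r)).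
  apply: eq_integrable (iM _ lt01) => // r _ /=; by rewrite mulN1r.
have Mpos1 w : 0 <= \int[leb R]_(r in `]0, +oo[) (expR (- r) * N r * cos (w * r)).
  by rewrite -Re_laplace ltW// Mpos//= ltr01.
have /choice[Y HY] : forall n, exists y, causal y /\
    forall t, y t = F t - n.+1%:R ^+ 2 * convol `]0, T[ N (primitive y) t.
  move=> n; have k0 : 0 <= n.+1%:R ^+ 2 :> R by exact: sqr_ge0.
  by have := volterra_exists (iN T T0) cF k0 FB.
(* One constant for the datum and for all modes; the index n does not occur in it. *)
pose C := Bf + expR T * (1 + G ^+ 2 * T).
have e0 : 0 <= expR T * (1 + G ^+ 2 * T).
  by rewrite mulr_ge0 ?expR_ge0// addr_ge0// mulr_ge0// sqr_ge0.
apply: (@exists_solution R N F f T C Y (iN T T0) T0 _ _ _ _ cf FE).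
- by move=> n; have [] := HY n.
- by move=> n t; have [_] := HY n.
- move=> n t tT; have [cy yE] := HY n.
  apply: le_trans (energy_bound (iN T T0) T0 iM1 Mpos1 cy (sqr_ge0 _) yE dF cg HG tT) _.
  by rewrite lerDr.
- by move=> t _; apply: le_trans (FB t) _; rewrite lerDl.
Qed.
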